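(* Let $H=H_1\sqcup H_2\subset\mathbb{R}^3$ be the Hopf link with $H_1=\{(x,y,0)\in\mathbb{R}^3\mid x^2+y^2=1\}$ and $H_2=\{(0,y,z)\in\mathbb{R}^3\mid (y-1)^2+z^2=1\}$. The ring group $R(\mathbb{R}^3,H)$ of the Hopf link admits the presentation $$\langle \tau_H, s \mid \tau_H^4=1,\ s^2=\tau_H^2,\ s\tau_H s^{-1}=\tau_H^{-1}\rangle,$$ where $\tau_H$ and $s$ are the elements of $R(\mathbb{R}^3,H)$ defined in the context.
   Context: A ring in $\mathbb{R}^3$ is a round Euclidean circle lying in a plane of $\mathbb{R}^3$. A ring link in a $3$-manifold $M\subset\mathbb{R}^3$ is a link in $M$ each of whose components is a ring. Ring links are topologized by the (unordered) data of centers, radii and planes of their components. Two ring links $L,L'$ in $M$ are equivalent if there is an isotopy $\{L_t\}_{t\in[0,1]}$ through ring links in $M$ with $L_0=L$, $L_1=L'$. $\mathcal{R}(M,L)$ is the space of all ring links in $M$ equivalent (as ring links in $M$) to $L$, with base point $L$, and the ring group is $R(M,L)=\pi_1(\mathcal{R}(M,L))$. A loop in $\mathcal{R}(M,L)$ based at $L$ is a ring motion $\{L_t\}_{t\in[0,1]}$ of $L$ in $M$ (so $L_0=L_1=L$); elements of $R(M,L)$ are homotopy classes of ring motions and the product is concatenation. Let $R_x(\varphi),R_y(\varphi),R_z(\varphi)$ be the counterclockwise rotations of $\mathbb{R}^3$ by angle $\varphi$ about the $x$-, $y$-, $z$-axis: $R_x(\varphi)(x,y,z)=(x,\,y\cos\varphi-z\sin\varphi,\,y\sin\varphi+z\cos\varphi)$,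 $R_y(\varphi)(x,y,z)=(x\cos\varphi+z\sin\varphi,\,y,\,-x\sin\varphi+z\cos\varphi)$, $R_z(\varphi)(x,y,z)=(x\cos\varphi-y\sin\varphi,\,x\sin\varphi+y\cos\varphi,\,z)$. $\tau_H$ is the class of $\{R_y(\pi t)(H)\}_{t\in[0,1]}$ (rotation by $180$ degrees about the $y$-axis). With $e_2=(0,1,0)$, $s$ is the class of the ring motion of $H$, which interchanges $H_1$ and $H_2$, obtained by performing successively (each gradually in time): translate $H$ along $-\tfrac12 e_2$; rotate by $45$ degrees about the $y$-axis; rotate by $180$ degrees about the $x$-axis; rotate by $-45$ degrees about the $y$-axis; translate along $\tfrac12 e_2$. *)

(* Defs.v *)
From HB Require Import structures.
From mathcomp Require Import all_boot all_order all_algebra perm.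
From mathcomp Require Import all_classical all_reals.
From mathcomp Require Import topology normedtype sequences realfun trigo.
From mathcomp Require Import homotopy ring lra.
Set Implicit Arguments.
Unset Strict Implicit.
Unset Printing Implicit Defensive.
Import Order.TTheory GRing.Theory Num.Theory numFieldNormedType.Exports.

Local Open Scope classical_set_scope.
Local Open Scope ring_scope.
Local Open Scope quotient_scope.

Definition unit_interval (R : realType) : Type := (`[0%R, 1%R]%classic : set R).

Section UnitInterval.
Variable R : realType.
Local Notation I := (unit_interval R).

HB.instance Definition _ := Topological.on I.
HB.instance Definition _ := SubChoice.on I.

Lemma clampP (x : R) : Num.max 0 (Num.min 1 x) \in (`[0%R, 1%R]%classic : set R).
Proof.
by rewrite mem_setE in_itv/= le_max lexx/= ge_max ler01 ge_min lexx.
Qed.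

(* The retraction of the line onto the unit interval. *)
Definition clamp (x : R) : I :=
  exist (fun y => y \in (`[0%R, 1%R]%classic : set R)) _ (clampP x).

Lemma uival_ge0 (t : I) : 0 <= val t.
Proof. by case: t => x /= /set_mem/=; rewrite in_itv/= => /andP[]. Qed.

Lemma uival_le1 (t : I) : val t <= 1.
Proof. by case: t => x /= /set_mem/=; rewrite in_itv/= => /andP[]. Qed.

Lemma clampE (x : R) : 0 <= x <= 1 -> val (clamp x) = x.
Proof. by move=> /andP[x0 x1] /=; rewrite min_r// max_r. Qed.

Lemma valK_clamp : cancel val clamp.
Proof. by move=> t; apply: val_inj; rewrite clampE// uival_ge0 uival_le1. Qed.

Lemma val_continuous : continuous (val : I -> R).
Proof. exact: initial_continuous. Qed.

Lemma clamp_continuous : continuous clamp.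
Proof.
apply: continuous_comp_initial => x.
apply: (@continuous_max _ _ (cst 0)); first exact: cst_continuous.
by apply: (@continuous_min _ _ (cst 1)); [exact: cst_continuous|exact: cvg_id].
Qed.

Lemma clamp01 : clamp 0 != clamp 1.
Proof.
by apply/eqP => /(congr1 val); rewrite !clampE ?lexx ?ler01// => /eqP; rewrite eq_sym oner_eq0.
Qed.

HB.instance Definition _ := isBiPointed.Build I clamp01.

Lemma val_zero : val (zero : I) = 0.
Proof. by rewrite clampE// lexx ler01. Qed.
Lemma val_one : val (one : I) = 1.
Proof. by rewrite clampE// lexx ler01. Qed.

End UnitInterval.

Section Continuity.
Variables (R : realType) (Y X : topologicalType).
Implicit Types c d : Y -> R.

Lemma ctsD c d : continuous c -> continuous d -> continuous (fun y => c y + d y).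
Proof. by move=> cc cd y; apply: cvgD; [exact: cc|exact: cd]. Qed.

Lemma ctsB c d : continuous c -> continuous d -> continuous (fun y => c y - d y).
Proof. by move=> cc cd y; apply: cvgB; [exact: cc|exact: cd]. Qed.

Lemma ctsM c d : continuous c -> continuous d -> continuous (fun y => c y * d y).
Proof. by move=> cc cd y; apply: cvgM; [exact: cc|exact: cd]. Qed.

Lemma cts_opp (V : normedModType R) (f : Y -> V) :
  continuous f -> continuous (fun y => - f y).
Proof. by move=> cf y; apply: cvgN; exact: cf. Qed.

Lemma cts_add (V : normedModType R) (f g : Y -> V) :
  continuous f -> continuous g -> continuous (fun y => f y + g y).
Proof. by move=> cf cg y; apply: cvgD; [exact: cf|exact: cg]. Qed.

Lemma cts_sub (V : normedModType R) (f g : Y -> V) :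
  continuous f -> continuous g -> continuous (fun y => f y - g y).
Proof. by move=> cf cg y; apply: cvgB; [exact: cf|exact: cg]. Qed.

Lemma cts_scale (V : normedModType R) c (v : V) :
  continuous c -> continuous (fun y => c y *: v).
Proof. by move=> cc y; apply: cvgZr_tmp; exact: cc. Qed.

Lemma cts_max c d :
  continuous c -> continuous d -> continuous (fun y => Num.max (c y) (d y)).
Proof.
by move=> cc cd y; apply: (@continuous_max _ _ c d y); [exact: cc|exact: cd].
Qed.

Lemma cts_min c d :
  continuous c -> continuous d -> continuous (fun y => Num.min (c y) (d y)).
Proof.
by move=> cc cd y; apply: (@continuous_min _ _ c d y); [exact: cc|exact: cd].
Qed.

Lemma cts_comp (Z : topologicalType) (f : Y -> X) (g : X -> Z) :
  continuous f -> continuous g -> continuous (fun y => g (f y)).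
Proof. by move=> cf cg y; apply: continuous_comp; [exact: cf|exact: cg]. Qed.

Lemma cts_pair (Z : topologicalType) (f : Y -> X) (g : Y -> Z) :
  continuous f -> continuous g -> continuous (fun y => (f y, g y)).
Proof. by move=> cf cg y; apply: cvg_pair; [exact: cf|exact: cg]. Qed.

Lemma cts_clamp c : continuous c -> continuous (fun y => clamp (c y)).
Proof.
move=> cc y; apply: (continuous_comp (f := c)); first exact: cc.
exact: clamp_continuous.
Qed.

Lemma cts_val (f : Y -> unit_interval R) :
  continuous f -> continuous (fun y => val (f y) : R).
Proof.
move=> cf y; apply: (continuous_comp (f := f)); first exact: cf.
exact: val_continuous.
Qed.

Lemma cts_cst (x : X) : continuous (fun _ : Y => x).
Proof. exact: cst_continuous. Qed.

Lemma cts_id : continuous (fun y : Y => y).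
Proof. by move=> y; exact: cvg_id. Qed.

Lemma cts_fst : continuous (fun p : Y * X => p.1).
Proof. by move=> p; exact: cvg_fst. Qed.

Lemma cts_snd : continuous (fun p : Y * X => p.2).
Proof. by move=> p; exact: cvg_snd. Qed.

End Continuity.

Ltac cts := repeat match goal with
  | |- continuous (fun _ => ?c) => exact: cts_cst
  | |- continuous (fun y => y) => exact: cts_id
  | |- continuous (fun p => fst p) => exact: cts_fst
  | |- continuous (fun p => snd p) => exact: cts_snd
  | |- continuous fst => exact: cts_fst
  | |- continuous snd => exact: cts_snd
  | |- continuous (fun y => (_, _)) => apply: cts_pair
  | |- continuous (fun y => clamp _) => apply: cts_clamp
  | |- continuous (fun y => _ - _) => apply: ctsB
  | |- continuous (fun y => _ + _) => apply: ctsD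
  | |- continuous (fun y => _ * _) => apply: ctsM
  | |- continuous (fun y => Num.max _ _) => apply: cts_max
  | |- continuous (fun y => Num.min _ _) => apply: cts_min
  | |- _ => assumption
  | |- _ => exact: cts_fun
  | |- continuous ( *%R _) => apply: ctsM
  | |- continuous id => exact: cts_id
  | |- _ => apply: cts_val
  end.

Section Glue.
Variables (R : realType) (Y X : topologicalType).

Lemma glue_continuous (c : Y -> R) (a : R) (f g : Y -> X) :
  continuous c -> continuous f -> continuous g ->
  (forall y, c y = a -> f y = g y) ->
  continuous (fun y => if c y <= a then f y else g y).
Proof.
move=> cc cf cg fg; set h := fun y => _.
apply/continuous_subspace_setT.
have -> : setT = [set y | c y <= a] `|` [set y | a <= c y].
  by apply/seteqP; split=> // y _ /=; apply/orP; exact: le_total.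
apply: withinU_continuous.
- by apply: (@closed_comp _ _ c [set r | r <= a]) => [? _|]; [exact: cc|exact: closed_le].
- by apply: (@closed_comp _ _ c [set r | a <= r]) => [? _|]; [exact: cc|exact: closed_ge].
- apply: (subspace_eq_continuous (f := f)); last exact: continuous_subspaceT.
  by move=> y /set_mem/= ya; rewrite /from_subspace /h ya.
- apply: (subspace_eq_continuous (f := g)); last exact: continuous_subspaceT.
  move=> y /set_mem/= ya; rewrite /from_subspace /h; case: ifPn => // ya'.
  by rewrite fg//; apply/eqP; rewrite eq_le ya ya'.
Qed.

End Glue.

Section FundamentalGroup.
Variables (R : realType) (X : topologicalType).
Local Notation I := (unit_interval R).

(* Homotopy relative to the end points. *)
Definition homotopic (x y : X) (f g : {path I from x to y}) : Prop :=
  exists h : I -> I -> X, [/\ continuous (fun p : I * I => h p.1 p.2),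
    forall t, h zero t = f t, forall t, h one t = g t,
    forall s, h s zero = x & forall s, h s one = y].

Section Homotopy.
Variables (x y : X).
Implicit Types f g h : {path I from x to y}.

Lemma homotopic_eq f g : f =1 g -> homotopic f g.
Proof.
move=> fg; exists (fun _ t => f t); split=> [|t|t|s|s].
- by apply: (cts_comp (g := f)); cts.
- by [].
- exact: fg.
- exact: path_zero.
- exact: path_one.
Qed.

Lemma homotopic_refl f : homotopic f f.
Proof. exact: homotopic_eq. Qed.

Lemma homotopic_sym f g : homotopic f g -> homotopic g f.
Proof.
move=> [h [ch h0 h1 hx hy]].
exists (fun s t => h (clamp (1 - val s)) t); split => // [|t|t].
- apply: (cts_comp (f := fun p : I * I => (clamp (1 - val p.1), p.2)) _ ch).
  by cts.
- by rewrite val_zero subr0 h1.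
- by rewrite val_one subrr h0.
Qed.

Lemma homotopic_trans f g k : homotopic f g -> homotopic g k -> homotopic f k.
Proof.
move=> [h [ch h0 h1 hx hy]] [l [cl l0 l1 lx ly]].
have c2 b : continuous (fun p : I * I => (clamp (2 * val p.1 - b), p.2)).
  by cts.
exists (fun s t => if val s <= 2^-1 then h (clamp (2 * val s - 0)) t
                   else l (clamp (2 * val s - 1)) t); split=> [|t|t|s|s].
- apply: glue_continuous.
  + by cts.
  + exact: (cts_comp (c2 0) ch).
  + exact: (cts_comp (c2 1) cl).
  + by move=> p ->; rewrite mulfV ?pnatr_eq0// subr0 subrr [h _ _]h1 [l _ _]l0.
- by rewrite val_zero invr_ge0 ler0n mulr0 subr0 [LHS]h0.
- rewrite val_one leNgt invf_lt1// ltr1n/=.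
  by rewrite mulr1 addrK [LHS]l1.
- by case: ifP.
- by case: ifP.
Qed.

(* A path may be reparameterized freely: the straight line between two
   reparameterizations with the same ends is a homotopy. *)
Lemma homotopic_reparam (a b : X) (k : {path I from a to b}) (u v : R -> R) f g :
  continuous u -> continuous v ->
  (forall t, 0 <= t <= 1 -> 0 <= u t <= 1) ->
  (forall t, 0 <= t <= 1 -> 0 <= v t <= 1) ->
  u 0 = v 0 -> u 1 = v 1 ->
  (forall t : I, f t = k (clamp (u (val t)))) ->
  (forall t : I, g t = k (clamp (v (val t)))) -> homotopic f g.
Proof.
move=> cu cv u01 v01 uv0 uv1 fk gk.
exists (fun s t => k (clamp ((1 - val s) * u (val t) + val s * v (val t)))); split.
- apply: (cts_comp (g := k)); cts.
  + by apply: (cts_comp (g := u)); cts.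
  + by apply: (cts_comp (g := v)); cts.
- by move=> t; rewrite val_zero subr0 mul1r mul0r addr0 fk.
- by move=> t; rewrite val_one subrr mul1r mul0r add0r gk.
- move=> s; rewrite val_zero -uv0 -mulrDl subrK mul1r -[RHS](path_zero (s := f)).
  by rewrite fk val_zero.
- move=> s; rewrite val_one -uv1 -mulrDl subrK mul1r -[RHS](path_one (s := f)).
  by rewrite fk val_one.
Qed.

End Homotopy.

Section Concat.
Variables (x y z : X) (f : {path I from x to y}) (g : {path I from y to z}).

Definition concat_fun (t : I) : X :=
  if val t <= 2^-1 then f (clamp (2 * val t)) else g (clamp (2 * val t - 1)).

Lemma concat_continuous : continuous concat_fun.
Proof.
apply: glue_continuous; first by cts.
- by apply: (cts_comp (g := f)); cts.
- by apply: (cts_comp (g := g)); cts.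
- move=> t ->; rewrite mulfV ?pnatr_eq0// subrr.
  by rewrite [f _]path_one [g _]path_zero.
Qed.

Lemma concat_zero : concat_fun zero = x.
Proof. by rewrite /concat_fun val_zero invr_ge0 ler0n mulr0 [LHS]path_zero. Qed.

Lemma concat_one : concat_fun one = z.
Proof.
rewrite /concat_fun val_one leNgt invf_lt1// ltr1n/= mulr1 addrK.
by rewrite [LHS]path_one.
Qed.

Definition concat : {path I from x to z} :=
  mk_path concat_continuous concat_zero concat_one.

Lemma concatE (t : I) : concat t =
  if val t <= 2^-1 then f (clamp (2 * val t)) else g (clamp (2 * val t - 1)).
Proof. by []. Qed.

End Concat.

Section Reverse.
Variables (x y : X) (f : {path I from x to y}).

Definition reverse_fun (t : I) : X := f (clamp (1 - val t)).

Lemma reverse_continuous : continuous reverse_fun.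
Proof.
by apply: (cts_comp (g := f)); cts.
Qed.

Lemma reverse_zero : reverse_fun zero = y.
Proof. by rewrite /reverse_fun val_zero subr0 [LHS]path_one. Qed.

Lemma reverse_one : reverse_fun one = x.
Proof. by rewrite /reverse_fun val_one subrr [LHS]path_zero. Qed.

Definition reverse : {path I from y to x} :=
  mk_path reverse_continuous reverse_zero reverse_one.

Lemma reverseE (t : I) : reverse t = f (clamp (1 - val t)).
Proof. by []. Qed.

End Reverse.

Lemma concat_homotopic (x y z : X) (f f' : {path I from x to y})
    (g g' : {path I from y to z}) :
  homotopic f f' -> homotopic g g' -> homotopic (concat f g) (concat f' g').
Proof.
move=> [h [ch h0 h1 hx hy]] [l [cl l0 l1 lx ly]].
have c2 b : continuous (fun p : I * I => (p.1, clamp (2 * val p.2 - b))).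
  by cts.
exists (fun s t => if val t <= 2^-1 then h s (clamp (2 * val t - 0))
                   else l s (clamp (2 * val t - 1))); split=> [|t|t|s|s].
- apply: glue_continuous.
  + by cts.
  + exact: (cts_comp (c2 0) ch).
  + exact: (cts_comp (c2 1) cl).
  + by move=> p ->; rewrite mulfV ?pnatr_eq0// subr0 subrr [h _ _]hy [l _ _]lx.
- by rewrite subr0 h0 l0.
- by rewrite subr0 h1 l1.
- by rewrite val_zero invr_ge0 ler0n mulr0 subr0 [LHS]hx.
- rewrite val_one leNgt invf_lt1// ltr1n/= mulr1 addrK.
  by rewrite [LHS]ly.
Qed.

Lemma reverse_homotopic (x y : X) (f f' : {path I from x to y}) :
  homotopic f f' -> homotopic (reverse f) (reverse f').
Proof.
move=> [h [ch h0 h1 hx hy]].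
exists (fun s t => h s (clamp (1 - val t))); split=> [|t|t|s|s].
- apply: (cts_comp (f := fun p : I * I => (p.1, clamp (1 - val p.2))) _ ch).
  by cts.
- by rewrite h0.
- by rewrite h1.
- by rewrite val_zero subr0 [LHS]hy.
- by rewrite val_one subrr [LHS]hx.
Qed.

Variable x : X.
Local Notation loop := {path I from x to x}.

Definition cst_loop : loop := mk_path (@cst_continuous _ _ x) erefl erefl.

Lemma cst_concat (f : loop) : homotopic (concat cst_loop f) f.
Proof.
apply: (homotopic_reparam (k := f) (u := fun t => Num.max 0 (2 * t + -1)) (v := id)).
- by cts.
- exact: cts_id.
- by move=> t /andP[t0 t1]; rewrite le_max lexx/= ge_max ler01/=; lra.
- by [].
- by rewrite mulr0 add0r max_l// lerN10.
- by rewrite mulr1 addrK max_r.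
- move=> t; rewrite concatE; case: ifPn => t2.
    rewrite max_l; last by lra.
    by rewrite [RHS]path_zero.
  by rewrite max_r//; move: t2; rewrite -ltNge => ?; lra.
- by move=> t; rewrite valK_clamp.
Qed.

Lemma concat_cst (f : loop) : homotopic (concat f cst_loop) f.
Proof.
apply: (homotopic_reparam (k := f) (u := fun t => Num.min 1 (2 * t + 0)) (v := id)).
- by cts.
- exact: cts_id.
- by move=> t /andP[t0 t1]; rewrite ge_min lexx/= le_min ler01/=; lra.
- by [].
- by rewrite mulr0 add0r min_r.
- by rewrite mulr1 addr0 min_l// ler1n.
- move=> t; rewrite concatE; case: ifPn => t2.
    by rewrite addr0 min_r//; lra.
  rewrite min_l; last by move: t2; rewrite -ltNge => ?; lra.
  by rewrite [RHS]path_one.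
- by move=> t; rewrite valK_clamp.
Qed.

Lemma concat_reverse (f : loop) : homotopic (concat f (reverse f)) cst_loop.
Proof.
apply: (homotopic_reparam (k := f) (v := cst 0)
  (u := fun t => Num.min (2 * t + 0) (- 2 * t + 2))).
- by cts.
- by cts.
- by move=> t /andP[t0 t1]; rewrite ge_min le_min; lra.
- by move=> t _; rewrite lexx ler01.
- by rewrite !mulr0 !add0r min_l.
- by rewrite !mulr1 addr0 addNr min_r.
- move=> t; rewrite concatE; case: ifPn => t2.
    by rewrite addr0 min_l//; lra.
  move: t2; rewrite -ltNge => t2; have := uival_le1 t => t1.
  rewrite reverseE clampE; last by lra.
  rewrite min_r; last by lra.
  by congr (f (clamp _)); lra.
- by move=> t; rewrite [RHS]path_zero.
Qed.

Lemma reverse_reverse (f : loop) : homotopic f (reverse (reverse f)).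
Proof.
apply: homotopic_eq => t; rewrite !reverseE clampE; last by rewrite subr_ge0 uival_le1 gerBl uival_ge0.
by rewrite subKr valK_clamp.
Qed.

Lemma reverse_concat (f : loop) : homotopic (concat (reverse f) f) cst_loop.
Proof.
apply: (homotopic_trans (g := concat (reverse f) (reverse (reverse f)))).
  by apply: concat_homotopic; [exact: homotopic_refl|exact: reverse_reverse].
exact: concat_reverse.
Qed.

Lemma concatA (f g h : loop) :
  homotopic (concat f (concat g h)) (concat (concat f g) h).
Proof.
apply: (homotopic_reparam (k := concat (concat f g) h) (v := id)
  (u := fun t => Num.max (2^-1 * t + 0) (Num.max (1 * t + - 4^-1) (2 * t + - 1)))).
- by cts.
- exact: cts_id.
- by move=> t /andP[t0 t1]; rewrite !le_max !ge_max; lra.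
- by [].
- by rewrite !mulr0 !add0r !maxEle; case: ifP; case: ifP; lra.
- by rewrite !mulr1 !maxEle; case: ifP; case: ifP; lra.
- move=> t; have t0 := uival_ge0 t; have t1 := uival_le1 t.
  set w := Num.max _ _.
  have w01 : 0 <= w <= 1.
    by rewrite /w !le_max !ge_max; lra.
  rewrite [RHS]concatE clampE// [LHS]concatE.
  have [t2|t2] := leP (val t) 2^-1.
    have -> : w = 2^-1 * val t.
      by rewrite /w !maxEle; case: ifP; case: ifP; lra.
    rewrite ifT; last by lra.
    rewrite concatE clampE; last by lra.
    rewrite ifT; last by lra.
    by congr (f (clamp _)); lra.
  rewrite concatE clampE; last by lra.
  have [t3|t3] := leP (2 * val t - 1) 2^-1.
    have -> : w = val t - 4^-1.
      by rewrite /w !maxEle; case: ifP; case: ifP; lra.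
    rewrite ifT; last by lra.
    rewrite concatE clampE; last by lra.
    rewrite ifF; last by apply/negbTE; rewrite -ltNge; lra.
    by congr (g (clamp _)); lra.
  have -> : w = 2 * val t - 1.
    by rewrite /w !maxEle; case: ifP; case: ifP; lra.
  rewrite ifF; last by apply/negbTE; rewrite -ltNge; lra.
  by [].
- by move=> t; rewrite valK_clamp.
Qed.

Definition homotopicb (f g : loop) : bool := `[< homotopic f g >].

Lemma homotopicb_refl : reflexive homotopicb.
Proof. by move=> f; apply/asboolP; exact: homotopic_refl. Qed.

Lemma homotopicb_sym : symmetric homotopicb.
Proof. by move=> f g; apply/asboolP/asboolP => /homotopic_sym. Qed.

Lemma homotopicb_trans : transitive homotopicb.
Proof.
move=> g f h /asboolP fg /asboolP gh; apply/asboolP.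
exact: homotopic_trans fg gh.
Qed.

Canonical homotopic_equiv :=
  EquivRel homotopicb homotopicb_refl homotopicb_sym homotopicb_trans.

Definition pi1 : Type := {eq_quot homotopic_equiv}.

HB.instance Definition _ := Choice.on pi1.
HB.instance Definition _ := EqQuotient.on pi1.

Definition homotopy_class (f : loop) : pi1 := \pi_pi1 f.

Lemma homotopy_classP (f g : loop) :
  homotopy_class f = homotopy_class g <-> homotopic f g.
Proof. by split=> [/eqmodP/asboolP//|fg]; apply/eqmodP/asboolP. Qed.

(* a * b runs through a first and then through b. *)
Definition pi1_mul (a b : pi1) : pi1 := homotopy_class (concat (repr a) (repr b)).
Definition pi1_inv (a : pi1) : pi1 := homotopy_class (reverse (repr a)).
Definition pi1_one : pi1 := homotopy_class cst_loop.

Lemma pi1_mulE (f g : loop) :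
  pi1_mul (homotopy_class f) (homotopy_class g) = homotopy_class (concat f g).
Proof.
by apply/homotopy_classP; apply: concat_homotopic; apply/homotopy_classP;
  rewrite /homotopy_class reprK.
Qed.

Lemma pi1_invE (f : loop) :
  pi1_inv (homotopy_class f) = homotopy_class (reverse f).
Proof.
by apply/homotopy_classP; apply: reverse_homotopic; apply/homotopy_classP;
  rewrite /homotopy_class reprK.
Qed.

Lemma homotopy_classK (a : pi1) : exists f, a = homotopy_class f.
Proof. by exists (repr a); rewrite /homotopy_class reprK. Qed.

Lemma pi1_mulA : associative pi1_mul.
Proof.
move=> a b c; have [f ->] := homotopy_classK a; have [g ->] := homotopy_classK b.
have [h ->] := homotopy_classK c; rewrite !pi1_mulE.
by apply/homotopy_classP; exact: concatA.
Qed.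

Lemma pi1_mul1 : left_id pi1_one pi1_mul.
Proof.
move=> a; have [f ->] := homotopy_classK a; rewrite pi1_mulE.
by apply/homotopy_classP; exact: cst_concat.
Qed.

Lemma pi1_1mul : right_id pi1_one pi1_mul.
Proof.
move=> a; have [f ->] := homotopy_classK a; rewrite pi1_mulE.
by apply/homotopy_classP; exact: concat_cst.
Qed.

Lemma pi1_mulV : left_inverse pi1_one pi1_inv pi1_mul.
Proof.
move=> a; have [f ->] := homotopy_classK a; rewrite pi1_invE pi1_mulE.
by apply/homotopy_classP; exact: reverse_concat.
Qed.

Lemma pi1_Vmul : right_inverse pi1_one pi1_inv pi1_mul.
Proof.
move=> a; have [f ->] := homotopy_classK a; rewrite pi1_invE pi1_mulE.
by apply/homotopy_classP; exact: concat_reverse.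
Qed.

HB.instance Definition _ :=
  isGroup.Build pi1 pi1_mulA pi1_mul1 pi1_1mul pi1_mulV pi1_Vmul.

End FundamentalGroup.

Section Presentation.
Variable I : Type.

(* (i, true) stands for the generator i and (i, false) for its inverse. *)
Definition word : Type := seq (I * bool).

(* The least congruence on words that cancels inverse letters and contains E;
   its classes form the group presented by < I | u = v, (u, v) in E >. *)
Inductive word_congruence (E : set (word * word)) : word -> word -> Prop :=
| wc_refl u : word_congruence E u u
| wc_sym u v : word_congruence E u v -> word_congruence E v u
| wc_trans u v w :
    word_congruence E u v -> word_congruence E v w -> word_congruence E u w
| wc_cat u u' v v' : word_congruence E u u' -> word_congruence E v v' ->
    word_congruence E (u ++ v) (u' ++ v')
| wc_cancel i b : word_congruence E [:: (i, b); (i, ~~ b)] [::]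
| wc_rel u v : E (u, v) -> word_congruence E u v.

Definition eval_letter (G : groupType) (x : I -> G) (l : I * bool) : G :=
  if l.2 then x l.1 else ((x l.1)^-1)%g.

Definition eval_word (G : groupType) (x : I -> G) (w : word) : G :=
  foldr (fun l g => eval_letter x l * g)%g 1%g w.

(* G admits the presentation < I | E >, the generator i being x i: evaluation
   of words at x induces an isomorphism from the presented group onto G. *)
Definition has_presentation (G : groupType) (x : I -> G)
    (E : set (word * word)) : Prop :=
  (forall g : G, exists w, eval_word x w = g) /\
  (forall u v, eval_word x u = eval_word x v <-> word_congruence E u v).

End Presentation.

Section EuclideanSpace.
Variable R : realType.
Local Notation vec := 'rV[R]_3.
Implicit Types (u v w x y : vec) (t phi : R).

Definition vec3 (a b c : R) : vec := \row_i [:: a; b; c]`_i.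

Definition px v : R := v 0 0.
Definition py v : R := v 0 1.
Definition pz v : R := v 0 2%:R.

Definition dot u v : R := \sum_i u 0 i * v 0 i.

Definition rotx phi v : vec :=
  vec3 (px v) (py v * cos phi - pz v * sin phi) (py v * sin phi + pz v * cos phi).
Definition roty phi v : vec :=
  vec3 (px v * cos phi + pz v * sin phi) (py v) (- px v * sin phi + pz v * cos phi).

Lemma px_vec3 a b c : px (vec3 a b c) = a. Proof. by rewrite /px mxE. Qed.
Lemma py_vec3 a b c : py (vec3 a b c) = b. Proof. by rewrite /py mxE. Qed.
Lemma pz_vec3 a b c : pz (vec3 a b c) = c. Proof. by rewrite /pz mxE. Qed.

Lemma pD u v : (px (u + v) = px u + px v) * (py (u + v) = py u + py v) *
  (pz (u + v) = pz u + pz v).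
Proof. by rewrite /px /py /pz !mxE. Qed.

Lemma pN v : (px (- v) = - px v) * (py (- v) = - py v) * (pz (- v) = - pz v).
Proof. by rewrite /px /py /pz !mxE. Qed.

Lemma p0 : (px 0 = 0) * (py 0 = 0) * (pz 0 = 0).
Proof. by rewrite /px /py /pz !mxE. Qed.

Lemma pZ a v : (px (a *: v) = a * px v) * (py (a *: v) = a * py v) *
  (pz (a *: v) = a * pz v).
Proof. by rewrite /px /py /pz !mxE. Qed.

Definition pE := (px_vec3, py_vec3, pz_vec3, pD, pN, p0, pZ).

Lemma vecP u v : px u = px v -> py u = py v -> pz u = pz v -> u = v.
Proof.
move=> uv0 uv1 uv2; apply/rowP => -[[|[|[|//]]] i3].
- by rewrite (_ : Ordinal i3 = 0)//; exact: val_inj.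
- by rewrite (_ : Ordinal i3 = 1)//; exact: val_inj.
- by rewrite (_ : Ordinal i3 = 2%:R)//; exact: val_inj.
Qed.

Lemma dotE u v : dot u v = px u * px v + py u * py v + pz u * pz v.
Proof.
rewrite /dot !big_ord_recl big_ord0 addr0 addrA /px /py /pz.
by congr (_ + u _ _ * v _ _ + u _ _ * v _ _); exact: val_inj.
Qed.

(* A Euclidean isometry of space. *)
Definition isometry (g : vec -> vec) : Prop :=
  bijective g /\
  forall x y, dot (g x - g y) (g x - g y) = dot (x - y) (x - y).

Lemma isometry_id : isometry id.
Proof. by split=> //; exists id. Qed.

Lemma isometry_comp (g h : vec -> vec) :
  isometry g -> isometry h -> isometry (g \o h).
Proof.
by move=> [bg dg] [bh dh]; split=> [|x y]; [exact: bij_comp|rewrite /= dg dh].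
Qed.

Lemma isometry_shift v : isometry (+%R^~ v).
Proof.
split=> [|x y]; last by rewrite opprD addrACA subrr addr0.
by exists (+%R^~ (- v)) => x; rewrite ?addrK ?subrK.
Qed.

Lemma rotxK phi : cancel (rotx phi) (rotx (- phi)).
Proof.
move=> v; have cs := sin2cos2 phi.
by apply: vecP; rewrite !pE// sinN cosN; ring: cs.
Qed.

Lemma rotyK phi : cancel (roty phi) (roty (- phi)).
Proof.
move=> v; have cs := sin2cos2 phi.
by apply: vecP; rewrite !pE// sinN cosN; ring: cs.
Qed.

Lemma isometry_rotx phi : isometry (rotx phi).
Proof.
split=> [|x y].
  by exists (rotx (- phi)); [|rewrite -{2}[phi]opprK]; exact: rotxK.
by have cs := sin2cos2 phi; rewrite !dotE !pE; ring: cs.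
Qed.

Lemma isometry_roty phi : isometry (roty phi).
Proof.
split=> [|x y].
  by exists (roty (- phi)); [|rewrite -{2}[phi]opprK]; exact: rotyK.
by have cs := sin2cos2 phi; rewrite !dotE !pE; ring: cs.
Qed.

Lemma isometry_dot (g : vec -> vec) (a b c d : vec) : isometry g ->
  dot (g a - g b) (g c - g d) = dot (a - b) (c - d).
Proof.
move=> [_ dg].
have key u v w x : 2 * dot (u - v) (w - x) =
    dot (u - x) (u - x) + dot (v - w) (v - w)
    - dot (u - w) (u - w) - dot (v - x) (v - x).
  by rewrite !dotE !pE; ring.
by apply: (@mulfI _ 2); rewrite ?pnatr_eq0// !key !dg.
Qed.

Lemma cts_vec3 (Y : topologicalType) (a b c : Y -> R) :
  continuous a -> continuous b -> continuous c ->
  continuous (fun s => vec3 (a s) (b s) (c s)).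
Proof.
move=> ca cb cc s A [P nP PA]; apply: filterS; first exact: PA.
apply: filter_forall => i; apply: filter_forall => j.
have := nP i j; rewrite /vec3 mxE => nPij; near=> z; rewrite mxE; near: z.
move: nPij; case: j => -[|[|[|//]]] j3 /=; [exact: ca|exact: cb|exact: cc].
Unshelve. all: by end_near. Qed.

Lemma cts_coord (Y : topologicalType) (f : Y -> vec) i :
  continuous f -> continuous (fun s => f s 0 i).
Proof.
by move=> cf; apply: (cts_comp (g := fun M : vec => M 0 i) cf); exact: coord_continuous.
Qed.

Lemma cts_rotx (Y : topologicalType) (c : Y -> R) (f : Y -> vec) :
  continuous c -> continuous f -> continuous (fun s => rotx (c s) (f s)).
Proof.
move=> cc cf; have ccos := cts_comp cc (@continuous_cos R).
have csin := cts_comp cc (@continuous_sin R).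
have cp i : continuous (fun s => f s 0 i) by exact: cts_coord.
by apply: cts_vec3; [exact: cp|apply: ctsB|apply: ctsD]; apply: ctsM => //; exact: cp.
Qed.

Lemma cts_roty (Y : topologicalType) (c : Y -> R) (f : Y -> vec) :
  continuous c -> continuous f -> continuous (fun s => roty (c s) (f s)).
Proof.
move=> cc cf; have ccos := cts_comp cc (@continuous_cos R).
have csin := cts_comp cc (@continuous_sin R).
have cp i : continuous (fun s => f s 0 i) by exact: cts_coord.
apply: cts_vec3; [apply: ctsD|exact: cp|apply: ctsD]; apply: ctsM => //; try exact: cp.
by apply: cts_opp; exact: cp.
Qed.

End EuclideanSpace.

Section RingLinks.
Variable R : realType.
Local Notation vec := 'rV[R]_3.
Local Notation I := (unit_interval R).

(* A ring is recorded by its center, its radius and a unit normal vector of its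
   plane; the normal is only determined up to sign. *)
Definition frame : Type := (vec * R * vec)%type.
HB.instance Definition _ := Topological.on frame.
Implicit Type p q : frame.

Definition center p : vec := p.1.1.
Definition radius p : R := p.1.2.
Definition normal p : vec := p.2.

Definition plane p : set vec := [set x | dot (normal p) (x - center p) = 0].
Definition ring_of p : set vec :=
  [set x | plane p x /\ dot (x - center p) (x - center p) = radius p ^+ 2].

Definition is_frame p : Prop := 0 < radius p /\ dot (normal p) (normal p) = 1.

Definition same_ring p q : Prop :=
  [/\ center p = center q, radius p = radius q & plane p = plane q].

Section Config.
Variables (M : set vec) (k : nat).

(* Ordered families of k disjoint rings in M. *)
Definition config : set {ptws 'I_k -> frame} :=
  [set d | [/\ forall i, is_frame (d i), forall i, ring_of (d i) `<=` M &
    forall i j, i != j -> ring_of (d i) `&` ring_of (d j) = set0]].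

(* Equality of the unordered data of centers, radii and planes. *)
Definition same_link (d e : config) : bool :=
  `[< exists s : {perm 'I_k}, forall i, same_ring (val d i) (val e (s i)) >].

Lemma same_link_refl : reflexive same_link.
Proof. by move=> d; apply/asboolP; exists 1%g => i; rewrite perm1. Qed.

Lemma same_link_sym : symmetric same_link.
Proof.
have H d e : same_link d e -> same_link e d.
  move=> /asboolP[s ds]; apply/asboolP; exists (s^-1)%g => i.
  by have [] := ds ((s^-1)%g i); rewrite permKV.
by move=> d e; apply/idP/idP; exact: H.
Qed.

Lemma same_link_trans : transitive same_link.
Proof.
move=> e d f /asboolP[s ds] /asboolP[t et]; apply/asboolP.
exists (s * t)%g => i; rewrite permM.
have [c r p] := ds i; have [c' r' p'] := et (s i).
by split; [rewrite c|rewrite r|rewrite p].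
Qed.

Canonical same_link_equiv :=
  EquivRel same_link same_link_refl same_link_sym same_link_trans.

(* The space of ring links in M with k components; k is constant along
   isotopies. *)
Definition ring_link : Type := quotient_topology {eq_quot same_link_equiv}.
HB.instance Definition _ := Topological.on ring_link.

Definition link_of (d : config) : ring_link := \pi_{eq_quot same_link_equiv} d.

Lemma link_ofP (d e : config) : link_of d = link_of e <-> same_link d e.
Proof. by split=> [/eqmodP|de]; [|apply/eqmodP]. Qed.

Lemma link_of_continuous : continuous link_of.
Proof. exact: pi_continuous. Qed.

(* Equivalence of ring links: isotopy through ring links in M. *)
Definition isotopic (L L' : ring_link) : Prop :=
  inhabited {path I from L to L'}.

Lemma isotopic_refl L : isotopic L L.
Proof. by split; exact: (mk_path (@cst_continuous _ _ L) erefl erefl). Qed.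

Definition ring_space (L : ring_link) : set ring_link := isotopic L.

Definition ring_base (L : ring_link) : ring_space L :=
  exist (fun L' => L' \in ring_space L) L (mem_set (isotopic_refl L)).

Definition ring_group (L : ring_link) : Type := pi1 R (ring_base L).
HB.instance Definition _ L := Group.on (ring_group L).

End Config.

(* g - g 0 is the linear part of the isometry g; by ring_act below, act g p is
   the image under g of the ring p. *)
Definition act (g : vec -> vec) p : frame :=
  (g (center p), radius p, g (normal p) - g 0).

Lemma ring_act (g : vec -> vec) p : isometry g ->
  ring_of (act g p) = g @` ring_of p.
Proof.
move=> ig; have [[h hK gK] dg] := ig; apply/seteqP; split=> y.
  rewrite -(gK y) => -[]; rewrite /plane /act/= /center/= dg => py0 yr.
  exists (h y) => //; split=> //; rewrite /plane/=.
  by rewrite isometry_dot// subr0 in py0.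
move=> [x [px0 xr] <-]; split; rewrite /plane/= /act /center/=.
  by rewrite isometry_dot// subr0.
by rewrite dg.
Qed.

Lemma is_frame_act (g : vec -> vec) p :
  isometry g -> is_frame p -> is_frame (act g p).
Proof. by move=> ig [r0 n1]; split=> //; rewrite isometry_dot// subr0. Qed.

Lemma config_act k (g : vec -> vec) (d : {ptws 'I_k -> frame}) :
  isometry g -> config setT d -> config setT (fun i => act g (d i)).
Proof.
move=> ig [fd _ dd]; split=> // [i|i j ij]; first exact: is_frame_act.
apply/seteqP; split=> // y; rewrite !ring_act// => -[[x xi <-] [x' xj]].
have [bg _] := ig; move=> /(bij_inj bg) xx'; rewrite xx' in xj.
by have : (ring_of (d i) `&` ring_of (d j)) x by []; rewrite dd.
Qed.

Definition transport k (g : vec -> vec) (ig : isometry g)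
    (d : config setT (k := k)) : config setT (k := k) :=
  exist (fun e => e \in config setT (k := k)) _
    (mem_set (config_act ig (set_mem (valP d)))).

(* A continuous family of isometries of space, starting at the identity. *)
Record motion := Motion {
  move :> R -> vec -> vec;
  move_isometry : forall t, isometry (move t);
  move_continuous : forall x, continuous (move^~ x);
  move0 : move 0 = id }.

Section RingMotion.
Variables (k : nat) (d : config setT (k := k)) (m : motion).

Definition moved (t : R) : ring_link setT k :=
  link_of (transport (move_isometry m t) d).

Lemma moved0 : moved 0 = link_of d.
Proof.
congr link_of; apply: val_inj => /=; apply/funext => i.
rewrite /act move0 /= subr0.
by case: (val d i) => -[].
Qed.

Lemma moved_continuous : continuous moved.
Proof.
apply: (cts_comp _ (@link_of_continuous _ _)).
apply: continuous_comp_initial => t; apply/cvg_sup => i.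
apply: (@continuous_comp_initial _ _ _ (fun f => f i)) => {}t.
rewrite /comp/= /act.
apply: cts_pair; last by apply: cts_sub; exact: move_continuous.
by apply: cts_pair; [exact: move_continuous|exact: cts_cst].
Qed.

Lemma moved_isotopic (t : R) : isotopic (link_of d) (moved t).
Proof.
split; apply: (@mk_path _ _ _ _ (fun s : I => moved (val s * t))).
- by apply: (cts_comp (f := fun s : I => val s * t) _ moved_continuous); cts.
- by rewrite val_zero mul0r moved0.
- by rewrite val_one mul1r.
Qed.

Hypothesis m1 : moved 1 = link_of d.

Definition motion_fun (t : I) : ring_space (link_of d) :=
  exist (fun L => L \in ring_space (link_of d)) (moved (val t))
    (mem_set (moved_isotopic (val t))).

Lemma motion_continuous : continuous motion_fun.
Proof.
have cm : continuous (fun t : I => moved (val t)).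
  exact: (cts_comp (@val_continuous R) moved_continuous).
exact: continuous_comp_initial.
Qed.

Lemma motion_zero : motion_fun zero = ring_base (link_of d).
Proof. by apply: val_inj; rewrite [LHS]/= -moved0; congr moved; exact: val_zero. Qed.

Lemma motion_one : motion_fun one = ring_base (link_of d).
Proof. by apply: val_inj; rewrite [LHS]/= -[RHS]m1; congr moved; exact: val_one. Qed.

(* The class of the ring motion t |-> m t (L) of the link L given by d. *)
Definition motion_class : ring_group (link_of d) :=
  homotopy_class (mk_path motion_continuous motion_zero motion_one).

End RingMotion.
End RingLinks.

Section Hopf.
Variable R : realType.
Local Notation vec := 'rV[R]_3.
Local Notation I := (unit_interval R).

Definition e1 : vec := vec3 1 0 0.
Definition e2 : vec := vec3 0 1 0.
Definition e3 : vec := vec3 0 0 1.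

Definition hopf_frames : {ptws 'I_2 -> frame R} :=
  fun i => if i == 0 then (0, 1, e3) else (e2, 1, e1).

Lemma ring_hopf1 :
  ring_of (hopf_frames 0) = [set v | pz v = 0 /\ px v ^+ 2 + py v ^+ 2 = 1].
Proof.
apply/seteqP; split=> v; rewrite /ring_of /plane /= /center /normal /radius /=;
  rewrite !dotE !pE => -[].
  rewrite !subr0 !mul0r !add0r mul1r => z0.
  by rewrite z0 mulr0 addr0 expr1n -!expr2.
move=> -> h; rewrite !subr0 !mul0r !add0r mulr0; split=> //.
by rewrite addr0 expr1n -!expr2.
Qed.

Lemma ring_hopf2 :
  ring_of (hopf_frames 1) = [set v | px v = 0 /\ (py v - 1) ^+ 2 + pz v ^+ 2 = 1].
Proof.
apply/seteqP; split=> v; rewrite /ring_of /plane /= /center /normal /radius /=;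
  rewrite !dotE !pE => -[].
  rewrite !subr0 !mul0r !addr0 mul1r => x0.
  by rewrite x0 mulr0 add0r expr1n -!expr2.
move=> -> h; rewrite !subr0 !mul0r !addr0 mulr0; split=> //.
by rewrite add0r expr1n -!expr2.
Qed.

Lemma hopf_config : config setT hopf_frames.
Proof.
have hdis : ring_of (hopf_frames 0) `&` ring_of (hopf_frames 1) = set0.
  rewrite ring_hopf1 ring_hopf2; apply/seteqP; split=> // v [/= [z0 xy] [x0 yz]].
  exfalso; move: xy yz; rewrite x0 z0 expr0n/= add0r addr0 => y1 y2.
  by nra.
split=> // [i|i j].
  rewrite /hopf_frames; case: ifP => _; split; rewrite ?ltr01//= dotE !pE;
  by rewrite !mulr0 ?mulr1 ?addr0 ?add0r.
have h01 (l : 'I_2) : l = 0 \/ l = 1.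
  by case: l => -[|[|//]] l2; [left|right]; exact: val_inj.
by case: (h01 i) => ->; case: (h01 j) => -> //; rewrite setIC.
Qed.

Definition hopf_data : config setT (k := 2) :=
  exist (fun d => d \in config setT (k := 2)) hopf_frames (mem_set hopf_config).

Definition hopf_link : ring_link (setT : set vec) 2 := link_of hopf_data.

Definition tau_move (t : R) (x : vec) : vec := roty (pi * t) x.

(* Progress at time t of the move number i (from 0) out of five moves performed
   one after the other, each taking one fifth of [0, 1]. *)
Definition stage (i : nat) (t : R) : R := \val (clamp (5 * t - i%:R)).

Definition s_move (t : R) (x : vec) : vec :=
  let x1 := x + (- (stage 0 t / 2)) *: e2 in
  let x2 := roty (pi / 4 * stage 1 t) x1 in
  let x3 := rotx (pi * stage 2 t) x2 in
  let x4 := roty (- (pi / 4) * stage 3 t) x3 in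
  x4 + (stage 4 t / 2) *: e2.

Lemma tau_isometry t : isometry (tau_move t).
Proof. exact: isometry_roty. Qed.

Lemma tau_continuous x : continuous (tau_move^~ x).
Proof. by apply: cts_roty; [cts|exact: cts_cst]. Qed.

Lemma roty0 : roty 0 = id :> (vec -> vec).
Proof.
apply/funext => x; rewrite /roty cos0 sin0.
by apply: vecP; rewrite !pE ?mulr0 ?mulr1 ?addr0 ?add0r.
Qed.

Lemma rotx0 : rotx 0 = id :> (vec -> vec).
Proof.
apply/funext => x; rewrite /rotx cos0 sin0.
by apply: vecP; rewrite !pE ?mulr0 ?mulr1 ?addr0 ?add0r ?subr0.
Qed.

Lemma tau0 : tau_move 0 = id.
Proof. by apply/funext => x; rewrite /tau_move mulr0 roty0. Qed.

Definition tau_motion : motion R := Motion tau_isometry tau_continuous tau0.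

Lemma s_isometry t : isometry (s_move t).
Proof.
exact: (isometry_comp (isometry_shift _) (isometry_comp (isometry_roty _)
  (isometry_comp (isometry_rotx _) (isometry_comp (isometry_roty _)
  (isometry_shift _))))).
Qed.

Lemma stage_continuous i : continuous (stage i).
Proof. by apply: cts_val; apply: cts_clamp; cts. Qed.

Lemma s_continuous x : continuous (s_move^~ x).
Proof.
have cs := stage_continuous.
have csc i (a : R) : continuous (fun t => a * stage i t).
  by apply: ctsM; [exact: cts_cst|exact: cs].
apply: cts_add.
  apply: cts_roty; first exact: csc.
  apply: cts_rotx; first exact: csc.
  apply: cts_roty; first exact: csc.
  apply: cts_add; first exact: cts_cst.
  apply: cts_scale; apply: cts_opp; apply: ctsM; [exact: cs|exact: cts_cst].
by apply: cts_scale; apply: ctsM; [exact: cs|exact: cts_cst].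
Qed.

Lemma stage0 i : stage i 0 = 0.
Proof. by rewrite /stage /clamp/= mulr0 sub0r min_r ?max_l ?oppr_le0 ?ler0n//
  (le_trans _ ler01)// oppr_le0 ler0n. Qed.

Lemma stage1 i : (i < 5)%N -> stage i 1 = 1.
Proof.
move=> i5; rewrite /stage/= mulr1.
have : 1 <= 5 - i%:R :> R by rewrite -natrB ?ler1n ?subn_gt0// ltnW.
by move=> h; rewrite min_l// max_r.
Qed.

Lemma s0 : s_move 0 = id.
Proof.
apply/funext => x; rewrite /s_move !stage0 !mulr0 rotx0 !roty0.
by rewrite mul0r oppr0 scale0r !addr0.
Qed.

Definition s_motion : motion R := Motion s_isometry s_continuous s0.

Lemma cos2_pi4 : cos (pi / 4) ^+ 2 = 2^-1 :> R.
Proof.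
have := cos_mulr2n (pi / 4 : R).
rewrite (_ : pi / 4 *+ 2 = pi / 2 :> R) ?cos_pihalf; last by field.
by move=> h; lra.
Qed.

Lemma sin2_pi4 : sin (pi / 4) ^+ 2 = 2^-1 :> R.
Proof. by rewrite sin2cos2 cos2_pi4; field. Qed.

Lemma tau_loop : moved hopf_data tau_motion 1 = hopf_link.
Proof.
apply/link_ofP/asboolP; exists 1%g => i; rewrite perm1 /= /act /hopf_frames.
rewrite /tau_move mulr1 /roty cospi sinpi.
case: ifP => _; split=> //=.
- by apply: vecP; rewrite /center/= !pE; ring.
- apply/seteqP; split=> x; rewrite /plane /normal /center /= !dotE !pE => h; lra.
- by apply: vecP; rewrite /center/= !pE; ring.
- apply/seteqP; split=> x; rewrite /plane /normal /center /= !dotE !pE => h; lra.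
Qed.

Lemma cos_sin_pi4 : cos (pi / 4) * sin (pi / 4) = 2^-1 :> R.
Proof.
have := sin_mulr2n (pi / 4 : R).
rewrite (_ : pi / 4 *+ 2 = pi / 2 :> R) ?sin_pihalf; last by field.
by move=> h; lra.
Qed.

Lemma s_move1 x : s_move 1 x = vec3 (pz x) (1 - py x) (px x).
Proof.
rewrite /s_move !stage1// !mulr1 /roty /rotx cospi sinpi cosN sinN.
have c := cos2_pi4; have s := sin2_pi4; have cs := cos_sin_pi4.
set C := cos _ in c cs *; set S := sin _ in s cs *.
apply: vecP; rewrite !pE.
- transitivity (px x * (C ^+ 2 - S ^+ 2) + pz x * (2 * (C * S))); first by ring.
  by rewrite c s cs; field.
- by field.
- transitivity (px x * (2 * (C * S)) + pz x * (S ^+ 2 - C ^+ 2)); first by ring.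
  by rewrite c s cs; field.
Qed.

Lemma s_loop : moved hopf_data s_motion 1 = hopf_link.
Proof.
apply/link_ofP/asboolP; exists (tperm 0 1) => i; rewrite /= /act !s_move1 !pE.
have [->|->] : i = 0 \/ i = 1.
  by case: i => -[|[|//]] i2; [left|right]; exact: val_inj.
- rewrite tpermL /hopf_frames/=; split=> //=.
  + by apply: vecP; rewrite /center/= !pE; ring.
  + by apply/seteqP; split=> x; rewrite /plane /normal /center /= !dotE !pE => h; lra.
- rewrite tpermR /hopf_frames/=; split=> //=.
  + by apply: vecP; rewrite /center/= !pE; ring.
  + by apply/seteqP; split=> x; rewrite /plane /normal /center /= !dotE !pE => h; lra.
Qed.

Definition tau_H : ring_group hopf_link := motion_class tau_loop.

Definition s_H : ring_group hopf_link := motion_class s_loop.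

Inductive hopf_generator := gen_tau | gen_s.

Definition hopf_generators (x : hopf_generator) : ring_group hopf_link :=
  match x with gen_tau => tau_H | gen_s => s_H end.

End Hopf.

(* Main.v *)
Require Import Defs.
From HB Require Import structures.
From mathcomp Require Import all_boot all_order all_algebra perm.
From mathcomp Require Import all_classical all_reals.
From mathcomp Require Import topology normedtype realfun trigo.
From mathcomp Require Import mxpoly homotopy ring lra.
Set Implicit Arguments.
Unset Strict Implicit.
Unset Printing Implicit Defensive.
Import Defs.
Import Order.TTheory GRing.Theory Num.Theory numFieldNormedType.Exports.

Local Open Scope classical_set_scope.
Local Open Scope ring_scope.

(** Two rings in non-parallel planes cut two chords out of the common line of
these planes, and they are linked exactly when the end points of the chords
interleave. A linked pair, with an order of its rings and with normals for which
[orient] is positive, is therefore described by a rotation, which places the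
common line and the normals, a scale, a point of the line, the angle of the
planes, the half lengths of the chords and the distances of the centers to the
line. Apart from the rotation these data range over a convex set: interleaving is
the triangle inequality between the half lengths of the chords and the distance of
their midpoints. Writing rotation and scale as a nonzero quaternion q gives a space
of parameters [hopf_space], the product of R^4 without its origin and a convex set,
hence simply connected ([hopf_space_simply_connected]), and a map [hopf_cover] from
it to the space of links.

The parameters of one link differ by the sign of q, by the order of the rings and
by the reversal of both normals. These changes are effected by [flip_deck], which
multiplies q by j, and [swap_deck], which multiplies q by (i + k) / sqrt 2; on
quaternions they generate the quaternion group of order 8, acting freely
([hopf_cover_fibre]). So [hopf_cover] is an eightfold covering of its image, and
the ring group is the quaternion group.

That [hopf_cover] is open follows from a continuous recovery of the parameters
([recoverK], [hopf_pair_open]). Its image is closed because linked pairs can only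
degenerate when their rings meet: on disjoint rings the weak inequalities imply the
strict ones ([weakly_linkedP]), the case of planes that become parallel being
controlled by the triangle inequality between the radii and the distance of the
centers. Since the quaternions over one link are orthogonal or opposite, homotopies
lift in steps of uniform size ([lift_square]). Hence two loops are homotopic exactly
when their lifts from the base point have the same end ([lifts_homotopic],
[lifts_same_end]), and concatenation of loops corresponds to composition of deck
transformations ([lifts_concat]).

The lifts of tau_H and s end at [flip_deck] and [swap_deck] of the base point
([lifts_tau], [lifts_s]). So the relations hold, the two classes generate the group,
and the presented group, in which every word reduces to one of the eight words
tau^k s^b ([normal_form]), maps to it injectively. *)

(** * Lifting squares through a covering *)

Lemma unit_clopen (R : realType) (X : topologicalType)
    (f : unit_interval R -> X) (A : set X) :
  continuous f -> clopen A -> A (f zero) -> forall t, A (f t).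
Proof.
move=> cf cA A0 t.
have cfc : continuous (fun x : R => f (clamp x)).
  by apply: (cts_comp (f := @clamp R)); [exact: clamp_continuous|exact: cf].
have [oB kB] := preimage_clopen cA cfc.
have ci : connected [set: R] by apply/connected_intervalP.
have -> : t = clamp (val t) by rewrite valK_clamp.
have BT : (fun x : R => f (clamp x)) @^-1` A = setT.
  apply: ci.
  - by exists 0.
  - by exists ((fun x : R => f (clamp x)) @^-1` A); rewrite ?setTI.
  - by exists ((fun x : R => f (clamp x)) @^-1` A); rewrite ?setTI.
by have : [set: R] (val t) by []; rewrite -BT.
Qed.

(** The relation [close] replaces evenly covered neighbourhoods: it selects at
most one point of a fibre, and [close_lift] carries it from one point of a
fibre to any other, so that one step size serves all sheets at once. *)
Record covering (E Q : topologicalType) (q : E -> Q) (close : E -> E -> Prop) :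
    Prop := Covering {
  cov_continuous : continuous q;
  cov_open : forall A : set E, open A -> open (q @` A);
  cov_closed : closed (range q);
  close_refl : forall a, close a a;
  close_open : open [set ab : E * E | close ab.1 ab.2];
  close_inj : forall a b b', close a b -> close a b' -> q b = q b' -> b = b';
  close_lift : forall a b a', close a b -> q a = q a' ->
    exists2 b', close a' b' & q b = q b' }.

Section Lifting.
Variables (R : realType) (E Q : topologicalType) (q : E -> Q).
Variable close : E -> E -> Prop.
Hypothesis cq : covering q close.
Hypothesis hE : hausdorff_space E.
Local Notation I := (unit_interval R).

Let close_nbhs (a b : E) : close a b ->
  exists U V, [/\ nbhs a U, nbhs b V & forall x y, U x -> V y -> close x y].
Proof.
move=> ab; have := close_open cq; rewrite openE => /(_ (a, b) ab).
by case=> -[U V] /= [aU bV] UV; exists U, V; split=> // x y xU yV; exact: (UV (x, y)).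
Qed.

Lemma cov_nbhs (a : E) (A : set E) : nbhs a A -> nbhs (q a) (q @` A).
Proof.
rewrite nbhsE => -[B [oB Ba] BA]; apply: (filterS (P := q @` B)).
  by move=> _ [x xB <-]; exists x => //; exact: BA.
by apply: open_nbhs_nbhs; split; [exact: cov_open cq _ oB|exists a].
Qed.

(** At each point the lift of g close to F is unique; it depends continuously on
the point because q maps neighbourhoods onto neighbourhoods. *)
Lemma lift_step (X : topologicalType) (F : X -> E) (g : X -> Q) :
  continuous F -> continuous g ->
  (forall x, exists a b, [/\ close a b, q a = q (F x) & q b = g x]) ->
  exists F' : X -> E, [/\ continuous F', forall x, q (F' x) = g x &
    forall x, close (F x) (F' x)].
Proof.
move=> cF cg H.
have /choice[F' HF'] : forall x, exists b, close (F x) b /\ q b = g x.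
  move=> x; have [a [b [ab qa <-]]] := H x.
  by have [b' Fb' qb] := close_lift cq ab qa; exists b'.
exists F'; split=> [x A nA|x|x]; try by have [] := HF' x.
have [FF' qF'] := HF' x; have [U [V [nU nV UV]]] := close_nbhs FF'.
have : nbhs (q (F' x)) (q @` (A `&` V)) by apply: cov_nbhs; exact: filterI.
rewrite qF' => /cg nx; have nU' := cF x _ nU.
change (nbhs x (F' @^-1` A)); near=> y.
have [b [Ab Vb] qb] : (q @` (A `&` V)) (g y) by near: y.
have Uy : U (F y) by near: y.
have [Fy qy] := HF' y; rewrite /=.
by rewrite (close_inj cq Fy (UV _ _ Uy Vb)) // qy qb.
Unshelve. all: by end_near. Qed.

(** Two lifts agree exactly where they are [close], hence on an open set, and they
differ on an open set since E is Hausdorff. *)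
Lemma lift_unique (F G : I -> E) : continuous F -> continuous G ->
  (forall t, q (F t) = q (G t)) -> F zero = G zero -> F =1 G.
Proof.
move=> cF cG FG FG0 t.
have cFG : continuous (fun t => (F t, G t)) by apply: cts_pair.
pose B := [set t | F t = G t].
have cB : clopen B.
  split.
    have -> : B = (fun t => (F t, G t)) @^-1` [set ab : E * E | close ab.1 ab.2].
      apply/seteqP; split=> s /=; first by move=> ->; exact: close_refl cq _.
      by move=> /(close_inj cq (close_refl cq (F s))); apply.
    by apply: open_comp; [move=> ? _; exact: cFG|exact: close_open cq].
  rewrite -openC openE => s /= Fs.
  have := hE; rewrite open_hausdorff => /(_ (F s) (G s)) [|[U V]/=]; first exact/eqP.
  rewrite !inE => -[Us Vs] [oU oV UV].
  have nU : nbhs s (F @^-1` U) by apply: cF; exact: open_nbhs_nbhs.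
  have nV : nbhs s (G @^-1` V) by apply: cG; exact: open_nbhs_nbhs.
  apply: filterS (filterI nU nV) => r [/= Ur Vr] FGr.
  have : (U `&` V) (F r) by split=> //; rewrite FGr.
  by rewrite UV.
exact: (unit_clopen (f := id) (@cts_id _) cB).
Qed.

(** A Lebesgue number for the square: around each of its points, f takes values in
the image of a neighbourhood whose points are pairwise [close]. *)
Lemma close_uniform (f : R * R -> Q) : continuous f ->
  (forall s t, 0 <= s <= 1 -> 0 <= t <= 1 -> range q (f (s, t))) ->
  exists2 d : R, 0 < d & forall s t s' t', 0 <= s <= 1 -> 0 <= t <= 1 ->
    `|s - s'| < d -> `|t - t'| < d ->
    exists a b, [/\ close a b, q a = f (s, t) & q b = f (s', t')].
Proof.
move=> cf rf.
have : compact (`[(0:R), 1]%classic `*` `[(0:R), 1]%classic).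
  by apply: compact_setX; exact: segment_compact.
move=> /compact_near_coveringP/(_ R (0^'+)
  (fun d y => forall s' t', `|y.1 - s'| < d -> `|y.2 - t'| < d ->
    exists a b, [/\ close a b, q a = f y & q b = f (s', t')]) _) [].
  move=> -[s t] /= [s01 t01]; rewrite !in_itv/= in s01 t01.
  have [a _ qa] := rf s t s01 t01.
  have [U [V [nU nV UV]]] := close_nbhs (close_refl cq a).
  have : nbhs (f (s, t)) (q @` (U `&` V)) by rewrite -qa; apply: cov_nbhs; exact: filterI.
  move=> /cf/nbhs_ballP[r/= r0 rb].
  exists (ball (s, t) (r / 2), [set d | d < r / 2]).
    split; first by apply: nbhsx_ballx; rewrite divr_gt0.
    by apply: nbhs_right_lt; rewrite divr_gt0.
  move=> -[[u v] d] /= [[/= su tv] dr] s' t' us vt.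
  rewrite /ball/= in su tv.
  have rr := splitr r.
  have [a' [Ua _] qa'] : (q @` (U `&` V)) (f (u, v)).
    by apply: rb; split; rewrite /ball/=; lra.
  have [b' [_ Vb] qb'] : (q @` (U `&` V)) (f (s', t')).
    apply: rb; split; rewrite /ball/=.
      have := ler_distD u s s'; lra.
    by have := ler_distD v t t'; lra.
  by exists a', b'; split=> //; exact: UV.
move=> r /= r0 /(_ (r / 2)) H; exists (r / 2); first by rewrite divr_gt0.
move=> s t s' t' s01 t01; apply: (H _ _ (s, t)) => //=.
- by rewrite sub0r normrN gtr0_norm; have := splitr r; lra.
- by rewrite divr_gt0.
Qed.

(** The square is shrunk to its corner: x |-> f (k / N x) is constant for k = 0 and
equal to f for k = N, and consecutive maps are near enough for [lift_step] as
soon as 1 / N is below the Lebesgue number. Nothing has to be glued. *)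
Lemma lift_square (f : I -> I -> Q) (e : E) :
  continuous (fun p : I * I => f p.1 p.2) ->
  (forall s t, range q (f s t)) -> q e = f zero zero ->
  exists F : I -> I -> E, [/\ continuous (fun p : I * I => F p.1 p.2),
    forall s t, q (F s t) = f s t & F zero zero = e].
Proof.
move=> cf rf qe.
pose g (x : R * R) := f (clamp x.1) (clamp x.2).
have cg : continuous g.
  by apply: (cts_comp (f := fun x : R * R => (clamp x.1, clamp x.2)) _ cf); cts.
have [|d d0 Hd] := close_uniform cg; first by move=> s t _ _; exact: rf.
have [N Nd] : exists N : nat, d^-1 < N.+1%:R :> R.
  by exists (Num.truncn d^-1); exact: truncnS_gt.
pose N1 := (N.+1%:R : R); have N10 : 0 < N1 by rewrite ltr0n.
have sc (l : R) : continuous (fun p : I * I => (l * val p.1, l * val p.2)) by cts.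
have l01 k (t : I) : (k <= N.+1)%N -> 0 <= k%:R / N1 * val t <= 1.
  move=> kN; have t0 := uival_ge0 t; have t1 := uival_le1 t.
  rewrite mulr_ge0 ?divr_ge0 ?ler0n ?(ltW N10)//=.
  by rewrite mulr_ile1 ?divr_ge0 ?ler0n ?(ltW N10)// ler_pdivrMr// mul1r ler_nat.
have [F [cF qF F0]] : exists F : I * I -> E, [/\ continuous F,
    forall p, q (F p) = g (N.+1%:R / N1 * val p.1, N.+1%:R / N1 * val p.2) &
    F (zero, zero) = e].
  have : (N.+1 <= N.+1)%N by [].
  elim: {1 3 4}N.+1 => [_|k IH kN].
    exists (fun=> e); split=> //; first exact: cts_cst.
    by move=> p; rewrite !mul0r qe /g/=; congr (f _ _); apply: val_inj;
      rewrite val_zero clampE// lexx ler01.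
  have [F [cF qF F0]] := IH (ltnW kN).
  have [||F' [cF' qF' FF']] := lift_step cF (g := fun p : I * I => g (k.+1%:R / N1 * val p.1, k.+1%:R / N1 * val p.2)).
  - exact: (cts_comp (sc _) cg).
  - move=> p; rewrite qF.
    have sd (t : I) : `|k%:R / N1 * val t - k.+1%:R / N1 * val t| < d.
      rewrite -natr1 !mulrDl opprD addrA subrr sub0r normrN mul1r.
      rewrite ger0_norm ?mulr_ge0 ?uival_ge0 ?invr_ge0 ?ltW//.
      apply: (@le_lt_trans _ _ N1^-1).
        by rewrite ger_pMr ?uival_le1// invr_gt0.
      by rewrite -[d]invrK ltf_pV2// posrE invr_gt0.
    by apply: Hd => //; apply: l01; exact: ltnW.
  - exists F'; split=> //; rewrite -F0; apply: esym; apply: (close_inj cq (close_refl cq _)).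
    + exact: FF'.
    + have z1 : val ((zero, zero) : I * I).1 = 0 := val_zero R.
      by rewrite qF qF' z1 !mulr0.
exists (fun s t => F (s, t)); split=> //.
- by apply: (cts_comp (f := fun p : I * I => (p.1, p.2)) _ cF); cts.
- by move=> s t; rewrite qF divff ?gt_eqF// /g/= !mul1r !valK_clamp.
Qed.

End Lifting.

(** * Star-shaped sets *)

Section SubspacePaths.
Variables (R : realType) (V : topologicalType) (A : set V).
Local Notation I := (unit_interval R).

Lemma cts_sub_type (Y : topologicalType) (f : Y -> V) (Af : forall y, A (f y)) :
  continuous f -> continuous (fun y => exist (fun v => v \in A) (f y) (mem_set (Af y)) : A).
Proof. by move=> cf; exact: continuous_comp_initial. Qed.

Lemma sub_path (x y : A) (f : I -> V) : continuous f -> (forall t, A (f t)) ->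
  f zero = val x -> f one = val y ->
  exists g : {path I from x to y}, forall t, val (g t) = f t.
Proof.
move=> cf Af f0 f1.
pose g t : A := exist (fun v => v \in A) (f t) (mem_set (Af t)).
have g0 : g zero = x by exact: val_inj.
have g1 : g one = y by exact: val_inj.
by exists (mk_path (cts_sub_type (Af := Af) cf) g0 g1).
Qed.

Lemma sub_homotopic (x y : A) (f g : {path I from x to y}) (h : I -> I -> V) :
  continuous (fun p : I * I => h p.1 p.2) -> (forall s t, A (h s t)) ->
  (forall t, h zero t = val (f t)) -> (forall t, h one t = val (g t)) ->
  (forall s, h s zero = val x) -> (forall s, h s one = val y) ->
  homotopic f g.
Proof.
move=> ch Ah h0 h1 hx hy.
exists (fun s t => exist (fun v => v \in A) (h s t) (mem_set (Ah s t)) : A).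
have vi (a b : A) : val a = val b -> a = b by exact: val_inj.
split=> [|t|t|s|s]; last 4 first.
- by apply: vi; exact: h0.
- by apply: vi; exact: h1.
- by apply: vi; exact: hx.
- by apply: vi; exact: hy.
by apply: (cts_sub_type (f := fun p : I * I => h p.1 p.2)).
Qed.

End SubspacePaths.

Section StarShaped.
Variables (R : realType) (V : normedModType R) (A : set V) (o : V).
Local Notation I := (unit_interval R).
Hypothesis starA : forall x (l : R), A x -> 0 <= l <= 1 -> A (o + l *: (x - o)).

(* (ud t, ld t) runs along three sides of the unit square, from (0, 1) through
   (0, 0) and (1, 0) to (1, 1). *)
Let ud (t : R) : R := Num.max 0 (Num.min 1 (3 * t - 1)).
Let ld (t : R) : R := Num.max 0 (Num.max (1 - 3 * t) (3 * t - 2)).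

(** In the square of the points (u, l), standing for the point f u contracted by l
towards o, the side l = 1 is moved to the other three sides. Along these the
path no longer depends on f: on u = 0 and u = 1 it sees an end point of f, and
on l = 0 it stays at o. *)
Lemma starshaped_homotopic (x y : A) (f g : {path I from x to y}) : homotopic f g.
Proof.
pose K (f : I -> A) (s t : I) : V :=
  o + ((1 - val s) + val s * ld (val t)) *:
    (val (f (clamp ((1 - val s) * val t + val s * ud (val t)))) - o).
have cld : continuous (fun p : I * I => ld (val p.2)) by rewrite /ld; cts.
have cud : continuous (fun p : I * I => ud (val p.2)) by rewrite /ud; cts.
have ld01 (t : I) : 0 <= ld (val t) <= 1.
  have := uival_ge0 t; have := uival_le1 t; move: (val t) => r r1 r0.
  by rewrite /ld !le_max !ge_max lexx ler01/=; lra.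
have cK (k : {path I from x to y}) : continuous (fun p : I * I => K k p.1 p.2).
  apply: cts_add; first exact: cts_cst.
  move=> p; apply: cvgZ.
    suff : continuous (fun p : I * I => 1 - val p.1 + val p.1 * ld (val p.2)) by apply.
    by cts.
  suff : continuous (fun p : I * I => val (k (clamp ((1 - val p.1) * val p.2 + val p.1 * ud (val p.2)))) - o) by apply.
  apply: cts_sub; last exact: cts_cst.
  apply: (cts_comp (g := fun v : A => val v)); last exact: initial_continuous.
  by apply: (cts_comp (g := k)); cts.
have AK (k : {path I from x to y}) s t : A (K k s t).
  apply: starA; first exact: set_mem (valP _).
  have /andP[l0 l1] := ld01 t; have s0 := uival_ge0 s; have s1 := uival_le1 s.
  have sl0 := mulr_ge0 s0 l0.
  have sl1 : val s * ld (val t) <= val s by exact: ler_piMr.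
  by apply/andP; split; lra.
have K0 (k : {path I from x to y}) t : K k zero t = val (k t).
  by rewrite /K val_zero subr0 !mul1r !mul0r !addr0 scale1r valK_clamp addrC subrK.
have ud0 : ud 0 = 0 by rewrite /ud mulr0 sub0r min_r ?max_l//; lra.
have ud1 : ud 1 = 1 by rewrite /ud min_l ?max_r//; lra.
have ld0 : ld 0 = 1 by rewrite /ld mulr0 subr0 sub0r [Num.max 1 _]max_l ?max_r//; lra.
have ld1 : ld 1 = 1 by rewrite /ld mulr1 [Num.max (1 - 3) _]max_r ?max_r//; lra.
have Kx (k : {path I from x to y}) s : K k s zero = val x.
  rewrite /K val_zero ud0 ld0 !mulr0 addr0 mulr1 subrK scale1r addrC subrK.
  by rewrite -[RHS](congr1 val (path_zero (s := k))).
have Ky (k : {path I from x to y}) s : K k s one = val y.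
  rewrite /K val_one ud1 ld1 !mulr1 subrK scale1r addrC subrK.
  by rewrite -[RHS](congr1 val (path_one (s := k))).
have KE t : K f one t = K g one t.
  rewrite /K val_one subrr !mul0r !add0r !mul1r.
  have [t1|t1] := leP (val t) 3^-1.
    have -> : ud (val t) = 0.
      by rewrite /ud max_l// ge_min; apply/orP; right; lra.
    by rewrite [f _]path_zero [g _]path_zero.
  have [t2|t2] := leP (2 / 3) (val t).
    have -> : ud (val t) = 1.
      by rewrite /ud min_l ?max_r//; lra.
    by rewrite [f _]path_one [g _]path_one.
  have -> : ld (val t) = 0 by rewrite /ld max_l// ge_max; lra.
  by rewrite !scale0r.
have [k kE] := sub_path (x := x) (y := y) (f := K f one)
  (cts_comp (f := fun t => (one, t)) (cts_pair (@cts_cst _ _ _) (@cts_id _)) (cK f))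
  (AK f one) (Kx f one) (Ky f one).
apply: (homotopic_trans (g := k)).
  by apply: (sub_homotopic (h := K f)).
apply: homotopic_sym; apply: (sub_homotopic (h := K g)) => // t.
by rewrite kE KE.
Qed.

End StarShaped.

(** * Piecewise linear approximation *)

Section PiecewiseLinear.
Variables (R : realType) (V : normedModType R).

(** The error is compared with |f t|, so that the segment from f t to f t' cannot
contain 0. *)
Lemma relative_modulus (f : R -> V) : continuous f ->
  (forall t, 0 <= t <= 1 -> f t != 0) ->
  exists2 d : R, 0 < d & forall t t', 0 <= t <= 1 -> `|t - t'| < d ->
    `|f t - f t'| < `|f t|.
Proof.
move=> cf f0.
have := @segment_compact R 0 1.
move=> /compact_near_coveringP/(_ R (0^'+)
  (fun d t => forall t', `|t - t'| < d -> `|f t - f t'| < `|f t|) _) [].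
  move=> t /=; rewrite in_itv/= => t01.
  have m0 : 0 < `|f t| by rewrite normr_gt0 f0.
  have m30 : 0 < `|f t| / 3 by rewrite divr_gt0.
  have /cvgrPdist_lt/(_ _ m30)/nbhs_ballP[r/= r0 rb] := cf t.
  exists (ball t (r / 2), [set d | d < r / 2]).
    split; first by apply: nbhsx_ballx; rewrite divr_gt0.
    by apply: nbhs_right_lt; rewrite divr_gt0.
  move=> -[u d] /= [tu dr] t' ut; rewrite /ball/= in tu.
  have rr := splitr r.
  have fu : `|f t - f u| < `|f t| / 3 by apply: rb; rewrite /ball/=; lra.
  have ft' : `|f t - f t'| < `|f t| / 3.
    by apply: rb; rewrite /ball/=; have := ler_distD u t t'; lra.
  have := ler_distD (f t) (f u) (f t'); rewrite (distrC (f u) (f t)).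
  have := lerB_normD (f t) (f u - f t); rewrite subrKC (distrC (f u) (f t)); lra.
move=> r /= r0 /(_ (r / 2)) H; exists (r / 2); first by rewrite divr_gt0.
move=> t t' t01; apply: H => //=.
- by rewrite sub0r normrN gtr0_norm; have := splitr r; lra.
- by rewrite divr_gt0.
Qed.

(** The hat functions make the interpolation at the multiples of 1 / n.+1 a single
sum of continuous terms. The range goes one node beyond the last one needed on
the unit interval, so that every point has a right neighbour. *)
Definition interpolation (f : R -> V) (n : nat) (t : R) : V :=
  \sum_(i < n.+3) Num.max 0 (1 - `|n.+1%:R * t - i%:R|) *: f (i%:R / n.+1%:R).

Lemma interpolation_continuous f n : continuous (interpolation f n).
Proof.
rewrite /interpolation; elim: n.+3 => [|m IH].
  by under [X in continuous X]eq_fun do rewrite big_ord0; exact: cts_cst.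
under [X in continuous X]eq_fun do rewrite big_ord_recr/=.
apply: cts_add; first exact: IH.
apply: cts_scale; apply: cts_max; first exact: cts_cst.
apply: ctsB; first exact: cts_cst.
move=> t; apply: cvg_norm.
suff : continuous (fun t : R => n.+1%:R * t - m%:R) by apply.
by cts.
Qed.

Lemma interpolationE f n t : 0 <= t <= 1 ->
  exists k l, [/\ (k < n.+2)%N, 0 <= l <= 1, n.+1%:R * t = k%:R + l &
  interpolation f n t =
    (1 - l) *: f (k%:R / n.+1%:R) + l *: f (k.+1%:R / n.+1%:R)].
Proof.
move=> /andP[t0 t1]; set N : R := n.+1%:R.
have N0 : 0 < N by rewrite ltr0n.
have Nt0 : 0 <= N * t by rewrite mulr_ge0// ltW.
have /andP[k0 k1] := truncn_itv Nt0.
set k := Num.truncn (N * t) in k0 k1 *.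
have kn : (k < n.+2)%N.
  rewrite ltnS -(ler_nat R) (le_trans k0)// -/N -[leRHS]mulr1 ler_pM2l//.
exists k, (N * t - k%:R); rewrite -natr1 in k1.
split=> //; [by lra|by lra|].
rewrite /interpolation -/N.
have kn3 : (k < n.+3)%N by exact: leqW.
rewrite (bigD1 (Ordinal kn3))//= (bigD1 (Ordinal (kn : (k.+1 < n.+3)%N)))/=; last first.
  by rewrite -val_eqE/= neq_ltn ltnSn orbT.
rewrite big1 ?addr0 => [|i /andP[ik ik1]]; last first.
  rewrite max_l ?scale0r// subr_le0.
  rewrite -val_eqE/= in ik; rewrite -val_eqE/= in ik1.
  have [lik|lki] := ltnP i k.
    have : (i.+1%:R : R) <= k%:R by rewrite ler_nat.
    by rewrite -natr1 => h; rewrite ger0_norm; lra.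
  have : (k.+2%:R : R) <= i%:R.
    by rewrite ler_nat ltn_neqAle eq_sym ik1 ltn_neqAle eq_sym ik.
  by rewrite -!natr1 => h; rewrite ler0_norm; lra.
have e1 : Num.max 0 (1 - `|N * t - k%:R|) = 1 - (N * t - k%:R).
  by rewrite max_r ger0_norm//; lra.
have e2 : Num.max 0 (1 - `|N * t - k.+1%:R|) = N * t - k%:R.
  by rewrite -natr1 max_r ler0_norm//; lra.
by rewrite e1 e2.
Qed.

Lemma interpolation0 f n : interpolation f n 0 = f 0.
Proof.
rewrite /interpolation (bigD1 ord0)//= big1 => [|i i0].
  by rewrite addr0 mulr0 subr0 normr0 subr0 max_r// scale1r mul0r.
rewrite mulr0 sub0r normrN max_l ?scale0r// subr_le0 ger0_norm ?ler0n//.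
by rewrite ler1n lt0n.
Qed.

Lemma interpolation1 f n : interpolation f n 1 = f 1.
Proof.
have n3 : (n.+1 < n.+3)%N by [].
rewrite /interpolation (bigD1 (Ordinal n3))//= big1 => [|i].
  by rewrite addr0 mulr1 subrr normr0 subr0 max_r ?ler01// scale1r divff ?pnatr_eq0.
rewrite -val_eqE/= mulr1 => ni.
rewrite max_l ?scale0r// subr_le0.
have [lin|lni] := ltnP i n.+1.
  by rewrite -natrB ?(ltnW lin)// ger0_norm ?ler0n// ler1n subn_gt0.
rewrite distrC -natrB// ger0_norm ?ler0n// ler1n subn_gt0.
by rewrite ltn_neqAle eq_sym ni.
Qed.

Lemma interpolation_close f (d : R) : continuous f ->
  (forall t t', 0 <= t <= 1 -> `|t - t'| < d -> `|f t - f t'| < `|f t|) -> 0 < d ->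
  exists n, forall t, 0 <= t <= 1 -> `|f t - interpolation f n t| < `|f t|.
Proof.
move=> cf fd d0; pose n := Num.truncn d^-1; exists n => t t01.
have nd : (n.+1%:R : R)^-1 < d by rewrite invf_plt ?posrE ?ltr0n ?truncnS_gt.
have [k [l [kn /andP[l0 l1] Nt ->]]] := interpolationE f n t01.
set N : R := n.+1%:R in nd Nt *; have N0 : 0 < N by rewrite ltr0n.
have tE : t = (k%:R + l) / N by rewrite -Nt mulrC mulKf ?gt_eqF.
have h1 : `|f t - f (k%:R / N)| < `|f t|.
  apply: fd => //; apply: le_lt_trans nd.
  rewrite tE -mulrBl addrC addKr normrM (ger0_norm l0) gtr0_norm ?invr_gt0//.
  by rewrite ler_piMl// invr_ge0 ltW.
have h2 : `|f t - f (k.+1%:R / N)| < `|f t|.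
  apply: fd => //; apply: le_lt_trans nd.
  rewrite tE -mulrBl -natr1 opprD addrACA subrr add0r normrM.
  rewrite ler0_norm ?subr_le0// gtr0_norm ?invr_gt0//.
  by rewrite ler_piMl ?invr_ge0 ?(ltW N0)//; lra.
have -> : f t - ((1 - l) *: f (k%:R / N) + l *: f (k.+1%:R / N)) =
    (1 - l) *: (f t - f (k%:R / N)) + l *: (f t - f (k.+1%:R / N)).
  rewrite !scalerBr addrACA -scalerDl subrK scale1r opprD.
  by [].
apply: le_lt_trans (ler_normD _ _) _.
rewrite !normrZ (ger0_norm l0) ger0_norm ?subr_ge0//.
have [->|ln0] := eqVneq l 0; first by rewrite subr0 mul1r mul0r addr0.
have lt0 : 0 < l by rewrite lt_neqAle eq_sym ln0.
have p1 : (1 - l) * `|f t - f (k%:R / N)| <= (1 - l) * `|f t|.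
  by rewrite ler_wpM2l ?subr_ge0// ltW.
have p2 : l * `|f t - f (k.+1%:R / N)| < l * `|f t| by rewrite ltr_pM2l.
by lra.
Qed.

End PiecewiseLinear.

(** In dimension at least 3, both entries of a pair are killed by some nonzero
linear form. Along the moment curve (1, t, t^2, ...) a nonzero form is a nonzero
polynomial in t, so some point of the curve is killed by none of the forms
chosen for the pairs of s. *)
Lemma generic_direction (R : realType) (n : nat)
    (s : seq ('rV[R]_n.+3 * 'rV[R]_n.+3)) :
  exists2 p : 'rV[R]_n.+3, p != 0 & forall v, v \in s ->
    forall a b c, a *: v.1 + b *: v.2 = c *: p -> c = 0.
Proof.
have /choice[w Hw] : forall v : 'rV[R]_n.+3 * 'rV[R]_n.+3, exists w : 'rV[R]_n.+3,
    [/\ w != 0, v.1 *m w^T = 0 & v.2 *m w^T = 0].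
  move=> v; pose A := row_mx v.1^T v.2^T.
  have : kermx A != 0.
    rewrite -mxrank_eq0 mxrank_ker -lt0n subn_gt0.
    by apply: (leq_ltn_trans (rank_leq_col A)); rewrite addn1.
  move=> /rowV0Pn[w /sub_kermxP + w0]; rewrite /A mul_mx_row => wA.
  exists w; split=> //.
    have := congr1 (fun M => (lsubmx M)^T) wA.
    by rewrite row_mxKl linear0 trmx0 trmx_mul trmxK.
  have := congr1 (fun M => (rsubmx M)^T) wA.
  by rewrite row_mxKr linear0 trmx0 trmx_mul trmxK.
pose P := \prod_(v <- s) rVpoly (w v).
have P0 : P != 0.
  rewrite /P prodf_seq_neq0; apply/allP => v _ /=.
  have [w0 _ _] := Hw v; apply: contra w0 => /eqP h.
  by rewrite -[w v]rVpolyK h linear0.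
have [t Pt] : exists t : R, P.[t] != 0.
  apply/not_existsP => H.
  have := max_poly_roots P0 (rs := [seq i%:R | i <- iota 0 (size P)]).
  rewrite size_map size_iota ltnn.
  have -> : all (root P) [seq i%:R | i <- iota 0 (size P)].
    apply/allP => _ /mapP[i _ ->]; apply/rootP/eqP; apply/negPn/negP; exact: H.
  have -> : uniq [seq (i%:R : R) | i <- iota 0 (size P)].
    rewrite map_inj_uniq ?iota_uniq// => i j /eqP.
    by rewrite eqr_nat => /eqP.
  by move=> /(_ isT isT).
exists (\row_j t ^+ j).
  apply/eqP => /rowP/(_ ord0); rewrite !mxE expr0 => /eqP.
  by rewrite oner_eq0.
move=> v vs a b c abc.
have [w0 v1 v2] := Hw v.
have wt : (rVpoly (w v)).[t] != 0.
  apply: contra Pt => /eqP wt.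
  by rewrite /P (big_rem v vs)/= hornerM wt mul0r.
have pw : ((\row_j t ^+ j) *m (w v)^T) 0 0 = (rVpoly (w v)).[t].
  rewrite !mxE (horner_coef_wide _ (size_poly _ _)).
  by apply: eq_bigr => i _; rewrite !mxE coef_rVpoly_ord mulrC.
have := congr1 (fun u => (u *m (w v)^T) 0 0) abc.
rewrite mulmxDl -!scalemxAl v1 v2 !scaler0 addr0 mxE mxE -/(_ *m _) pw.
by move/esym/eqP; rewrite mulf_eq0 (negbTE wt) orbF => /eqP.
Qed.

(** * The complement of the origin is simply connected *)

Section Punctured.
Variables (R : realType) (n : nat).
Local Notation I := (unit_interval R).
Local Notation V := 'rV[R]_n.+3.

Definition punctured : set V := [set v | v != 0].

Definition off_ray (p : V) : set V := [set v | forall c, 0 <= c -> v != c *: p].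

Lemma off_ray_star (p : V) : p != 0 -> forall x (l : R),
  off_ray p x -> 0 <= l <= 1 -> off_ray p (- p + l *: (x - - p)).
Proof.
move=> p0 x l px /andP[l0 l1] c c0; apply/eqP => e.
have {}e : l *: x = (c + (1 - l)) *: p.
  rewrite !scalerDl scaleNr scale1r -e opprK scalerDr addrA.
  by rewrite [- p + _]addrC subrK addrK.
have [l00|ln0] := eqVneq l 0.
  move: e; rewrite l00 scale0r subr0 => /esym/eqP.
  by rewrite scaler_eq0 (negbTE p0) orbF gt_eqF// ltr_wpDl.
have cl0 : 0 <= (c + (1 - l)) / l by rewrite divr_ge0// addr_ge0// subr_ge0.
have /eqP := px _ cl0; apply.
by rewrite mulrC -scalerA -e scalerA mulVf// scale1r.
Qed.

Lemma punctured_interpolation (x y : punctured) (f : {path I from x to y}) :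
  exists (m : nat) (g : {path I from x to y}),
    homotopic f g /\
    forall t, val (g t) = interpolation (fun s : R => val (f (clamp s))) m (val t).
Proof.
pose F (s : R) : V := val (f (clamp s)).
have cF : continuous F.
  apply: (cts_comp (f := fun s => f (clamp s)) (g := fun v : punctured => val v)).
    by apply: (cts_comp (f := @clamp R)); [exact: clamp_continuous|exact: cts_fun].
  exact: initial_continuous.
have F0 s : F s != 0 by have := set_mem (valP (f (clamp s))).
have [d d0 Fd] := relative_modulus cF (fun s _ => F0 s).
have [m Fm] := interpolation_close cF Fd d0.
have FmI (t : I) : `|F (val t) - interpolation F m (val t)| < `|F (val t)|.
  by apply: Fm; rewrite uival_ge0 uival_le1.
have fF (t : I) : val (f t) = F (val t) by rewrite /F valK_clamp.
have cP : continuous (fun t : I => interpolation F m (val t)).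
  by apply: (cts_comp (f := fun t : I => val t)); [exact: val_continuous|exact: interpolation_continuous].
have seg0 (s t : I) : punctured (F (val t) - val s *: (F (val t) - interpolation F m (val t))).
  apply/eqP => /eqP; rewrite subr_eq0 => /eqP e.
  have := FmI t; rewrite [X in _ < `|X|]e normrZ ger0_norm ?uival_ge0//.
  by rewrite ltNge ler_piMl// uival_le1.
exists m.
have F00 : F 0 = val x by rewrite /F [f _]path_zero.
have F11 : F 1 = val y by rewrite /F [f _]path_one.
have [||||g gE] := sub_path (x := x) (y := y) (f := fun t : I => interpolation F m (val t)).
- exact: cP.
- by move=> t; have := seg0 one t; rewrite val_one scale1r subKr.
- by rewrite val_zero interpolation0.
- by rewrite val_one interpolation1.
exists g; split=> //.
apply: (sub_homotopic (h := fun s t => F (val t) - val s *: (F (val t) - interpolation F m (val t)))) => //.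
- have cFp : continuous (fun p : I * I => F (val p.2)).
    by apply: (cts_comp (f := fun p : I * I => val p.2) _ cF); cts.
  have cPp : continuous (fun p : I * I => interpolation F m (val p.2)).
    by apply: (cts_comp (f := fun p : I * I => p.2) _ cP); cts.
  apply: cts_sub => //; move=> p; apply: cvgZ.
    suff : continuous (fun p : I * I => val p.1) by apply.
    by cts.
  suff : continuous (fun p : I * I => F (val p.2) - interpolation F m (val p.2)) by apply.
  exact: cts_sub.
- by move=> t; rewrite val_zero scale0r subr0.
- by move=> t; rewrite val_one scale1r subKr gE.
- by move=> s; rewrite val_zero interpolation0 subrr scaler0 subr0.
- by move=> s; rewrite val_one interpolation1 subrr scaler0 subr0.
Qed.

(** Both paths are deformed into polygons. The ray spanned by a direction generic
for their edges misses both polygons, and the complement of this ray is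
star-shaped around a point of the opposite ray. *)
Lemma punctured_simply_connected (x y : punctured) (f g : {path I from x to y}) :
  homotopic f g.
Proof.
have [mf [f' [ff' f'E]]] := punctured_interpolation f.
have [mg [g' [gg' g'E]]] := punctured_interpolation g.
apply: (homotopic_trans ff'); apply: homotopic_sym; apply: (homotopic_trans gg').
apply: homotopic_sym.
pose vert (k : {path I from x to y}) (m i : nat) : V := val (k (clamp (i%:R / m.+1%:R))).
pose edges k m := [seq (vert k m i, vert k m i.+1) | i <- iota 0 m.+2].
have [p p0 Hp] := generic_direction (edges f mf ++ edges g mg).
have off (k k' : {path I from x to y}) m :
    (forall t, val (k' t) = interpolation (fun s : R => val (k (clamp s))) m (val t)) ->
    {subset edges k m <= edges f mf ++ edges g mg} -> forall t, off_ray p (val (k' t)).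
  move=> k'E sub t c c0; apply/eqP => e.
  have t01 : 0 <= val t <= 1 by rewrite uival_ge0 uival_le1.
  have [i [l [im _ _]]] := interpolationE (fun s : R => val (k (clamp s)) : V) m t01.
  rewrite -k'E e => /esym e'.
  have c00 : c = 0.
    apply: (Hp (vert k m i, vert k m i.+1)) e'; apply: sub; apply/mapP; exists i => //.
    by rewrite mem_iota.
  by have /eqP := set_mem (valP (k' t)); rewrite e c00 scale0r.
have offf : forall t, off_ray p (val (f' t)).
  by apply: (off f f' mf f'E) => v vf; rewrite mem_cat vf.
have offg : forall t, off_ray p (val (g' t)).
  by apply: (off g g' mg g'E) => v vg; rewrite mem_cat vg orbT.
have x0 : f' zero = x := path_zero.
have y0 : f' one = y := path_one.
have ox : off_ray p (val x) by rewrite -x0.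
have oy : off_ray p (val y) by rewrite -y0.
have cval (k : {path I from x to y}) : continuous (fun t => val (k t) : V).
  apply: (cts_comp (f := k) (g := fun v : punctured => val v)); first exact: cts_fun.
  exact: initial_continuous.
pose x' : off_ray p := exist (fun v => v \in off_ray p) (val x) (mem_set ox).
pose y' : off_ray p := exist (fun v => v \in off_ray p) (val y) (mem_set oy).
have [||kf kfE] := sub_path (x := x') (y := y') (cval f') offf.
- by rewrite [f' _]path_zero.
- by rewrite [f' _]path_one.
have [||kg kgE] := sub_path (x := x') (y := y') (cval g') offg.
- by rewrite [g' _]path_zero.
- by rewrite [g' _]path_one.
have [h [ch h0 h1 hx hy]] := starshaped_homotopic (off_ray_star p0) kf kg.
apply: (sub_homotopic (h := fun s t => val (h s t))).
- apply: (cts_comp (f := fun p : I * I => h p.1 p.2) ch (g := fun v : off_ray p => val v)).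
  exact: initial_continuous.
- move=> s t; have /(_ 0 (lexx 0)) := set_mem (valP (h s t)).
  by rewrite scale0r.
- by move=> t; rewrite h0 kfE.
- by move=> t; rewrite h1 kgE.
- by move=> s; rewrite hx.
- by move=> s; rewrite hy.
Qed.

End Punctured.

(** * Quaternions and rotations *)

Section Quaternions.
Variable R : realType.
Local Notation vec := 'rV[R]_3.
Local Notation quat := 'rV[R]_4.
Implicit Types (p q : quat) (u v w : vec).

Definition quat4 (a b c d : R) : quat := \row_i [:: a; b; c; d]`_i.

Definition qa q : R := q 0 0.
Definition qb q : R := q 0 1.
Definition qc q : R := q 0 2%:R.
Definition qd q : R := q 0 3%:R.

Lemma quat4E a b c d : (qa (quat4 a b c d) = a) * (qb (quat4 a b c d) = b) *
  (qc (quat4 a b c d) = c) * (qd (quat4 a b c d) = d).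
Proof. by rewrite /qa /qb /qc /qd !mxE. Qed.

Lemma quatZ l q : (qa (l *: q) = l * qa q) * (qb (l *: q) = l * qb q) *
  (qc (l *: q) = l * qc q) * (qd (l *: q) = l * qd q).
Proof. by rewrite /qa /qb /qc /qd !mxE. Qed.

Lemma quatN q : (qa (- q) = - qa q) * (qb (- q) = - qb q) *
  (qc (- q) = - qc q) * (qd (- q) = - qd q).
Proof. by rewrite /qa /qb /qc /qd !mxE. Qed.

Lemma quat0 : (qa 0 = 0) * (qb 0 = 0) * (qc 0 = 0) * (qd 0 = 0).
Proof. by rewrite /qa /qb /qc /qd !mxE. Qed.

Lemma quatP p q : qa p = qa q -> qb p = qb q -> qc p = qc q -> qd p = qd q -> p = q.
Proof.
move=> e0 e1 e2 e3; apply/rowP => -[[|[|[|[|//]]]] i4].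
- by rewrite (_ : Ordinal i4 = 0)//; exact: val_inj.
- by rewrite (_ : Ordinal i4 = 1)//; exact: val_inj.
- by rewrite (_ : Ordinal i4 = 2%:R)//; exact: val_inj.
- by rewrite (_ : Ordinal i4 = 3%:R)//; exact: val_inj.
Qed.

Definition qE := (quat4E, quatZ, quatN, quat0).

Definition qdot p q : R := qa p * qa q + qb p * qb q + qc p * qc q + qd p * qd q.
Definition qnorm2 q : R := qdot q q.

Definition qmul p q : quat := quat4
  (qa p * qa q - qb p * qb q - qc p * qc q - qd p * qd q)
  (qa p * qb q + qb p * qa q + qc p * qd q - qd p * qc q)
  (qa p * qc q - qb p * qd q + qc p * qa q + qd p * qb q)
  (qa p * qd q + qb p * qc q - qc p * qb q + qd p * qa q).

Definition qconj q : quat := quat4 (qa q) (- qb q) (- qc q) (- qd q).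

(** The map v |-> q v q^* on pure quaternions: a rotation followed by the scaling
of ratio [qnorm2 q]. *)
Definition rot q v : vec := vec3
  ((qa q ^+ 2 + qb q ^+ 2 - qc q ^+ 2 - qd q ^+ 2) * px v
   + 2 * (qb q * qc q - qa q * qd q) * py v + 2 * (qb q * qd q + qa q * qc q) * pz v)
  (2 * (qb q * qc q + qa q * qd q) * px v
   + (qa q ^+ 2 - qb q ^+ 2 + qc q ^+ 2 - qd q ^+ 2) * py v
   + 2 * (qc q * qd q - qa q * qb q) * pz v)
  (2 * (qb q * qd q - qa q * qc q) * px v + 2 * (qc q * qd q + qa q * qb q) * py v
   + (qa q ^+ 2 - qb q ^+ 2 - qc q ^+ 2 + qd q ^+ 2) * pz v).

Definition cross u v : vec := vec3 (py u * pz v - pz u * py v)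
  (pz u * px v - px u * pz v) (px u * py v - py u * px v).

Lemma qnorm2_ge0 q : 0 <= qnorm2 q.
Proof. by rewrite /qnorm2 /qdot -!expr2 !addr_ge0// sqr_ge0. Qed.

Lemma qnorm2_eq0 q : (qnorm2 q == 0) = (q == 0).
Proof.
apply/eqP/eqP => [|->]; last by rewrite /qnorm2 /qdot !qE !mulr0 !addr0.
rewrite /qnorm2 /qdot -!expr2 => e.
have [a b c d] : [/\ 0 <= qa q ^+ 2, 0 <= qb q ^+ 2, 0 <= qc q ^+ 2 & 0 <= qd q ^+ 2].
  by rewrite !sqr_ge0.
have z (x : R) : x ^+ 2 = 0 -> x = 0 by move/eqP; rewrite sqrf_eq0 => /eqP.
by apply: quatP; rewrite qE; apply: z; lra.
Qed.

Lemma qnorm2_gt0 q : q != 0 -> 0 < qnorm2 q.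
Proof. by move=> q0; rewrite lt_neqAle qnorm2_ge0 eq_sym qnorm2_eq0 q0. Qed.

Lemma qnorm2M p q : qnorm2 (qmul p q) = qnorm2 p * qnorm2 q.
Proof. by rewrite /qnorm2 /qdot /qmul !qE; ring. Qed.

Lemma qdotM p q r : qdot (qmul p r) (qmul q r) = qdot p q * qnorm2 r.
Proof. by rewrite /qnorm2 /qdot /qmul !qE; ring. Qed.

Lemma qmulA p q r : qmul p (qmul q r) = qmul (qmul p q) r.
Proof. by apply: quatP; rewrite /qmul !qE; ring. Qed.

Lemma rotD q u v : rot q (u + v) = rot q u + rot q v.
Proof. by apply: vecP; rewrite !pE; ring. Qed.

Lemma rotB q u v : rot q (u - v) = rot q u - rot q v.
Proof. by apply: vecP; rewrite !pE; ring. Qed.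

Lemma rotZ q a v : rot q (a *: v) = a *: rot q v.
Proof. by apply: vecP; rewrite !pE; ring. Qed.

Lemma rotZl q a v : rot (a *: q) v = a ^+ 2 *: rot q v.
Proof. by apply: vecP; rewrite !pE !qE; ring. Qed.

Lemma rotM p q v : rot (qmul p q) v = rot p (rot q v).
Proof. by apply: vecP; rewrite !pE /qmul !qE; ring. Qed.

Lemma dot_rot q u v : dot (rot q u) (rot q v) = qnorm2 q ^+ 2 * dot u v.
Proof. by rewrite !dotE !pE /qnorm2 /qdot; ring. Qed.

Lemma cross_rot q u v : cross (rot q u) (rot q v) = qnorm2 q *: rot q (cross u v).
Proof. by apply: vecP; rewrite !pE /qnorm2 /qdot; ring. Qed.

Lemma rot_conj q v : rot q (rot (qconj q) v) = qnorm2 q ^+ 2 *: v.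
Proof. by apply: vecP; rewrite !pE /qconj !qE /qnorm2 /qdot; ring. Qed.

Lemma rot_surj q v : q != 0 -> exists u, v = rot q u.
Proof.
move=> q0; exists (qnorm2 q ^- 2 *: rot (qconj q) v).
by rewrite rotZ rot_conj scalerA mulVf ?scale1r// sqrf_eq0 qnorm2_eq0.
Qed.

Lemma dotC u v : dot u v = dot v u.
Proof. by rewrite !dotE; ring. Qed.
Lemma dotDl u v w : dot (u + v) w = dot u w + dot v w.
Proof. by rewrite !dotE !pE; ring. Qed.
Lemma dotBl u v w : dot (u - v) w = dot u w - dot v w.
Proof. by rewrite !dotE !pE; ring. Qed.
Lemma dotBr u v w : dot w (u - v) = dot w u - dot w v.
Proof. by rewrite !dotE !pE; ring. Qed.
Lemma dotZl a u v : dot (a *: u) v = a * dot u v.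
Proof. by rewrite !dotE !pE; ring. Qed.
Lemma dotZr a u v : dot u (a *: v) = a * dot u v.
Proof. by rewrite !dotE !pE; ring. Qed.
Lemma dotNl u v : dot (- u) v = - dot u v.
Proof. by rewrite !dotE !pE; ring. Qed.
Lemma crossZl a u v : cross (a *: u) v = a *: cross u v.
Proof. by apply: vecP; rewrite !pE; ring. Qed.
Lemma crossZr a u v : cross u (a *: v) = a *: cross u v.
Proof. by apply: vecP; rewrite !pE; ring. Qed.

Lemma lagrange u v :
  dot (cross u v) (cross u v) = dot u u * dot v v - dot u v ^+ 2.
Proof. by rewrite !dotE !pE; ring. Qed.

Lemma dot_ge0 u : 0 <= dot u u.
Proof. by rewrite dotE -!expr2 !addr_ge0// sqr_ge0. Qed.

Lemma dot_eq0 u : dot u u = 0 -> u = 0.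
Proof.
rewrite dotE -!expr2 => e.
have [a b c] : [/\ 0 <= px u ^+ 2, 0 <= py u ^+ 2 & 0 <= pz u ^+ 2].
  by rewrite !sqr_ge0.
have z (x : R) : x ^+ 2 = 0 -> x = 0 by move/eqP; rewrite sqrf_eq0 => /eqP.
by apply: vecP; rewrite p0; apply: z; lra.
Qed.

Lemma orthogonal_exists u : exists2 m, dot m m = 1 & dot m u = 0.
Proof.
have [/eqP e|xy] := eqVneq (px u ^+ 2 + py u ^+ 2) 0.
  exists (vec3 1 0 0); rewrite !dotE !pE; first by ring.
  have := sqr_ge0 (px u); have := sqr_ge0 (py u) => y0 x0.
  have /eqP : px u ^+ 2 = 0 by move/eqP: e; lra.
  by rewrite sqrf_eq0 => /eqP ->; ring.
pose s := Num.sqrt (px u ^+ 2 + py u ^+ 2).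
have s2 : s ^+ 2 = px u ^+ 2 + py u ^+ 2 by rewrite sqr_sqrtr// addr_ge0 ?sqr_ge0.
have s0 : s != 0 by apply: contra xy => /eqP s0; rewrite -s2 s0 expr0n.
exists (s^-1 *: vec3 (- py u) (px u) 0).
  rewrite dotZl dotZr mulrA -expr2 dotE !pE exprVn s2.
  by field.
by rewrite dotZl dotE !pE; ring.
Qed.

(** The half-turn about the bisector of u and v exchanges them; if v = - u, any
half-turn about an axis orthogonal to u will do. A pure quaternion m gives the
half-turn about m. *)
Lemma rot_onto u v : dot u u = 1 -> dot v v = 1 ->
  exists2 q, q != 0 & rot q u = qnorm2 q *: v.
Proof.
move=> u1 v1.
have pureE m : rot (quat4 0 (px m) (py m) (pz m)) u = (2 * dot m u) *: m - dot m m *: u.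
  by apply: vecP; rewrite !dotE !pE !qE; ring.
have pureN m : qnorm2 (quat4 0 (px m) (py m) (pz m)) = dot m m.
  by rewrite /qnorm2 /qdot dotE !qE; ring.
have [e|uv] := eqVneq (dot (u + v) (u + v)) 0.
  have vE : v = - u by apply/eqP; rewrite -addr_eq0 addrC; apply/eqP; exact: dot_eq0.
  have [m m1 mu] := orthogonal_exists u.
  exists (quat4 0 (px m) (py m) (pz m)).
    by rewrite -qnorm2_eq0 pureN m1 oner_eq0.
  by rewrite pureE pureN m1 mu mulr0 scale0r sub0r !scale1r vE.
exists (quat4 0 (px (u + v)) (py (u + v)) (pz (u + v))).
  by rewrite -qnorm2_eq0 pureN.
rewrite pureE pureN.
have e1 : dot (u + v) (u + v) = 2 * dot (u + v) u.
  transitivity (2 * dot (u + v) u - dot u u + dot v v); last by rewrite u1 v1; ring.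
  by rewrite !dotE !pE; ring.
by rewrite -e1 -scalerBr (_ : u + v - u = v)// addrAC subrr add0r.
Qed.

(** First carry (0, 1, 0) to v, then correct by a rotation about (0, 1, 0). *)
Lemma rot_frame u v : dot u u = 1 -> dot v v = 1 -> dot u v = 0 ->
  exists q, [/\ qnorm2 q = 1, rot q (vec3 1 0 0) = u & rot q (vec3 0 1 0) = v].
Proof.
move=> u1 v1 uv.
suff [q [q0 qu qv]] : exists q, [/\ q != 0, rot q (vec3 1 0 0) = qnorm2 q *: u
    & rot q (vec3 0 1 0) = qnorm2 q *: v].
  have n0 := qnorm2_gt0 q0.
  have s2 : Num.sqrt (qnorm2 q) ^- 1 ^+ 2 = (qnorm2 q)^-1.
    by rewrite expr1 exprVn sqr_sqrtr// ltW.
  exists (Num.sqrt (qnorm2 q) ^- 1 *: q); split.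
  - rewrite /qnorm2 /qdot !qE.
    transitivity ((Num.sqrt (qnorm2 q) ^- 1) ^+ 2 * qnorm2 q).
      by rewrite /qnorm2 /qdot; ring.
    by rewrite s2 mulVf// gt_eqF.
  - by rewrite rotZl s2 qu scalerA mulVf ?scale1r// gt_eqF.
  - by rewrite rotZl s2 qv scalerA mulVf ?scale1r// gt_eqF.
have e2 : dot (vec3 0 1 0) (vec3 0 1 0) = 1 :> R by rewrite dotE !pE; ring.
have [q1 q10 q1v] := rot_onto e2 v1.
have [u' uE] := rot_surj (qnorm2 q1 *: u) q10.
have n10 := qnorm2_gt0 q10.
have y0 : py u' = 0.
  have : dot (rot q1 u') (rot q1 (vec3 0 1 0)) = 0 by rewrite -uE q1v dotZl dotZr uv !mulr0.
  rewrite dot_rot => /eqP; rewrite mulf_eq0 sqrf_eq0 (gt_eqF n10)/= => /eqP.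
  by rewrite dotE !pE => e; lra.
have n1 : px u' ^+ 2 + pz u' ^+ 2 = 1.
  have : dot (rot q1 u') (rot q1 u') = qnorm2 q1 ^+ 2.
    by rewrite -uE dotZl dotZr u1; ring.
  rewrite dot_rot => /(canRL (mulKf _)); rewrite expf_neq0 ?gt_eqF// => /(_ isT).
  by rewrite mulVf ?expf_neq0 ?gt_eqF// dotE y0 => <-; ring.
(* With u' = (cos a, 0, sin a), the quaternion 1 + cos a - (sin a) j is a
   multiple of the rotation by - a about the second axis. *)
have [q2 [q20 q2e1 q2e2]] : exists q2, [/\ q2 != 0,
    rot q2 (vec3 1 0 0) = qnorm2 q2 *: u' & rot q2 (vec3 0 1 0) = qnorm2 q2 *: vec3 0 1 0].
  have [a1|a1] := eqVneq (px u') (- 1).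
    have z0 : pz u' = 0.
      by apply/eqP; rewrite -sqrf_eq0; apply/eqP; move: n1; rewrite a1; lra.
    exists (quat4 0 0 1 0); rewrite -qnorm2_eq0 /qnorm2 /qdot !qE; split.
    - by rewrite !mulr0 mulr1 !addr0 add0r oner_eq0.
    - by apply: vecP; rewrite !pE !qE ?a1 ?z0 ?y0; ring.
    - by apply: vecP; rewrite !pE !qE; ring.
  have nE : qnorm2 (quat4 (1 + px u') 0 (- pz u') 0) = 2 * (1 + px u').
    transitivity (1 + 2 * px u' + (px u' ^+ 2 + pz u' ^+ 2)); last by rewrite n1; ring.
    by rewrite /qnorm2 /qdot !qE; ring.
  exists (quat4 (1 + px u') 0 (- pz u') 0); split.
  - by rewrite -qnorm2_eq0 nE mulf_eq0 pnatr_eq0/= addrC addr_eq0.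
  - rewrite nE; apply: vecP; rewrite !pE !qE ?y0; [|by ring|by ring].
    have z2 : pz u' ^+ 2 = 1 - px u' ^+ 2 by lra.
    transitivity ((1 + px u') ^+ 2 - pz u' ^+ 2); first by ring.
    by rewrite z2; ring.
  - rewrite nE; apply: vecP; rewrite !pE !qE; [by ring| |by ring].
    transitivity (1 + 2 * px u' + (px u' ^+ 2 + pz u' ^+ 2)); first by ring.
    by rewrite n1; ring.
exists (qmul q1 q2); rewrite qnorm2M; split.
- by rewrite -qnorm2_eq0 qnorm2M mulf_neq0 ?qnorm2_eq0.
- by rewrite rotM q2e1 rotZ -uE scalerA mulrC.
- by rewrite rotM q2e2 rotZ q1v scalerA mulrC.
Qed.

End Quaternions.

(** * Parameters for Hopf pairs *)

Section HopfPairs.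
Variable R : realType.
Local Notation vec := 'rV[R]_3.
Local Notation quat := 'rV[R]_4.

(** A Hopf pair is described by (q, p, (z, h1, h2, l1, l2)). In the coordinates v of
p + q v q^*, the planes of the two rings meet along the second axis and have
normals (z, 0, 1) and (1, 0, z) up to length; the chords that they cut out of
this axis have midpoints - 1/2 and 1/2 and half lengths l1 and l2; the centers
differ from these midpoints by h1 (1, 0, - z) and h2 (- z, 0, 1). The length of
q carries the scale. *)
Definition param : Type := (quat * vec * (R * R * R * R * R))%type.
HB.instance Definition _ := Topological.on param.
Implicit Types e : param.

Definition rotor e : quat := e.1.1.
Definition mid e : vec := e.1.2.
Definition tilt e : R := e.2.1.1.1.1.
Definition off1 e : R := e.2.1.1.1.2.
Definition off2 e : R := e.2.1.1.2.
Definition half1 e : R := e.2.1.2.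
Definition half2 e : R := e.2.2.

(** The bounds on the half lengths say that the two chords interleave. *)
Definition hopf_params : set param := [set e | [/\ rotor e != 0, `|tilt e| < 1,
  `|half1 e - half2 e| < 1 & 1 < half1 e + half2 e]].

Definition axis_norm (z : R) : R := Num.sqrt (1 + z ^+ 2).

Definition frame1 e : frame R :=
  (mid e + rot (rotor e) (vec3 (off1 e) (- 2^-1) (- (off1 e * tilt e))),
   qnorm2 (rotor e) * Num.sqrt (half1 e ^+ 2 + off1 e ^+ 2 * (1 + tilt e ^+ 2)),
   (qnorm2 (rotor e) * axis_norm (tilt e))^-1 *: rot (rotor e) (vec3 (tilt e) 0 1)).

(** The half-turns about (1, 0, 1), which exchanges the two normals and reverses the
second axis, and about the second axis, which reverses both normals. *)
Definition swap_quat : quat := quat4 0 (cos (pi / 4)) 0 (sin (pi / 4)).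
Definition flip_quat : quat := quat4 0 0 1 0.

Definition swap e : param :=
  (qmul (rotor e) swap_quat, mid e, (tilt e, off2 e, off1 e, half2 e, half1 e)).
Definition flip e : param :=
  (qmul (rotor e) flip_quat, mid e, (tilt e, - off1 e, - off2 e, half1 e, half2 e)).

(** Seen as the first ring of the swapped parameters, the second ring inherits what
is proved of the first one. *)
Definition frame2 e := frame1 (swap e).

Lemma rot_swap v : rot swap_quat v = vec3 (pz v) (- py v) (px v).
Proof.
have c := @cos2_pi4 R; have s := @sin2_pi4 R; have cs := @cos_sin_pi4 R.
rewrite /rot /swap_quat; set C := cos _ in c cs *; set S := sin _ in s cs *.
apply: vecP; rewrite !pE !qE.
- transitivity ((C ^+ 2 - S ^+ 2) * px v + 2 * (C * S) * pz v); first by ring.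
  by rewrite c s cs; field.
- transitivity (- (C ^+ 2 + S ^+ 2) * py v); first by ring.
  by rewrite c s; field.
- transitivity ((S ^+ 2 - C ^+ 2) * pz v + 2 * (C * S) * px v); first by ring.
  by rewrite c s cs; field.
Qed.

Lemma qnorm2_swap : qnorm2 swap_quat = 1.
Proof.
have c := @cos2_pi4 R; have s := @sin2_pi4 R.
by rewrite /qnorm2 /qdot !qE -!expr2 c s; field.
Qed.

Lemma rot_flip (v : vec) : rot flip_quat v = vec3 (- px v) (py v) (- pz v).
Proof. by apply: vecP; rewrite !pE !qE; ring. Qed.

Lemma qnorm2_flip : qnorm2 flip_quat = 1 :> R.
Proof. by rewrite /qnorm2 /qdot !qE; ring. Qed.

Lemma frame2E e : frame2 e =
  (mid e + rot (rotor e) (vec3 (- (off2 e * tilt e)) 2^-1 (off2 e)),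
   qnorm2 (rotor e) * Num.sqrt (half2 e ^+ 2 + off2 e ^+ 2 * (1 + tilt e ^+ 2)),
   (qnorm2 (rotor e) * axis_norm (tilt e))^-1 *: rot (rotor e) (vec3 1 0 (tilt e))).
Proof.
rewrite /frame2 /frame1 /swap /mid /rotor /tilt /off1 /half1/=.
rewrite qnorm2M qnorm2_swap mulr1 !rotM !rot_swap !pE opprK oppr0.
by [].
Qed.

Lemma frame1_opp e : frame1 (- rotor e, mid e, (tilt e, off1 e, off2 e, half1 e, half2 e))
  = frame1 e.
Proof.
rewrite /frame1 /mid /rotor /tilt /off1 /half1/=.
have -> : - e.1.1 = (-1) *: e.1.1 by rewrite scaleN1r.
rewrite !rotZl sqrrN expr1n !scale1r; congr (_, _ * _, (_ * _)^-1 *: _).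
  by rewrite /qnorm2 /qdot !qE; ring.
by rewrite /qnorm2 /qdot !qE; ring.
Qed.

Lemma qmul_swap2 q : qmul (qmul q swap_quat) swap_quat = - q.
Proof.
have c := @cos2_pi4 R; have s := @sin2_pi4 R.
rewrite -qmulA -scaleN1r; have -> : qmul swap_quat swap_quat = quat4 (-1) 0 0 0.
  apply: quatP; rewrite /qmul !qE; try by ring.
  by transitivity (- (cos (pi / 4) ^+ 2 + sin (pi / 4) ^+ 2) : R); [ring|rewrite c s; field].
by apply: quatP; rewrite /qmul !qE; ring.
Qed.

Lemma frame2_swap e : frame2 (swap e) = frame1 e.
Proof. by rewrite /frame2 /swap {1}/rotor/= qmul_swap2 frame1_opp. Qed.

Lemma frame1_flip e : frame1 (flip e) =
  (center (frame1 e), radius (frame1 e), - normal (frame1 e)).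
Proof.
rewrite /frame1 /center /radius /normal /flip /mid /rotor /tilt /off1 /half1/=.
rewrite qnorm2M qnorm2_flip mulr1 !rotM !rot_flip !pE sqrrN mulNr !opprK.
congr (_, _, _); rewrite -scalerN; congr (_ *: _).
by rewrite -scaleN1r -rotZ; congr rot; apply: vecP; rewrite !pE; ring.
Qed.

Lemma frame2_flip e : frame2 (flip e) =
  (center (frame2 e), radius (frame2 e), - normal (frame2 e)).
Proof.
rewrite !frame2E /center /radius /normal /flip /mid /rotor /tilt /off2 /half2/=.
rewrite qnorm2M qnorm2_flip mulr1 !rotM !rot_flip !pE sqrrN mulNr !opprK.
congr (_, _, _); rewrite -scalerN; congr (_ *: _).
by rewrite -scaleN1r -rotZ; congr rot; apply: vecP; rewrite !pE; ring.
Qed.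

Lemma qmul_neq0 (p q : quat) : qnorm2 q = 1 -> p != 0 -> qmul p q != 0.
Proof. by move=> q1; rewrite -!qnorm2_eq0 qnorm2M q1 mulr1. Qed.

Lemma swap_params e : hopf_params e -> hopf_params (swap e).
Proof.
move=> [q0 z1 l1 l2]; split=> //.
- exact: qmul_neq0 qnorm2_swap q0.
- by rewrite distrC.
- by rewrite addrC.
Qed.

Lemma flip_params e : hopf_params e -> hopf_params (flip e).
Proof. by move=> [q0 z1 l1 l2]; split=> //; exact: qmul_neq0 qnorm2_flip q0. Qed.

Lemma axis_norm2 z : axis_norm z ^+ 2 = 1 + z ^+ 2.
Proof. by rewrite sqr_sqrtr// addr_ge0 ?sqr_ge0. Qed.

Lemma axis_norm_gt0 z : 0 < axis_norm z.
Proof. by rewrite sqrtr_gt0 ltr_wpDr ?sqr_ge0. Qed.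

Section Facts.
Variable e : param.
Hypothesis De : hopf_params e.
Local Notation w := (qnorm2 (rotor e)).
Local Notation z := (tilt e).
Local Notation N := (axis_norm (tilt e)).

Lemma rotor_gt0 : 0 < w.
Proof. by case: De => q0 _ _ _; exact: qnorm2_gt0. Qed.

Lemma half1_gt0 : 0 < half1 e.
Proof. by case: De => _ _; rewrite ltr_norml => /andP[a b] c; lra. Qed.

Lemma tilt2_lt1 : 0 < 1 - z ^+ 2.
Proof. by case: De => _ z1 _ _; rewrite subr_gt0 -real_normK ?num_real// expr_lt1. Qed.

Lemma radius1_sq : radius (frame1 e) ^+ 2 =
  w ^+ 2 * (half1 e ^+ 2 + off1 e ^+ 2 * (1 + z ^+ 2)).
Proof.
rewrite exprMn sqr_sqrtr// addr_ge0 ?sqr_ge0// mulr_ge0 ?sqr_ge0//.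
by rewrite addr_ge0 ?sqr_ge0.
Qed.

Lemma is_frame1 : is_frame (frame1 e).
Proof.
have w0 := rotor_gt0; have l0 := half1_gt0.
split.
  rewrite mulr_gt0// sqrtr_gt0 ltr_wpDr ?exprn_gt0// mulr_ge0 ?sqr_ge0//.
  by rewrite addr_ge0 ?sqr_ge0.
rewrite /normal/= dotZl dotZr dot_rot dotE !pE.
have N0 := axis_norm_gt0 z; have N2 := axis_norm2 z.
transitivity ((w * N)^-1 ^+ 2 * (w ^+ 2 * (1 + z ^+ 2))); first by ring.
by rewrite -N2; field; rewrite !gt_eqF.
Qed.

Lemma plane1E v : plane (frame1 e) (mid e + rot (rotor e) v) <-> px v * z + pz v = 0.
Proof.
have w0 := rotor_gt0; have N0 := axis_norm_gt0 z.
rewrite /plane/= /normal /center/= opprD addrACA subrr add0r -rotB dotZl dot_rot.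
rewrite dotE !pE; split.
  move/eqP; rewrite mulf_eq0 invr_eq0 mulf_eq0 (gt_eqF w0) (gt_eqF N0)/=.
  by rewrite mulf_eq0 expf_eq0 (gt_eqF w0)/= => /eqP <-; ring.
move=> h; transitivity ((w * N)^-1 * (w ^+ 2 * (px v * z + pz v))); first by ring.
by rewrite h !mulr0.
Qed.

Lemma ring1E v : ring_of (frame1 e) (mid e + rot (rotor e) v) <->
  px v * z + pz v = 0 /\ (px v - off1 e) ^+ 2 + (py v + 2^-1) ^+ 2
    + (pz v + off1 e * z) ^+ 2 = half1 e ^+ 2 + off1 e ^+ 2 * (1 + z ^+ 2).
Proof.
have w0 := rotor_gt0.
rewrite /ring_of/= radius1_sq plane1E; apply: and_iff_compat_l.
rewrite /center/= opprD addrACA subrr add0r -rotB dot_rot.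
split=> [/(mulfI _)|<-]; last by rewrite dotE !pE; ring.
by rewrite expf_neq0 ?gt_eqF// => /(_ isT) <-; rewrite dotE !pE; ring.
Qed.

End Facts.

Lemma ring2E e : hopf_params e -> forall v,
  ring_of (frame2 e) (mid e + rot (rotor e) v) <->
  px v + pz v * tilt e = 0 /\ (px v + off2 e * tilt e) ^+ 2 + (py v - 2^-1) ^+ 2
    + (pz v - off2 e) ^+ 2 = half2 e ^+ 2 + off2 e ^+ 2 * (1 + tilt e ^+ 2).
Proof.
move=> De v; have := ring1E (swap_params De) (vec3 (pz v) (- py v) (px v)).
have vE : vec3 (px v) (py v) (pz v) = v by apply: vecP; rewrite !pE.
rewrite /frame2 {1}/mid {1}/rotor/= rotM rot_swap !pE opprK vE => ->.
rewrite /tilt /off1 /off2 /half1/=.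
by split=> -[a b]; (split; [rewrite -a; ring|rewrite -b; ring]).
Qed.

Definition pair_frames e : {ptws 'I_2 -> frame R} :=
  fun i => if i == 0 then frame1 e else frame2 e.

(** Heron's product for the triangle of sides a, b and 1. *)
Lemma heron (a b : R) : `|a - b| < 1 -> 1 < a + b ->
  0 < 2 * a ^+ 2 * b ^+ 2 + 2 * a ^+ 2 + 2 * b ^+ 2 - a ^+ 4 - b ^+ 4 - 1.
Proof.
rewrite ltr_norml => /andP[h1 h2] h3.
have -> : 2 * a ^+ 2 * b ^+ 2 + 2 * a ^+ 2 + 2 * b ^+ 2 - a ^+ 4 - b ^+ 4 - 1 =
  (a + b + 1) * (a + b - 1) * ((1 + (a - b)) * (1 - (a - b))) by ring.
by rewrite !mulr_gt0//; lra.
Qed.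

Lemma ord2P (i : 'I_2) : i = 0 \/ i = 1.
Proof. by case: i => -[|[|//]] i2; [left|right]; exact: val_inj. Qed.

(** A common point would lie on both planes, hence on the second axis, at distance
l1 from - 1/2 and l2 from 1/2: the triangle of sides l1, l2, 1 would be flat. *)
Lemma pair_config e : hopf_params e -> config setT (pair_frames e).
Proof.
move=> De; have dis : ring_of (frame1 e) `&` ring_of (frame2 e) = set0.
  apply/seteqP; split=> // x [x1 x2]; exfalso.
  have [q0 _ l1 l2] := De; have z2 := tilt2_lt1 De.
  have [v vE] := rot_surj (x - mid e) q0.
  have {}vE : x = mid e + rot (rotor e) v by rewrite -vE addrC subrK.
  move: x1 x2; rewrite vE => /(ring1E De)[a1 b1] /(ring2E De)[a2 b2].
  have x0 : px v = 0.
    apply/eqP; have /eqP : (1 - tilt e ^+ 2) * px v = 0.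
      transitivity ((px v + pz v * tilt e) - (px v * tilt e + pz v) * tilt e); first by ring.
      by rewrite a1 a2 mul0r subrr.
    by rewrite mulf_eq0 gt_eqF.
  have z0 : pz v = 0 by rewrite -a1 x0; ring.
  have {}b1 : half1 e ^+ 2 = (py v + 2^-1) ^+ 2.
    by apply: (addIr (off1 e ^+ 2 * (1 + tilt e ^+ 2))); rewrite -b1 x0 z0; ring.
  have {}b2 : half2 e ^+ 2 = (py v - 2^-1) ^+ 2.
    by apply: (addIr (off2 e ^+ 2 * (1 + tilt e ^+ 2))); rewrite -b2 x0 z0; ring.
  have := heron l1 l2.
  rewrite -[4%N]/(2 * 2)%N !exprM b1 b2.
  by rewrite [X in 0 < X](_ : _ = 0) ?ltxx//; field.
split=> // [i|i j].
  by rewrite /pair_frames; case: ifP => _; apply: is_frame1 => //; exact: swap_params.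
by case: (ord2P i) => ->; case: (ord2P j) => -> //; rewrite /pair_frames/= setIC.
Qed.

Definition hopf_space : Type := hopf_params.
HB.instance Definition _ := Topological.on hopf_space.

Definition hopf_pair (x : hopf_params) : config setT (k := 2) :=
  exist (fun d => d \in config setT (k := 2)) (pair_frames (val x))
    (mem_set (pair_config (set_mem (valP x)))).

End HopfPairs.

(** * Recovering the parameters from the rings *)

Section PairRecovery.
Variable R : realType.
Local Notation vec := 'rV[R]_3.
Local Notation quat := 'rV[R]_4.
Implicit Types (f g : frame R) (e : param R).

Definition cosn f g : R := dot (normal f) (normal g).
Definition sinn f g : R := Num.sqrt (1 - cosn f g ^+ 2).
(** The tangent of half the angle whose sine is [cosn] and whose cosine is [sinn]. *)
Definition rtilt f g : R := cosn f g / (1 + sinn f g).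
Definition displ f g : vec := center g - center f.
Definition orient f g : R := dot (displ f g) (cross (normal f) (normal g)).
Definition rscale f g : R := orient f g / sinn f g.
Definition col1 f g : vec :=
  (rscale f g * axis_norm (rtilt f g) / (1 - rtilt f g ^+ 2)) *:
    (normal g - rtilt f g *: normal f).
Definition col2 f g : vec := (rscale f g / sinn f g) *: cross (normal f) (normal g).
Definition col3 f g : vec :=
  (rscale f g * axis_norm (rtilt f g) / (1 - rtilt f g ^+ 2)) *:
    (normal f - rtilt f g *: normal g).
Definition roff1 f g : R :=
  - (axis_norm (rtilt f g) * dot (normal g) (displ f g) / ((1 - rtilt f g ^+ 2) * rscale f g)).
Definition roff2 f g : R :=
  axis_norm (rtilt f g) * dot (normal f) (displ f g) / ((1 - rtilt f g ^+ 2) * rscale f g).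
Definition rhalf (r h : R) f g : R :=
  Num.sqrt ((r / rscale f g) ^+ 2 - h ^+ 2 * (1 + rtilt f g ^+ 2)).

(** With w = |q|^2 and u1, u2, u3 the images of the unit vectors under [rot q], this
is 4 q q^T v: the entries of q q^T are linear in those of the matrix of [rot q]. *)
Definition quat_gram (w : R) (u1 u2 u3 : vec) (v : quat) : quat := quat4
  ((w + px u1 + py u2 + pz u3) * qa v + (pz u2 - py u3) * qb v
   + (px u3 - pz u1) * qc v + (py u1 - px u2) * qd v)
  ((pz u2 - py u3) * qa v + (w + px u1 - py u2 - pz u3) * qb v
   + (py u1 + px u2) * qc v + (pz u1 + px u3) * qd v)
  ((px u3 - pz u1) * qa v + (py u1 + px u2) * qb v
   + (w - px u1 + py u2 - pz u3) * qc v + (pz u2 + py u3) * qd v)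
  ((py u1 - px u2) * qa v + (pz u1 + px u3) * qb v
   + (pz u2 + py u3) * qc v + (w - px u1 - py u2 + pz u3) * qd v).

Lemma quat_gramE (q v : quat) :
  quat_gram (qnorm2 q) (rot q (vec3 1 0 0)) (rot q (vec3 0 1 0)) (rot q (vec3 0 0 1)) v
  = (4 * qdot q v) *: q.
Proof. by apply: quatP; rewrite !qE !pE /qnorm2 /qdot; ring. Qed.

Definition rgram (v : quat) f g : quat :=
  quat_gram (rscale f g) (col1 f g) (col2 f g) (col3 f g) v.

(** As q q^T v = <q, v> q and v^T q q^T v = <q, v>^2, normalizing gives q back up to
the sign of <q, v>. Thus v selects one of the two quaternions, continuously. *)
Definition rrotor (v : quat) f g : quat :=
  (2 * Num.sqrt (qdot (rgram v f g) v))^-1 *: rgram v f g.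

Definition rmid f g : vec := 2^-1 *: (center f + center g -
  ((roff1 f g - roff2 f g * rtilt f g) *: col1 f g
   + (roff2 f g - roff1 f g * rtilt f g) *: col3 f g)).

Definition recover (v : quat) f g : param R :=
  (rrotor v f g, rmid f g, (rtilt f g, roff1 f g, roff2 f g,
    rhalf (radius f) (roff1 f g) f g, rhalf (radius g) (roff2 f g) f g)).

Section Recover.
Variable e : param R.
Hypothesis De : hopf_params e.
Local Notation w := (qnorm2 (rotor e)).
Local Notation z := (tilt e).
Local Notation N := (axis_norm (tilt e)).
Local Notation f := (frame1 e).
Local Notation g := (frame2 e).

Let w0 : w != 0. Proof. by rewrite gt_eqF// rotor_gt0. Qed.
Let N0 : N != 0. Proof. by rewrite gt_eqF// axis_norm_gt0. Qed.
Let z0 : 1 - z ^+ 2 != 0. Proof. by rewrite gt_eqF// tilt2_lt1. Qed.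
Let N2 : N ^+ 2 = 1 + z ^+ 2. Proof. exact: axis_norm2. Qed.
Let zp : 1 + z ^+ 2 != 0. Proof. by rewrite -N2 expf_neq0. Qed.

Let n1E : normal f = (w * N)^-1 *: rot (rotor e) (vec3 z 0 1). Proof. by []. Qed.
Let n2E : normal g = (w * N)^-1 *: rot (rotor e) (vec3 1 0 z).
Proof. by rewrite frame2E. Qed.

Lemma cosnE : cosn f g = 2 * z / (1 + z ^+ 2).
Proof.
rewrite /cosn n1E n2E dotZl dotZr dot_rot dotE !pE -N2.
by field; rewrite w0 N0.
Qed.

Lemma sinnE : sinn f g = (1 - z ^+ 2) / (1 + z ^+ 2).
Proof.
rewrite /sinn cosnE.
have -> : 1 - (2 * z / (1 + z ^+ 2)) ^+ 2 = ((1 - z ^+ 2) / (1 + z ^+ 2)) ^+ 2.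
  by field.
rewrite sqrtr_sqr ger0_norm// divr_ge0 ?(ltW (tilt2_lt1 De))//.
by rewrite addr_ge0 ?sqr_ge0.
Qed.

Let S0 : sinn f g != 0.
Proof. by rewrite sinnE mulf_neq0 ?invr_neq0. Qed.

Lemma rtiltE : rtilt f g = z.
Proof.
rewrite /rtilt cosnE sinnE.
have -> : 1 + (1 - z ^+ 2) / (1 + z ^+ 2) = 2 / (1 + z ^+ 2) by field.
by field.
Qed.

Lemma displE : displ f g = rot (rotor e)
  (vec3 (- (off2 e * z) - off1 e) 1 (off2 e + off1 e * z)).
Proof.
rewrite /displ frame2E /center/= opprD addrACA subrr add0r -rotB; congr rot.
by apply: vecP; rewrite !pE; field.
Qed.

Lemma cross_normals : cross (normal f) (normal g) =
  (sinn f g / w) *: rot (rotor e) (vec3 0 1 0).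
Proof.
rewrite n1E n2E crossZl crossZr cross_rot !scalerA sinnE.
have -> : cross (vec3 z 0 1) (vec3 1 0 z) = (1 - z ^+ 2) *: vec3 0 1 0.
  by apply: vecP; rewrite !pE; ring.
rewrite rotZ scalerA -N2; congr (_ *: _); field; by rewrite w0 N0.
Qed.

Lemma orientE : orient f g = sinn f g * w.
Proof.
rewrite /orient cross_normals displE dotZr dot_rot dotE !pE.
by field.
Qed.

Lemma rscaleE : rscale f g = w.
Proof. by rewrite /rscale orientE; field. Qed.

Lemma col1E : col1 f g = rot (rotor e) (vec3 1 0 0).
Proof.
rewrite /col1 rscaleE rtiltE n1E n2E -!rotZ -rotB -rotZ.
congr rot; apply: vecP; rewrite !pE; [|by ring|by ring].
by field; rewrite w0 N0.
Qed.

Lemma col3E : col3 f g = rot (rotor e) (vec3 0 0 1).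
Proof.
rewrite /col3 rscaleE rtiltE n1E n2E -!rotZ -rotB -rotZ.
congr rot; apply: vecP; rewrite !pE; [by ring|by ring|].
by field; rewrite w0 N0.
Qed.

Lemma col2E : col2 f g = rot (rotor e) (vec3 0 1 0).
Proof.
rewrite /col2 rscaleE cross_normals scalerA.
by rewrite (_ : _ * _ = 1) ?scale1r//; field; rewrite w0 S0.
Qed.

Lemma roff1E : roff1 f g = off1 e.
Proof.
rewrite /roff1 rtiltE rscaleE displE n2E dotZl dot_rot dotE !pE.
by field; rewrite w0 N0 z0.
Qed.

Lemma roff2E : roff2 f g = off2 e.
Proof.
rewrite /roff2 rtiltE rscaleE displE n1E dotZl dot_rot dotE !pE.
by field; rewrite w0 N0 z0.
Qed.

Lemma rhalf1E : rhalf (radius f) (roff1 f g) f g = half1 e.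
Proof.
rewrite /rhalf roff1E rscaleE rtiltE expr_div_n radius1_sq mulrAC divff ?mul1r ?expf_neq0//.
by rewrite addrK sqrtr_sqr ger0_norm// ltW// half1_gt0.
Qed.

Lemma rhalf2E : rhalf (radius g) (roff2 f g) f g = half2 e.
Proof.
have De' := swap_params De.
rewrite /rhalf roff2E rscaleE rtiltE expr_div_n radius1_sq.
rewrite {1}/rotor/= qnorm2M qnorm2_swap mulr1 -/(rotor e) mulrAC divff ?mul1r ?expf_neq0//.
by rewrite /off1 /half1 /tilt/= addrK sqrtr_sqr ger0_norm// ltW// (half1_gt0 De').
Qed.

Lemma rmidE : rmid f g = mid e.
Proof.
rewrite /rmid roff1E roff2E rtiltE col1E col3E frame2E /center/=.
by apply: vecP; rewrite !pE; field.
Qed.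

Lemma rgramE v : rgram v f g = (4 * qdot (rotor e) v) *: rotor e.
Proof. by rewrite /rgram rscaleE col1E col2E col3E quat_gramE. Qed.

Lemma rrotorE v : 0 < qdot (rotor e) v -> rrotor v f g = rotor e.
Proof.
move=> v0; rewrite /rrotor rgramE scalerA.
have -> : qdot ((4 * qdot (rotor e) v) *: rotor e) v = (2 * qdot (rotor e) v) ^+ 2.
  by rewrite /qdot !qE; ring.
rewrite sqrtr_sqr ger0_norm ?mulr_ge0// ?ltW// (_ : _ * _ = 1) ?scale1r//.
by field; rewrite gt_eqF.
Qed.

(** So [recover v] is a section of the map from parameters to pairs. *)
Lemma recoverK v : 0 < qdot (rotor e) v -> recover v f g = e.
Proof.
move=> v0; rewrite /recover rrotorE// rmidE rtiltE roff1E roff2E -{2}roff1E rhalf1E.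
rewrite -{2}roff2E rhalf2E.
by case: (e) => -[q p] [[[[? ?] ?] ?] ?].
Qed.

End Recover.
End PairRecovery.

(** * A criterion for linking *)

Section Linking.
Variable R : realType.
Local Notation vec := 'rV[R]_3.
Local Notation quat := 'rV[R]_4.
Implicit Types (f g : frame R) (e : param R).

(** The squares of the half chords cut out of the common line of the planes, times
the squared sine of the angle of the planes. In this form they make sense for
parallel planes as well; likewise [orient] is this sine times the signed
distance of the midpoints of the chords. *)
Definition chord1 f g : R :=
  radius f ^+ 2 * (1 - cosn f g ^+ 2) - dot (normal g) (displ f g) ^+ 2.
Definition chord2 f g : R :=
  radius g ^+ 2 * (1 - cosn f g ^+ 2) - dot (normal f) (displ f g) ^+ 2.
(** Sixteen times the squared area of a triangle whose sides have squares a, b, c. *)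
Definition heron3 (a b c : R) : R :=
  2 * (a * b + b * c + c * a) - a ^+ 2 - b ^+ 2 - c ^+ 2.
Definition linking f g : R := heron3 (chord1 f g) (chord2 f g) (orient f g ^+ 2).

Definition linked f g : Prop :=
  [/\ cosn f g ^+ 2 < 1, 0 < chord1 f g, 0 < chord2 f g & 0 < linking f g].

(** A closed condition satisfied by all Hopf pairs. When the planes are parallel,
[linking] vanishes, the first two inequalities say that the planes coincide, and
the last two give the triangle inequality between the radii and the distance of
the centers. *)
Definition weakly_linked f g : Prop := [/\ 0 <= chord1 f g, 0 <= chord2 f g,
  0 <= linking f g, (radius f - radius g) ^+ 2 <= dot (displ f g) (displ f g) &
  dot (displ f g) (displ f g) <= (radius f + radius g) ^+ 2].

Section Standard.
Variables (q : quat) (p : vec) (z h1 h2 D r1 r2 : R).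
Hypotheses (q1 : qnorm2 q = 1) (z1 : z ^+ 2 < 1).

Let N := axis_norm z.
Let N0 : N != 0. Proof. by rewrite gt_eqF// axis_norm_gt0. Qed.
Let N2 : N ^+ 2 = 1 + z ^+ 2. Proof. exact: axis_norm2. Qed.
Let zp : 1 + z ^+ 2 != 0. Proof. by rewrite -N2 expf_neq0. Qed.
Let z0 : 1 - z ^+ 2 != 0. Proof. by rewrite gt_eqF// subr_gt0. Qed.
Let S := (1 - z ^+ 2) / (1 + z ^+ 2).
Let S0 : 0 < S. Proof. by rewrite divr_gt0 ?subr_gt0 ?ltr_wpDr ?sqr_ge0. Qed.

(** The analogue of [frame1] for a unit quaternion, with the distance D of the
midpoints of the chords and the radii as free parameters. *)
Definition std1 : frame R := (p + rot q (vec3 h1 (- (D / 2)) (- (h1 * z))), r1,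
  N^-1 *: rot q (vec3 z 0 1)).
Definition std2 : frame R := (p + rot q (vec3 (- (h2 * z)) (D / 2) h2), r2,
  N^-1 *: rot q (vec3 1 0 z)).

Lemma std_cosn : cosn std1 std2 = 2 * z / (1 + z ^+ 2).
Proof.
rewrite /cosn /normal/= dotZl dotZr dot_rot q1 dotE !pE -N2.
by field.
Qed.

Lemma std_sin2 : 1 - cosn std1 std2 ^+ 2 = S ^+ 2.
Proof. by rewrite std_cosn /S; field. Qed.

Lemma std_displ : displ std1 std2 = rot q (vec3 (- (h2 * z) - h1) D (h2 + h1 * z)).
Proof.
rewrite /displ /center/= opprD addrACA subrr add0r -rotB; congr rot.
by apply: vecP; rewrite !pE; field.
Qed.

Lemma std_chord1 : chord1 std1 std2 = S ^+ 2 * (r1 ^+ 2 - h1 ^+ 2 * (1 + z ^+ 2)).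
Proof.
rewrite /chord1 std_sin2 std_displ /normal /radius/= dotZl dot_rot q1 dotE !pE.
transitivity (r1 ^+ 2 * S ^+ 2 - (h1 * (1 - z ^+ 2)) ^+ 2 / N ^+ 2); first by field.
by rewrite N2 /S; field.
Qed.

Lemma std_chord2 : chord2 std1 std2 = S ^+ 2 * (r2 ^+ 2 - h2 ^+ 2 * (1 + z ^+ 2)).
Proof.
rewrite /chord2 std_sin2 std_displ /normal /radius/= dotZl dot_rot q1 dotE !pE.
transitivity (r2 ^+ 2 * S ^+ 2 - (h2 * (1 - z ^+ 2)) ^+ 2 / N ^+ 2); first by field.
by rewrite N2 /S; field.
Qed.

Lemma std_orient : orient std1 std2 = S * D.
Proof.
rewrite /orient std_displ /normal/= crossZl crossZr cross_rot q1 scale1r scalerA.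
rewrite dotZr dot_rot q1 dotE !pE -expr2 exprVn N2 /S.
by field.
Qed.

Lemma std_linking : linking std1 std2 = S ^+ 4 *
  heron3 (r1 ^+ 2 - h1 ^+ 2 * (1 + z ^+ 2)) (r2 ^+ 2 - h2 ^+ 2 * (1 + z ^+ 2)) (D ^+ 2).
Proof. by rewrite /linking std_chord1 std_chord2 std_orient /heron3; ring. Qed.

Lemma std_dist : dot (displ std1 std2) (displ std1 std2) =
  D ^+ 2 + (h1 ^+ 2 + h2 ^+ 2) * (1 + z ^+ 2) + 4 * h1 * h2 * z.
Proof. by rewrite std_displ dot_rot q1 dotE !pE; ring. Qed.

Lemma std_ring1 y : (y + D / 2) ^+ 2 = r1 ^+ 2 - h1 ^+ 2 * (1 + z ^+ 2) ->
  ring_of std1 (p + rot q (vec3 0 y 0)).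
Proof.
move=> e; rewrite /ring_of/= /plane/= /center /radius /normal/= opprD addrACA subrr add0r -rotB.
rewrite dotZl !dot_rot q1 !dotE !pE; split; first by ring.
transitivity ((y + D / 2) ^+ 2 + h1 ^+ 2 * (1 + z ^+ 2)); first by ring.
by rewrite e subrK.
Qed.

Lemma std_ring2 y : (y - D / 2) ^+ 2 = r2 ^+ 2 - h2 ^+ 2 * (1 + z ^+ 2) ->
  ring_of std2 (p + rot q (vec3 0 y 0)).
Proof.
move=> e; rewrite /ring_of/= /plane/= /center /radius /normal/= opprD addrACA subrr add0r -rotB.
rewrite dotZl !dot_rot q1 !dotE !pE; split; first by ring.
transitivity ((y - D / 2) ^+ 2 + h2 ^+ 2 * (1 + z ^+ 2)); first by ring.
by rewrite e subrK.
Qed.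

(** If the triangle of the half chords and D is flat, an end point of one chord is
an end point of the other, and the rings meet there. *)
Lemma std_linking_neq0 : ring_of std1 `&` ring_of std2 = set0 ->
  0 <= chord1 std1 std2 -> linking std1 std2 != 0.
Proof.
move=> dis; rewrite std_chord1 std_linking pmulr_rge0 ?exprn_gt0// => c1.
rewrite mulf_eq0 negb_or expf_neq0 ?(gt_eqF S0)//=.
set L1 := _ - _ in c1 *; set L2 := (r2 ^+ 2 - _).
pose l := Num.sqrt L1; have l2 : l ^+ 2 = L1 by rewrite sqr_sqrtr.
have nl (m : R) : m ^+ 2 = L1 -> (m - D) ^+ 2 != L2.
  move=> m2; apply/eqP => e.
  have : (ring_of std1 `&` ring_of std2) (p + rot q (vec3 0 (m - D / 2) 0)).
    split; first by apply: std_ring1; rewrite subrK.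
    by apply: std_ring2; rewrite -/L2 -e; congr (_ ^+ _); field.
  by rewrite dis.
have -> : heron3 L1 L2 (D ^+ 2) = (L2 - (l - D) ^+ 2) * ((- l - D) ^+ 2 - L2).
  by rewrite /heron3 -l2; ring.
rewrite mulf_eq0 negb_or !subr_eq0 [L2 == _]eq_sym nl//=.
by rewrite nl// sqrrN.
Qed.

End Standard.

Lemma half_angle (c S : R) : S ^+ 2 = 1 - c ^+ 2 -> 0 < S ->
  let z := c / (1 + S) in c = 2 * z / (1 + z ^+ 2) /\ S = (1 - z ^+ 2) / (1 + z ^+ 2).
Proof.
move=> S2 S0 z; have S1 : 1 + S != 0 by rewrite gt_eqF// ltr_wpDr// ltW.
have e : 1 + z ^+ 2 = 2 / (1 + S).
  rewrite /z expr_div_n (_ : c ^+ 2 = 1 - S ^+ 2); last by rewrite S2 subKr.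
  by field.
have e' : 1 - z ^+ 2 = 2 * S / (1 + S).
  by transitivity (2 - (1 + z ^+ 2)); [ring|rewrite e; field].
by rewrite e' e /z; split; field; rewrite S1.
Qed.

(** The second axis is turned onto the common line of the planes; the images of
the other two axes are then the combinations of the normals forced by the
coordinates (z, 0, 1) and (1, 0, z). *)
Lemma standard_position f g : is_frame f -> is_frame g -> cosn f g ^+ 2 < 1 ->
  exists q p z h1 h2 D, [/\ qnorm2 q = 1, z ^+ 2 < 1,
    f = std1 q p z h1 D (radius f) & g = std2 q p z h2 D (radius g)].
Proof.
move=> [_ f1] [_ g1] c1.
pose c := cosn f g; pose S := sinn f g; pose z := rtilt f g; pose N := axis_norm z.
have S2 : S ^+ 2 = 1 - c ^+ 2 by rewrite /S sqr_sqrtr// subr_ge0 ltW.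
have S0 : 0 < S by rewrite sqrtr_gt0 subr_gt0.
have [cE SE] := half_angle S2 S0; rewrite -/(rtilt f g) -/z in cE SE.
have zp : 0 < 1 + z ^+ 2 by rewrite ltr_wpDr ?sqr_ge0.
have z1 : z ^+ 2 < 1.
  by move: S0; rewrite SE pmulr_lgt0 ?invr_gt0// subr_gt0.
have z0 : 1 - z ^+ 2 != 0 by rewrite gt_eqF// subr_gt0.
have N0 : N != 0 by rewrite gt_eqF// axis_norm_gt0.
have N2 : N ^+ 2 = 1 + z ^+ 2 by exact: axis_norm2.
have zp0 : 1 + z ^+ 2 != 0 by rewrite gt_eqF.
have fg : dot (normal f) (normal g) = c by [].
pose u := (N / (1 - z ^+ 2)) *: (normal g - z *: normal f).
pose v := S^-1 *: cross (normal f) (normal g).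
have [|||q [q1 qu qv]] := @rot_frame R u v.
- rewrite /u dotZl dotZr !(dotBl, dotBr, dotZl, dotZr) (dotC (normal g) (normal f)) fg f1 g1.
  transitivity (N ^+ 2 * ((1 + z ^+ 2 - 2 * z * c) / (1 - z ^+ 2) ^+ 2)); first by field.
  by rewrite cE N2; field; rewrite zp0 z0.
- rewrite /v dotZl dotZr lagrange f1 g1 fg mulr1 -S2.
  by field; rewrite gt_eqF.
- by rewrite /u /v !(dotZl, dotZr) !dotE !pE; ring.
have q3 : rot q (vec3 0 0 1) = (N / (1 - z ^+ 2)) *: (normal f - z *: normal g).
  have -> : rot q (vec3 0 0 1) = cross (rot q (vec3 1 0 0)) (rot q (vec3 0 1 0)).
    by rewrite cross_rot q1 scale1r; congr rot; apply: vecP; rewrite !pE; ring.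
  rewrite qu qv /u /v crossZl crossZr scalerA.
  have -> : cross (normal g - z *: normal f) (cross (normal f) (normal g)) =
      (dot (normal g) (normal g) - z * dot (normal f) (normal g)) *: normal f
      - (dot (normal f) (normal g) - z * dot (normal f) (normal f)) *: normal g.
    by apply: vecP; rewrite !dotE !pE; ring.
  rewrite f1 g1 fg.
  have -> : 1 - z * c = S by rewrite cE SE; field.
  have -> : c - z * 1 = S * z by rewrite cE SE; field.
  have S0' : S != 0 by rewrite gt_eqF.
  by apply: vecP; rewrite !pE; field; rewrite z0 S0'.
have rotE a b d : rot q (vec3 a b d) = a *: rot q (vec3 1 0 0) + b *: rot q (vec3 0 1 0)
    + d *: rot q (vec3 0 0 1).
  by rewrite -!rotZ -!rotD; congr rot; apply: vecP; rewrite !pE; ring.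
have nf : normal f = N^-1 *: rot q (vec3 z 0 1).
  rewrite rotE qu q3 /u scale0r addr0 scale1r.
  by apply: vecP; rewrite !pE; field; rewrite z0 N0.
have ng : normal g = N^-1 *: rot q (vec3 1 0 z).
  rewrite rotE qu q3 /u scale0r addr0 scale1r.
  by apply: vecP; rewrite !pE; field; rewrite z0 N0.
have q0 : q != 0 by rewrite -qnorm2_eq0 q1 oner_eq0.
have [d dE] := rot_surj (displ f g) q0.
pose h1 := - ((px d + z * pz d) / (1 - z ^+ 2)).
pose h2 := (pz d + z * px d) / (1 - z ^+ 2).
pose p := center f - rot q (vec3 h1 (- (py d / 2)) (- (h1 * z))).
exists q, p, z, h1, h2, (py d); split=> //.
  rewrite /std1 /p subrK -nf; by case: (f) => -[].
rewrite /std2 -ng.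
have -> : p + rot q (vec3 (- (h2 * z)) (py d / 2) h2) = center g.
  rewrite /p -addrA [- _ + _]addrC -rotB (_ : _ - _ = d) -?dE ?/displ ?[center f + _]addrC ?subrK//.
  by apply: vecP; rewrite !pE /h1 /h2; field.
by case: (g) => -[].
Qed.

End Linking.

Section LinkingCriterion.
Variable R : realType.
Local Notation vec := 'rV[R]_3.
Local Notation quat := 'rV[R]_4.
Implicit Types (f g : frame R) (e : param R).

Lemma heron3_gt0 (a b c : R) : 0 < heron3 a b c -> [/\ a != 0, b != 0 & c != 0].
Proof.
have h (x y : R) : 0 < heron3 0 x y -> False.
  rewrite /heron3 [X in 0 < X](_ : _ = - (x - y) ^+ 2); last by ring.
  by rewrite oppr_gt0 ltNge sqr_ge0.
move=> abc; split; apply/eqP => e; rewrite e in abc; [exact: h abc|apply: (h a c)|apply: (h a b)].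
  by move: abc; congr (0 < _); rewrite /heron3; ring.
by move: abc; congr (0 < _); rewrite /heron3; ring.
Qed.

Lemma cosn_le1 f g : is_frame f -> is_frame g -> cosn f g ^+ 2 <= 1.
Proof.
move=> [_ f1] [_ g1]; have := dot_ge0 (cross (normal f) (normal g)).
by rewrite lagrange f1 g1 mulr1 subr_ge0.
Qed.

(** The two rings lie in one plane, and by the triangle inequality there is a
triangle with the centers as two of its vertices and the radii as sides. *)
Lemma coplanar_meet f g : is_frame f -> is_frame g -> cosn f g ^+ 2 = 1 ->
  weakly_linked f g -> ring_of f `&` ring_of g !=set0.
Proof.
move=> ff fg c1 [k1 k2 _ d1 d2]; have [r1 f1] := ff; have [r2 g1] := fg.
have ngE : normal g = cosn f g *: normal f.
  apply/eqP; rewrite -subr_eq0; apply/eqP; apply: dot_eq0.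
  rewrite dotBl !dotBr !dotZl !dotZr (dotC (normal g) (normal f)) -/(cosn f g) f1 g1.
  by transitivity (1 - cosn f g ^+ 2); [ring|rewrite c1 subrr].
have nu : dot (normal f) (displ f g) = 0.
  apply/eqP; rewrite -sqrf_eq0 eq_le sqr_ge0 andbT.
  by move: k2; rewrite /chord2 c1 subrr mulr0 sub0r oppr_ge0.
set u := displ f g in nu d1 d2; set U := dot u u in d1 d2.
suff [v [v1 v2 v3]] : exists v, [/\ dot (normal f) v = 0, dot v v = radius f ^+ 2
    & dot (v - u) (v - u) = radius g ^+ 2].
  exists (center f + v); split; split.
  - by rewrite /plane/= addrAC subrr add0r.
  - by rewrite addrAC subrr add0r.
  - rewrite /plane/= ngE dotZl (_ : _ - center g = v - u); last first.
      by rewrite /u /displ; apply: vecP; rewrite !pE; ring.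
    by rewrite dotBr v1 nu subr0 mulr0.
  - rewrite (_ : _ - center g = v - u)//.
    by rewrite /u /displ; apply: vecP; rewrite !pE; ring.
have [U0|U0] := eqVneq U 0.
  have u0 : u = 0 := dot_eq0 U0.
  have r12 : radius f = radius g.
    apply/eqP; rewrite -subr_eq0 -sqrf_eq0 eq_le sqr_ge0 andbT -U0; exact: d1.
  have [m m1 mn] := orthogonal_exists (normal f).
  exists (radius f *: m); rewrite dotZr dotC mn mulr0 u0 subr0 dotZl dotZr m1 mulr1 -expr2.
  by rewrite {3}r12.
have Up : 0 < U by rewrite lt_neqAle eq_sym U0 dot_ge0.
(* The foot of the altitude of the triangle is center f + a u, and the third
   vertex is at the signed distance b |u| from it. *)
pose a := (radius f ^+ 2 - radius g ^+ 2 + U) / (2 * U).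
have b0 : 0 <= radius f ^+ 2 / U - a ^+ 2.
  have -> : radius f ^+ 2 / U - a ^+ 2 = ((radius f + radius g) ^+ 2 - U) *
      (U - (radius f - radius g) ^+ 2) / (4 * U ^+ 2) by rewrite /a; field.
  by rewrite !mulr_ge0 ?subr_ge0// invr_ge0 mulr_ge0 ?sqr_ge0.
pose b := Num.sqrt (radius f ^+ 2 / U - a ^+ 2).
have b2 : b ^+ 2 = radius f ^+ 2 / U - a ^+ 2 by rewrite sqr_sqrtr.
pose m := cross (normal f) u.
have mm : dot m m = U by rewrite lagrange f1 nu expr0n subr0 mul1r.
have mu : dot m u = 0 by rewrite /m !dotE !pE; ring.
have nm : dot (normal f) m = 0 by rewrite /m !dotE !pE; ring.
exists (a *: u + b *: m); split.
- rewrite dotC dotDl !dotZl (dotC u) nu (dotC m) nm; ring.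
- transitivity (a ^+ 2 * U + 2 * a * b * dot m u + b ^+ 2 * dot m m).
    by rewrite /U !dotE !pE; ring.
  by rewrite mu mm b2; field.
- transitivity ((a - 1) ^+ 2 * U + 2 * (a - 1) * b * dot m u + b ^+ 2 * dot m m).
    by rewrite /U !dotE !pE; ring.
  by rewrite mu mm b2 /a; field.
Qed.

(** On disjoint rings the closed condition implies the open one: parallel planes are
excluded by [coplanar_meet] and flat triangles by [std_linking_neq0]. Hence no
pair stops being linked along a path of links. *)
Lemma weakly_linkedP f g : is_frame f -> is_frame g ->
  ring_of f `&` ring_of g = set0 -> weakly_linked f g ->
  linked f g /\ orient f g != 0.
Proof.
move=> ff fg dis wl; have [k1 k2 k3 _ _] := wl.
have c1 : cosn f g ^+ 2 < 1.
  rewrite lt_neqAle cosn_le1// andbT; apply/eqP => c1.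
  by have := coplanar_meet ff fg c1 wl; rewrite dis => -[].
have lk : 0 < linking f g.
  rewrite lt_neqAle k3 andbT eq_sym.
  have [q [p [z [h1 [h2 [D [q1 z1 fE gE]]]]]]] := standard_position ff fg c1.
  by move: dis k1; rewrite fE gE; exact: std_linking_neq0.
have [a b c] := heron3_gt0 lk.
split; last by apply: contra c => /eqP ->; rewrite expr0n.
by split=> //; rewrite lt_neqAle eq_sym ?a ?b.
Qed.

Lemma triangle_heron (a b D : R) : 0 <= a -> 0 <= b -> 0 < D ->
  0 < heron3 (a ^+ 2) (b ^+ 2) (D ^+ 2) -> `|a - b| < D /\ D < a + b.
Proof.
move=> a0 b0 D0.
have -> : heron3 (a ^+ 2) (b ^+ 2) (D ^+ 2) =
  ((a + b) ^+ 2 - D ^+ 2) * (D ^+ 2 - (a - b) ^+ 2) by rewrite /heron3; ring.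
have ab : (a - b) ^+ 2 <= (a + b) ^+ 2 by have := mulr_ge0 a0 b0; nra.
have [h|h] := ltP ((a - b) ^+ 2) (D ^+ 2).
  rewrite pmulr_lgt0 ?subr_gt0// => h'; split.
    by move: h; rewrite -(real_normK (num_real (a - b))) ltr_pXn2r// ?nnegrE ?ltW.
  by move: h'; rewrite ltr_pXn2r// ?nnegrE ?addr_ge0// ltW.
by rewrite ltNge mulr_ge0_le0 ?subr_ge0 ?subr_le0// (le_trans h).
Qed.

(** In standard position, the distance D of the midpoints of the chords is positive
by the sign of [orient], and it becomes the squared norm of the quaternion. *)
Lemma linked_exists f g : is_frame f -> is_frame g -> linked f g ->
  0 < orient f g -> exists e, [/\ hopf_params e, frame1 e = f & frame2 e = g].
Proof.
move=> ff fg [c1 k1 k2 lk] o0.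
have [q [p [z [h1 [h2 [D [q1 z1 fE gE]]]]]]] := standard_position ff fg c1.
have [r10 _] := ff; have [r20 _] := fg.
move: k1 k2 lk o0 fE gE; move: (radius f) (radius g) r10 r20 => r1 r2 r10 r20.
move=> k1 k2 lk o0 fE gE; move: k1 k2 lk o0; rewrite fE gE.
rewrite std_chord1// std_chord2// std_linking// std_orient//.
have N0 := axis_norm_gt0 z; have N2 := axis_norm2 z.
have S0 : 0 < (1 - z ^+ 2) / (1 + z ^+ 2) by rewrite -N2 divr_gt0 ?subr_gt0 ?exprn_gt0.
rewrite !(pmulr_rgt0 _ (exprn_gt0 2 S0)) (pmulr_rgt0 _ (exprn_gt0 4 S0)) => L1 L2.
rewrite (pmulr_rgt0 _ S0).
pose l1 := Num.sqrt (r1 ^+ 2 - h1 ^+ 2 * (1 + z ^+ 2)).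
pose l2 := Num.sqrt (r2 ^+ 2 - h2 ^+ 2 * (1 + z ^+ 2)).
have l1E : l1 ^+ 2 = r1 ^+ 2 - h1 ^+ 2 * (1 + z ^+ 2) by rewrite sqr_sqrtr// ltW.
have l2E : l2 ^+ 2 = r2 ^+ 2 - h2 ^+ 2 * (1 + z ^+ 2) by rewrite sqr_sqrtr// ltW.
rewrite -l1E -l2E => lk D0; have [t1 t2] := triangle_heron (sqrtr_ge0 _) (sqrtr_ge0 _) D0 lk.
have q0 : q != 0 by rewrite -qnorm2_eq0 q1 oner_eq0.
have Dn : D != 0 by rewrite gt_eqF.
have sD : Num.sqrt D ^+ 2 = D by rewrite sqr_sqrtr// ltW.
pose e : param R := (Num.sqrt D *: q, p, (z, h1 / D, h2 / D, l1 / D, l2 / D)).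
have wE : qnorm2 (rotor e) = D.
  transitivity (Num.sqrt D ^+ 2 * qnorm2 q); last by rewrite sD q1 mulr1.
  by rewrite /qnorm2 /qdot !qE; ring.
have De : hopf_params e.
  split; rewrite /rotor /tilt /half1 /half2/=.
  - by rewrite scaler_eq0 negb_or q0 gt_eqF ?sqrtr_gt0.
  - by rewrite -(expr_lt1 (n := 2))// real_normK// num_real.
  - by rewrite -mulrBl normrM normfV [`|D|]gtr0_norm// ltr_pdivrMr// mul1r.
  - by rewrite -mulrDl ltr_pdivlMr// mul1r.
exists e; split=> //.
  rewrite /frame1 wE /rotor /tilt /mid /off1 /half1/= /std1 !rotZl sD.
  congr (_, _, _).
  - by congr (_ + _); rewrite -rotZ; congr rot; apply: vecP; rewrite !pE; field.
  - rewrite (_ : _ + _ = (r1 / D) ^+ 2); last by rewrite !expr_div_n l1E; field.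
    by rewrite sqrtr_sqr ger0_norm ?divr_ge0 ?ltW//; field.
  - rewrite scalerA; congr (_ *: _).
    by field; rewrite Dn gt_eqF.
rewrite frame2E wE /rotor /tilt /mid /off2 /half2/= /std2 !rotZl sD.
congr (_, _, _).
- by congr (_ + _); rewrite -rotZ; congr rot; apply: vecP; rewrite !pE; field.
- rewrite (_ : _ + _ = (r2 / D) ^+ 2); last by rewrite !expr_div_n l2E; field.
  by rewrite sqrtr_sqr ger0_norm ?divr_ge0 ?ltW//; field.
- rewrite scalerA; congr (_ *: _).
  by field; rewrite Dn gt_eqF.
Qed.

Lemma sqrM_ge0 (a h M : R) : 0 <= M -> 0 <= a ^+ 2 + h ^+ 2 * M.
Proof.
by move=> M0; apply: addr_ge0; [exact: sqr_ge0|apply: mulr_ge0 => //; exact: sqr_ge0].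
Qed.

(** The Cauchy-Schwarz inequality for (a, |x| sqrt M) and (b, |y| sqrt M). *)
Lemma product_bound (a b x y M : R) : 0 <= a -> 0 <= b -> 0 <= M ->
  a * b + `|x * y| * M <=
  Num.sqrt (a ^+ 2 + x ^+ 2 * M) * Num.sqrt (b ^+ 2 + y ^+ 2 * M).
Proof.
move=> a0 b0 M0.
have A0 := sqrM_ge0 a x M0; have B0 := sqrM_ge0 b y M0.
rewrite -(@ler_pXn2r _ 2) ?nnegrE ?mulr_ge0 ?sqrtr_ge0 ?addr_ge0 ?mulr_ge0//.
rewrite exprMn !sqr_sqrtr// normrM.
have x2 : x ^+ 2 = `|x| ^+ 2 by rewrite real_normK ?num_real.
have y2 : y ^+ 2 = `|y| ^+ 2 by rewrite real_normK ?num_real.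
rewrite x2 y2 -subr_ge0.
rewrite [leRHS](_ : _ = M * (a * `|y| - b * `|x|) ^+ 2); last by ring.
by rewrite mulr_ge0 ?sqr_ge0.
Qed.

Lemma hopf_linked e : hopf_params e -> [/\ linked (frame1 e) (frame2 e),
  0 < orient (frame1 e) (frame2 e) & weakly_linked (frame1 e) (frame2 e)].
Proof.
move=> De; have [_ z1 t1 t2] := De; have w0 := rotor_gt0 De.
set w := qnorm2 (rotor e) in w0; have wn : w != 0 by rewrite gt_eqF.
set z := tilt e in z1.
have zz1 : z ^+ 2 < 1 by rewrite -real_normK ?num_real// expr_lt1.
pose q := (Num.sqrt w)^-1 *: rotor e.
have sw : (Num.sqrt w)^-1 ^+ 2 = w^-1 by rewrite exprVn sqr_sqrtr// ltW.
have q1 : qnorm2 q = 1.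
  transitivity ((Num.sqrt w)^-1 ^+ 2 * w); last by rewrite sw mulVf.
  by rewrite /q /w /qnorm2 /qdot !qE; ring.
have rotE v : rot (rotor e) v = w *: rot q v.
  by rewrite rotZl sw scalerA divff// scale1r.
have N0 := axis_norm_gt0 z; have N2 := axis_norm2 z.
have Nn : axis_norm z != 0 by rewrite gt_eqF.
have M0 : 0 < 1 + z ^+ 2 by rewrite -N2 exprn_gt0.
pose rr a h := Num.sqrt (a ^+ 2 + h ^+ 2 * (1 + z ^+ 2)).
have E1 : frame1 e = std1 q (mid e) z (w * off1 e) w (w * rr (half1 e) (off1 e)).
  rewrite /frame1 /std1 -/w -/z !rotE scalerA; congr (_, _, _ *: _).
    by congr (_ + _); rewrite -rotZ; congr rot; apply: vecP; rewrite !pE; field.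
  by field; rewrite wn Nn.
have E2 : frame2 e = std2 q (mid e) z (w * off2 e) w (w * rr (half2 e) (off2 e)).
  rewrite frame2E /std2 -/w -/z !rotE scalerA; congr (_, _, _ *: _).
    by congr (_ + _); rewrite -rotZ; congr rot; apply: vecP; rewrite !pE; field.
  by field; rewrite wn Nn.
have a0 := half1_gt0 De; have b0 : 0 < half2 e := half1_gt0 (swap_params De).
have rrE a h : rr a h ^+ 2 = a ^+ 2 + h ^+ 2 * (1 + z ^+ 2).
  by rewrite sqr_sqrtr// sqrM_ge0// ltW.
have LE a h : (w * rr a h) ^+ 2 - (w * h) ^+ 2 * (1 + z ^+ 2) = w ^+ 2 * a ^+ 2.
  by rewrite !exprMn rrE; ring.
set S := (1 - z ^+ 2) / (1 + z ^+ 2).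
have S0 : 0 < S by rewrite divr_gt0 ?subr_gt0.
have c1 : cosn (frame1 e) (frame2 e) ^+ 2 < 1.
  by rewrite -subr_gt0 E1 E2 std_sin2// exprn_gt0.
have k1 : 0 < chord1 (frame1 e) (frame2 e).
  rewrite E1 E2 std_chord1// LE.
  exact: (mulr_gt0 (exprn_gt0 2 S0) (mulr_gt0 (exprn_gt0 2 w0) (exprn_gt0 2 a0))).
have k2 : 0 < chord2 (frame1 e) (frame2 e).
  rewrite E1 E2 std_chord2// LE.
  exact: (mulr_gt0 (exprn_gt0 2 S0) (mulr_gt0 (exprn_gt0 2 w0) (exprn_gt0 2 b0))).
have o0 : 0 < orient (frame1 e) (frame2 e) by rewrite E1 E2 std_orient// mulr_gt0.
have lk : 0 < linking (frame1 e) (frame2 e).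
  rewrite E1 E2 std_linking// !LE mulr_gt0 ?exprn_gt0//.
  rewrite [X in 0 < X](_ : _ = w ^+ 4 * (2 * half1 e ^+ 2 * half2 e ^+ 2 + 2 * half1 e ^+ 2
    + 2 * half2 e ^+ 2 - half1 e ^+ 4 - half2 e ^+ 4 - 1)); last by rewrite /heron3; ring.
  by rewrite mulr_gt0 ?exprn_gt0// heron.
split=> //; split; [exact: ltW|exact: ltW|exact: ltW| |];
  rewrite E1 E2 std_dist// /radius/=.
  rewrite -subr_ge0.
  set A := rr _ _; set B := rr _ _.
  have pb : half1 e * half2 e + `|off1 e * off2 e| * (1 + z ^+ 2) <= A * B.
    by apply: product_bound; exact: ltW.
  have A2 : A ^+ 2 = _ := rrE _ _; have B2 : B ^+ 2 = _ := rrE _ _.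
  rewrite [leRHS](_ : _ = w ^+ 2 * (1 + 4 * (off1 e * off2 e) * z +
    (off1 e ^+ 2 + off2 e ^+ 2) * (1 + z ^+ 2) - A ^+ 2 - B ^+ 2 + 2 * (A * B))); last by ring.
  rewrite mulr_ge0 ?sqr_ge0// A2 B2.
  have h1 : (half1 e - half2 e) ^+ 2 < 1 by rewrite -real_normK ?num_real// expr_lt1.
  have h2 : - (4 * (off1 e * off2 e) * z) <= 2 * (`|off1 e * off2 e| * (1 + z ^+ 2)).
    apply: le_trans (ler_norm _) _; rewrite normrN !normrM [`|4|]ger0_norm//.
    rewrite -(real_normK (num_real z)); have := mulr_ge0 (normr_ge0 (off1 e)) (normr_ge0 (off2 e)).
    by move: (`|z|) (sqr_ge0 (`|z| - 1)) => y y1; nra.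
  by lra.
rewrite -subr_ge0.
set A := rr _ _; set B := rr _ _.
have pb : half1 e * half2 e + `|off1 e * off2 e| * (1 + z ^+ 2) <= A * B.
  by apply: product_bound; exact: ltW.
have A2 : A ^+ 2 = _ := rrE _ _; have B2 : B ^+ 2 = _ := rrE _ _.
rewrite [leRHS](_ : _ = w ^+ 2 * (A ^+ 2 + B ^+ 2 + 2 * (A * B) - 1 - 4 * (off1 e * off2 e) * z -
  (off1 e ^+ 2 + off2 e ^+ 2) * (1 + z ^+ 2))); last by ring.
rewrite mulr_ge0 ?sqr_ge0// A2 B2.
have h1 : 1 < (half1 e + half2 e) ^+ 2 by rewrite exprn_egt1.
have h2 : 4 * (off1 e * off2 e) * z <= 2 * (`|off1 e * off2 e| * (1 + z ^+ 2)).
  apply: le_trans (ler_norm _) _; rewrite !normrM [`|4|]ger0_norm//.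
  rewrite -(real_normK (num_real z)); have := mulr_ge0 (normr_ge0 (off1 e)) (normr_ge0 (off2 e)).
  by move: (`|z|) (sqr_ge0 (`|z| - 1)) => y y1; nra.
by lra.
Qed.

End LinkingCriterion.

(** * Continuity at a point *)

Section ContinuousAt.
Variables (R : realType) (Y : topologicalType) (y : Y).
Implicit Types c d : Y -> R.
Local Notation ctsat f := (continuous_at y f).

Lemma ctat_cst (X : topologicalType) (x : X) : ctsat (fun=> x).
Proof. exact: cvg_cst. Qed.

Lemma ctatD c d : ctsat c -> ctsat d -> ctsat (fun y => c y + d y).
Proof. exact: cvgD. Qed.

Lemma ctatB c d : ctsat c -> ctsat d -> ctsat (fun y => c y - d y).
Proof. exact: cvgB. Qed.

Lemma ctatM c d : ctsat c -> ctsat d -> ctsat (fun y => c y * d y).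
Proof. exact: cvgM. Qed.

Lemma ctatN c : ctsat c -> ctsat (fun y => - c y).
Proof. exact: cvgN. Qed.

Lemma ctatX c n : ctsat c -> ctsat (fun y => c y ^+ n).
Proof.
move=> cc; elim: n => [|n IH].
  under [X in ctsat X]eq_fun do rewrite expr0; exact: cvg_cst.
by under [X in ctsat X]eq_fun do rewrite exprS; exact: ctatM.
Qed.

Lemma ctatV c : c y != 0 -> ctsat c -> ctsat (fun y => (c y)^-1).
Proof. by move=> c0 cc; exact: cvgV. Qed.

Lemma ctat_sqrt c : ctsat c -> ctsat (fun y => Num.sqrt (c y)).
Proof.
move=> cc; apply: (@continuous_comp _ _ _ c Num.sqrt y cc).
exact: sqrt_continuous.
Qed.

Lemma ctat_addv (V : normedModType R) (f g : Y -> V) :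
  ctsat f -> ctsat g -> ctsat (fun y => f y + g y).
Proof. exact: cvgD. Qed.

Lemma ctat_subv (V : normedModType R) (f g : Y -> V) :
  ctsat f -> ctsat g -> ctsat (fun y => f y - g y).
Proof. exact: cvgB. Qed.

Lemma ctat_scale (V : normedModType R) c (f : Y -> V) :
  ctsat c -> ctsat f -> ctsat (fun y => c y *: f y).
Proof. exact: cvgZ. Qed.

Lemma ctat_pair (X Z : topologicalType) (f : Y -> X) (g : Y -> Z) :
  ctsat f -> ctsat g -> ctsat (fun y => (f y, g y)).
Proof. exact: cvg_pair. Qed.

Lemma ctat_coord n (f : Y -> 'rV[R]_n.+1) i : ctsat f -> ctsat (fun y => f y 0 i).
Proof.
move=> cf; apply: (@continuous_comp _ _ _ f (fun M : 'rV[R]_n.+1 => M 0 i) y cf).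
exact: coord_continuous.
Qed.

Lemma ctat_row n (f : Y -> 'rV[R]_n) : (forall i, ctsat (fun y => f y 0 i)) -> ctsat f.
Proof.
move=> cf A [P nP PA]; apply: filterS; first exact: PA.
apply: filter_forall => i; apply: filter_forall => j.
by have := cf j (P i j); rewrite ord1; apply; rewrite -(ord1 i); exact: nP.
Qed.

Lemma ctat_vec3 (a b c : Y -> R) : ctsat a -> ctsat b -> ctsat c ->
  ctsat (fun y => vec3 (a y) (b y) (c y)).
Proof.
move=> ca cb cc; apply: ctat_row => i; under [X in ctsat X]eq_fun do rewrite mxE.
by case: i => -[|[|[|//]]] i3.
Qed.

Lemma ctat_quat4 (a b c d : Y -> R) : ctsat a -> ctsat b -> ctsat c -> ctsat d ->
  ctsat (fun y => quat4 (a y) (b y) (c y) (d y)).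
Proof.
move=> ca cb cc cd; apply: ctat_row => i; under [X in ctsat X]eq_fun do rewrite mxE.
by case: i => -[|[|[|[|//]]]] i3.
Qed.

End ContinuousAt.

Ltac ctat := repeat match goal with
  | |- continuous_at _ (fun _ => ?c) => exact: ctat_cst
  | H : continuous_at ?y ?f |- continuous_at ?y ?f => exact: H
  | |- is_true _ => assumption
  | |- continuous_at _ (fun y => (_, _)) => apply: ctat_pair
  | |- continuous_at _ (fun y => quat4 _ _ _ _) => apply: ctat_quat4
  | |- continuous_at _ (fun y => vec3 _ _ _) => apply: ctat_vec3
  | |- continuous_at _ (fun y => _ *: _) => apply: ctat_scale
  | |- continuous_at _ (fun y => Num.sqrt _) => apply: ctat_sqrt
  | |- continuous_at _ (fun y => _ ^+ _) => apply: ctatX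
  | |- continuous_at _ (fun y => (_)^-1) => apply: ctatV
  | |- continuous_at _ (fun y => _ * _) => apply: ctatM
  | |- continuous_at _ (fun y => _ - _) => first [apply: ctatB | apply: ctat_subv]
  | |- continuous_at _ (fun y => _ + _) => first [apply: ctatD | apply: ctat_addv]
  | |- continuous_at _ (fun y => - _) => apply: ctatN
  | |- continuous_at _ (fun y => px _) => apply: ctat_coord
  | |- continuous_at _ (fun y => py _) => apply: ctat_coord
  | |- continuous_at _ (fun y => pz _) => apply: ctat_coord
  | |- continuous_at _ (fun y => qa _) => apply: ctat_coord
  | |- continuous_at _ (fun y => qb _) => apply: ctat_coord
  | |- continuous_at _ (fun y => qc _) => apply: ctat_coord
  | |- continuous_at _ (fun y => qd _) => apply: ctat_coord
  end.

Section GeometricContinuity.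
Variables (R : realType) (Y : topologicalType) (y : Y).
Local Notation ctsat f := (continuous_at y f).
Local Notation vec := 'rV[R]_3.
Local Notation quat := 'rV[R]_4.

Lemma ctat_dot (u v : Y -> vec) : ctsat u -> ctsat v -> ctsat (fun y => dot (u y) (v y)).
Proof.
move=> cu cv.
have -> : (fun y => dot (u y) (v y)) = fun y =>
    px (u y) * px (v y) + py (u y) * py (v y) + pz (u y) * pz (v y).
  by apply/funext => x; rewrite dotE.
by ctat.
Qed.

Lemma ctat_cross (u v : Y -> vec) : ctsat u -> ctsat v ->
  ctsat (fun y => cross (u y) (v y)).
Proof. by move=> cu cv; rewrite /cross; ctat. Qed.

Lemma ctat_qdot (p q : Y -> quat) : ctsat p -> ctsat q -> ctsat (fun y => qdot (p y) (q y)).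
Proof. by move=> cu cv; rewrite /qdot; ctat. Qed.

Lemma ctat_rot (q : Y -> quat) (v : Y -> vec) : ctsat q -> ctsat v ->
  ctsat (fun y => rot (q y) (v y)).
Proof. by move=> cu cv; rewrite /rot; ctat. Qed.

Lemma ctat_qmul (p q : Y -> quat) : ctsat p -> ctsat q -> ctsat (fun y => qmul (p y) (q y)).
Proof. by move=> cu cv; rewrite /qmul; ctat. Qed.

Lemma ctat_fst (X Z : topologicalType) (f : Y -> X * Z) : ctsat f -> ctsat (fun y => (f y).1).
Proof. by move=> cf; apply: (@continuous_comp _ _ _ f fst y cf); exact: cvg_fst. Qed.

Lemma ctat_snd (X Z : topologicalType) (f : Y -> X * Z) : ctsat f -> ctsat (fun y => (f y).2).
Proof. by move=> cf; apply: (@continuous_comp _ _ _ f snd y cf); exact: cvg_snd. Qed.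

Section Frames.
Variables f g : Y -> frame R.
Hypotheses (cf : ctsat f) (cg : ctsat g).

Lemma ctat_center : ctsat (fun y => center (f y)).
Proof. by apply: ctat_fst; exact: ctat_fst. Qed.
Lemma ctat_radius : ctsat (fun y => radius (f y)).
Proof. by apply: (ctat_snd (f := fun y => (f y).1)); exact: ctat_fst. Qed.
Lemma ctat_normal : ctsat (fun y => normal (f y)).
Proof. exact: ctat_snd. Qed.
End Frames.
End GeometricContinuity.

(** * From parameters to pairs: a continuous open map *)

Section RecoverContinuity.
Variables (R : realType) (Y : topologicalType) (y : Y) (f g : Y -> frame R).
Local Notation ctsat f := (continuous_at y f).
Hypotheses (cf : ctsat f) (cg : ctsat g).
Local Notation F h := (fun y => h (f y) (g y)).

Let cfn := ctat_normal cf.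
Let cgn := ctat_normal cg.
Let cfr := ctat_radius cf.
Let cgr := ctat_radius cg.

Lemma ctat_cosn : ctsat (F (@cosn R)).
Proof. exact: ctat_dot. Qed.

Lemma ctat_displ : ctsat (F (@displ R)).
Proof. by apply: ctat_subv; exact: ctat_center. Qed.

Lemma ctat_orient : ctsat (F (@orient R)).
Proof. by apply: ctat_dot; [exact: ctat_displ|exact: ctat_cross]. Qed.

Lemma ctat_chord1 : ctsat (F (@chord1 R)).
Proof.
have cc := ctat_cosn; have cn := ctat_dot cgn ctat_displ.
by rewrite /chord1; ctat.
Qed.

Lemma ctat_chord2 : ctsat (F (@chord2 R)).
Proof.
have cc := ctat_cosn; have cn := ctat_dot cfn ctat_displ.
by rewrite /chord2; ctat.
Qed.

Lemma ctat_linking : ctsat (F (@linking R)).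
Proof.
have c1 := ctat_chord1; have c2 := ctat_chord2; have co := ctat_orient.
by rewrite /linking /heron3; ctat.
Qed.

Lemma ctat_sinn : ctsat (F (@sinn R)).
Proof. by have cc := ctat_cosn; rewrite /sinn; ctat. Qed.

Lemma ctat_rtilt : ctsat (F (@rtilt R)).
Proof.
have cc := ctat_cosn; have cs := ctat_sinn; rewrite /rtilt; ctat.
by rewrite gt_eqF// ltr_wpDr// sqrtr_ge0.
Qed.

Hypothesis s0 : sinn (f y) (g y) != 0.

Lemma ctat_rscale : ctsat (F (@rscale R)).
Proof. by have cc := ctat_orient; have cs := ctat_sinn; rewrite /rscale; ctat. Qed.

Hypothesis w0 : rscale (f y) (g y) != 0.
Hypothesis z0 : 1 - rtilt (f y) (g y) ^+ 2 != 0.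

Lemma ctat_recover (v : 'rV[R]_4) :
  0 < qdot (rgram v (f y) (g y)) v ->
  ctsat (fun y => qdot (rgram v (f y) (g y)) v) /\ ctsat (F (recover v)).
Proof.
move=> v0; have cs := ctat_sinn; have cz := ctat_rtilt; have cw := ctat_rscale.
have cfc := ctat_center cf; have cgc := ctat_center cg.
have cN : ctsat (fun y => axis_norm (rtilt (f y) (g y))) by rewrite /axis_norm; ctat.
have c1 : ctsat (F (@col1 R)) by rewrite /col1; ctat.
have c3 : ctsat (F (@col3 R)) by rewrite /col3; ctat.
have cX := ctat_cross cfn cgn.
have c2 : ctsat (F (@col2 R)) by rewrite /col2; ctat.
have zw0 : (1 - rtilt (f y) (g y) ^+ 2) * rscale (f y) (g y) != 0 by rewrite mulf_neq0.
have cdf := ctat_dot cfn ctat_displ; have cdg := ctat_dot cgn ctat_displ.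
have ch1 : ctsat (F (@roff1 R)) by rewrite /roff1; ctat.
have ch2 : ctsat (F (@roff2 R)) by rewrite /roff2; ctat.
have cG : ctsat (F (rgram v)) by rewrite /rgram /quat_gram; ctat.
have cq : ctsat (fun y => qdot (rgram v (f y) (g y)) v).
  by apply: ctat_qdot => //; exact: ctat_cst.
split=> //; rewrite /recover; apply: ctat_pair; first apply: ctat_pair.
- rewrite /rrotor; ctat.
  by rewrite mulf_neq0 ?pnatr_eq0// gt_eqF// sqrtr_gt0.
- by rewrite /rmid; ctat.
- by rewrite /rhalf; ctat.
Qed.

End RecoverContinuity.

Section HopfPairMap.
Variable R : realType.
Local Notation frames := (config (setT : set 'rV[R]_3) (k := 2)).
Implicit Types d : config (setT : set 'rV[R]_3) (k := 2).

Lemma cts_config_coord (k : nat) (M : set 'rV[R]_3) (i : 'I_k) :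
  continuous (fun d : config M (k := k) => val d i : frame R).
Proof.
apply: (cts_comp (f := fun d : config M (k := k) => val d) (g := fun c : {ptws 'I_k -> frame R} => c i)).
  exact: initial_continuous.
exact: (@proj_continuous _ (fun=> frame R) i).
Qed.

Lemma cts_into_config (k : nat) (M : set 'rV[R]_3) (Y : topologicalType)
    (c : Y -> config M (k := k)) :
  (forall i, continuous (fun y => val (c y) i : frame R)) -> continuous c.
Proof.
move=> cc; apply: continuous_comp_initial => y; apply/cvg_sup => i.
by apply: (@continuous_comp_initial _ _ _ (fun f => f i)) => {}y; exact: cc.
Qed.

Lemma cts_param (Y : topologicalType) (e : Y -> param R) : continuous e ->
  [/\ continuous (fun y => rotor (e y)), continuous (fun y => mid (e y)),
      continuous (fun y => tilt (e y)) &
   [/\ continuous (fun y => off1 (e y)), continuous (fun y => off2 (e y)),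
      continuous (fun y => half1 (e y)) & continuous (fun y => half2 (e y))]].
Proof.
move=> ce; have c2 : continuous (fun y => (e y).2) by move=> y; exact: ctat_snd.
have c1 : continuous (fun y => (e y).1) by move=> y; exact: ctat_fst.
have c21 : continuous (fun y => (e y).2.1) by move=> y; exact: (ctat_fst (c2 y)).
have c211 : continuous (fun y => (e y).2.1.1) by move=> y; exact: (ctat_fst (c21 y)).
have c2111 : continuous (fun y => (e y).2.1.1.1) by move=> y; exact: (ctat_fst (c211 y)).
split; [| | |split]; move=> y.
- exact: (ctat_fst (c1 y)).
- exact: (ctat_snd (c1 y)).
- exact: (ctat_fst (c2111 y)).
- exact: (ctat_snd (c2111 y)).
- exact: (ctat_snd (c211 y)).
- exact: (ctat_snd (c21 y)).
- exact: (ctat_snd (c2 y)).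
Qed.

Lemma cts_frame1 (Y : topologicalType) (e : Y -> param R) : continuous e ->
  (forall y, hopf_params (e y)) -> continuous (fun y => frame1 (e y)).
Proof.
move=> ce De; have [cq cp cz [ch1 ch2 cl1 cl2]] := cts_param ce.
move=> y; have {}cq := cq y; have {}cp := cp y; have {}cz := cz y.
have {}ch1 := ch1 y; have {}cl1 := cl1 y.
have cn : continuous_at y (fun y => qnorm2 (rotor (e y))) by exact: ctat_qdot.
have w0 : qnorm2 (rotor (e y)) != 0 by rewrite gt_eqF// rotor_gt0.
have N0 : axis_norm (tilt (e y)) != 0 by rewrite gt_eqF// axis_norm_gt0.
have wN0 := mulf_neq0 w0 N0.
have cN : continuous_at y (fun y => axis_norm (tilt (e y))) by rewrite /axis_norm; ctat.
rewrite /frame1; apply: ctat_pair; first apply: ctat_pair.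
- by apply: ctat_addv => //; apply: ctat_rot => //; ctat.
- by ctat.
- by apply: ctat_scale; [ctat|apply: ctat_rot => //; ctat].
Qed.

Lemma cts_swap (Y : topologicalType) (e : Y -> param R) : continuous e ->
  continuous (fun y => swap (e y)).
Proof.
move=> ce; have [cq cp cz [ch1 ch2 cl1 cl2]] := cts_param ce => y.
rewrite /swap; apply: ctat_pair; first apply: ctat_pair; last 1 first.
- by do ![apply: ctat_pair]; auto.
- by apply: ctat_qmul; [exact: cq|exact: ctat_cst].
- exact: cp.
Qed.

Lemma cts_flip (Y : topologicalType) (e : Y -> param R) : continuous e ->
  continuous (fun y => flip (e y)).
Proof.
move=> ce; have [cq cp cz [ch1 ch2 cl1 cl2]] := cts_param ce => y.
rewrite /flip; apply: ctat_pair; first apply: ctat_pair; last 1 first.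
- by do ![apply: ctat_pair]; auto; apply: ctatN; auto.
- by apply: ctat_qmul; [exact: cq|exact: ctat_cst].
- exact: cp.
Qed.

Lemma cts_val_hopf : continuous (fun x : hopf_space R => val x : param R).
Proof. exact: initial_continuous. Qed.

Lemma hopf_pair_continuous : continuous (@hopf_pair R : hopf_space R -> frames).
Proof.
apply: cts_into_config => i; rewrite /hopf_pair/= /pair_frames.
have De (x : hopf_space R) : hopf_params (val x) := set_mem (valP x).
have [->|->] := ord2P i; first exact: (cts_frame1 cts_val_hopf).
apply: (cts_frame1 (e := fun x : hopf_space R => swap (val x))).
  exact: (cts_swap cts_val_hopf).
by move=> x; exact: swap_params.
Qed.

Lemma opp_params (e : param R) : hopf_params e ->
  hopf_params (- rotor e, mid e, (tilt e, off1 e, off2 e, half1 e, half2 e)).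
Proof. by move=> [q0 z1 l1 l2]; split=> //; rewrite /rotor/= oppr_eq0. Qed.

Lemma pair_frames_opp (e : param R) :
  pair_frames (- rotor e, mid e, (tilt e, off1 e, off2 e, half1 e, half2 e)) = pair_frames e.
Proof.
apply/funext => i; rewrite /pair_frames frame1_opp; case: ifP => // _.
rewrite /frame2 -frame1_opp /swap/=; congr frame1; congr (_, _, _).
by rewrite /rotor/=; apply: quatP; rewrite /qmul !qE; ring.
Qed.

(** The quaternions q and - q describe the same pair. *)
Lemma pair_params_sign (e : param R) (v : 'rV[R]_4) : hopf_params e -> qdot (rotor e) v != 0 ->
  exists e', [/\ hopf_params e', pair_frames e' = pair_frames e & 0 < qdot (rotor e') v].
Proof.
move=> De; rewrite neq_lt => /orP[n|p]; last by exists e.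
exists (- rotor e, mid e, (tilt e, off1 e, off2 e, half1 e, half2 e)).
split; [exact: opp_params|exact: pair_frames_opp|].
rewrite [X in 0 < X](_ : _ = - qdot (rotor e) v) ?oppr_gt0//.
by rewrite {1}/rotor/= /qdot !qE; ring.
Qed.

Lemma pair_exists (d : frames) : linked (val d 0) (val d 1) -> 0 < orient (val d 0) (val d 1) ->
  exists2 e, hopf_params e & pair_frames e = val d.
Proof.
move=> lk o0; have [fd _ _] := set_mem (valP d).
have [e [De e1 e2]] := linked_exists (fd 0) (fd 1) lk o0.
exists e => //; apply/funext => i.
by case: (ord2P i) => ->; rewrite /pair_frames/= ?e1 ?e2.
Qed.

Lemma near_lt_continuous (Y : topologicalType) (y : Y) (h : Y -> R) (a : R) :
  continuous_at y h -> a < h y -> \forall x \near y, a < h x.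
Proof. by move=> ch ay; exact: (ch _ (lt_nbhsr ay)). Qed.

(** A pair near that of x satisfies the strict inequalities of [linked], so it comes
from some parameters e. Up to the sign of its quaternion, e is given by
[recover], which is continuous, so e is near x. *)
Lemma hopf_pair_open (A : set (hopf_space R)) : open A ->
  open ((@hopf_pair R : hopf_space R -> frames) @` A).
Proof.
move=> [B oB AB]; rewrite openE => _ [x Ax <-].
have De : hopf_params (val x) := set_mem (valP x).
set d0 : frames := hopf_pair x; set v := rotor (val x).
have [[c1 k1 k2 lk] o0 _] := hopf_linked De.
have cf : continuous_at d0 (fun d : frames => val d 0 : frame R) by exact: cts_config_coord.
have cg : continuous_at d0 (fun d : frames => val d 1 : frame R) by exact: cts_config_coord.
have v0 : 0 < qdot (rgram v (val d0 0) (val d0 1)) v.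
  have w0 : 0 < qdot (rotor (val x)) v by exact: rotor_gt0.
  rewrite [X in 0 < X](_ : _ = 4 * (qdot (rotor (val x)) v) ^+ 2).
    by rewrite mulr_gt0// exprn_gt0.
  by rewrite /= rgramE// /qdot !qE; ring.
have [||||cq cr] := @ctat_recover _ _ _ _ _ cf cg _ _ _ v.
- by rewrite /= sinnE// gt_eqF// divr_gt0 ?tilt2_lt1// ltr_wpDr ?sqr_ge0.
- by rewrite /= rscaleE// gt_eqF// rotor_gt0.
- by rewrite /= rtiltE// gt_eqF// tilt2_lt1.
- exact: v0.
have nB : nbhs (recover v (val d0 0) (val d0 1)) B.
  apply: open_nbhs_nbhs; split=> //; rewrite /= recoverK//; last exact: rotor_gt0.
  by move: Ax; rewrite -AB.
have nv := near_lt_continuous cq v0.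
near=> d.
have lkd : linked (val d 0) (val d 1).
  split.
  - rewrite -subr_gt0; near: d; apply: (near_lt_continuous (h := fun d : frames => 1 - cosn (val d 0) (val d 1) ^+ 2)).
      by apply: ctatB; [exact: ctat_cst|apply: ctatX; exact: (ctat_cosn cf cg)].
    by rewrite subr_gt0.
  - by near: d; apply: (near_lt_continuous (ctat_chord1 cf cg)).
  - by near: d; apply: (near_lt_continuous (ctat_chord2 cf cg)).
  - by near: d; apply: (near_lt_continuous (ctat_linking cf cg)).
have od : 0 < orient (val d 0) (val d 1).
  by near: d; apply: (near_lt_continuous (ctat_orient cf cg)).
have [e De' ed] := pair_exists lkd od.
have vd : 0 < qdot (rgram v (val d 0) (val d 1)) v by near: d; exact: nv.
have qv : qdot (rotor e) v != 0.
  apply: contraL vd => /eqP qv; rewrite -ed /pair_frames/= rgramE// qv mulr0 scale0r.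
  by rewrite /qdot !qE !mul0r !addr0 ltxx.
have [e' [De'' ee' qv']] := pair_params_sign De' qv.
have Be' : B e'.
  rewrite -(recoverK De'' qv').
  have -> : frame1 e' = val d 0 by rewrite -ed -ee'.
  have -> : frame2 e' = val d 1 by rewrite -ed -ee'.
  by near: d; exact: cr.
exists (exist (fun e => e \in @hopf_params R) e' (mem_set De'')).
  by rewrite -AB.
by apply: val_inj; rewrite /= ee'.
Unshelve. all: by end_near. Qed.

End HopfPairMap.

(** * The covering of the space of links *)

Section Relabelling.
Variable R : realType.
Implicit Types f g : frame R.

Definition resign (b : bool) f : frame R :=
  (center f, radius f, if b then - normal f else normal f).

Lemma plane_resign b f : plane (resign b f) = plane f.
Proof.
case: b; apply/seteqP; split=> x; rewrite /plane/= /resign /normal/center/= ?dotNl; lra.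
Qed.

Lemma ring_resign b f : ring_of (resign b f) = ring_of f.
Proof. by rewrite /ring_of plane_resign. Qed.

(** For unit normals n and m, the vector m - <m, n> n is orthogonal to n, hence to m
if the planes are equal; so it vanishes. *)
Lemma same_ringP f g : is_frame f -> is_frame g -> same_ring f g ->
  exists b, g = resign b f.
Proof.
move=> [_ f1] [_ g1] [fc fr fp].
set c := dot (normal g) (normal f).
have e : normal g = c *: normal f.
  have : plane f (center f + (normal g - c *: normal f)).
    rewrite /plane/= addrAC subrr add0r dotBr dotZr f1 (dotC (normal f)) -/c; ring.
  rewrite fp /plane/= fc addrAC subrr add0r dotBr dotZr g1 -/c => c1.
  apply/eqP; rewrite -subr_eq0; apply/eqP; apply: dot_eq0.
  rewrite dotBl !dotBr !dotZl !dotZr (dotC (normal f)) -/c f1 g1.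
  by rewrite !mulr1 subrr subr0.
have c2 : c ^+ 2 = 1 by move: g1; rewrite {1}e {1}e dotZl dotZr f1 mulr1 expr2.
have gE : g = (center f, radius f, normal g) by rewrite fc fr; case: (g) => -[].
move/eqP: c2; rewrite sqrf_eq1 => /orP[/eqP c1|/eqP c1].
  by exists false; rewrite gE e c1 scale1r.
by exists true; rewrite gE e c1 scaleN1r.
Qed.

Lemma same_ring_resign b f : same_ring f (resign b f).
Proof. by split=> //; rewrite plane_resign. Qed.

Lemma cts_resign (Y : topologicalType) b (f : Y -> frame R) :
  continuous f -> continuous (fun y => resign b (f y)).
Proof.
move=> cf y; have cc := ctat_center (cf y); have cr := ctat_radius (cf y).
have cn := ctat_normal (cf y).
rewrite /resign; apply: ctat_pair; first exact: ctat_pair.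
by case: b => //; exact: cvgN.
Qed.

Section Config.
Variables (M : set 'rV[R]_3) (k : nat).
Local Notation frames := (config M (k := k)).
Implicit Types d e : config M (k := k).

Lemma config_relabel d (s : {perm 'I_k}) (b : 'I_k -> bool) :
  config M (fun i => resign (b i) (val d (s i))).
Proof.
have [fd Md dd] := set_mem (valP d); split=> [i|i|i j ij].
- have [r0 n1] := fd (s i); split=> //; rewrite /resign /normal/=.
  by case: (b i) => //; rewrite -scaleN1r dotZl dotZr mulN1r mulN1r opprK.
- by rewrite ring_resign.
- by rewrite !ring_resign dd// (inj_eq perm_inj).
Qed.

Definition relabel (s : {perm 'I_k}) (b : 'I_k -> bool) d : frames :=
  exist (fun c => c \in config M (k := k)) (fun i => resign (b i) (val d (s i)))
    (mem_set (config_relabel d s b)).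

Lemma relabel_continuous s b : continuous (relabel s b).
Proof.
by apply: cts_into_config => i; apply: cts_resign; exact: cts_config_coord.
Qed.

Lemma same_link_relabel s b d : same_link d (relabel s b d).
Proof.
apply/asboolP; exists (s^-1)%g => i; rewrite /= permKV.
exact: same_ring_resign.
Qed.

Lemma same_linkP d e : same_link d e -> exists s b, e = relabel s b d.
Proof.
move=> /asboolP[s se]; exists (s^-1)%g.
have [fd _ _] := set_mem (valP d); have [fe _ _] := set_mem (valP e).
have /choice[b bE] : forall i, exists b, val e i = resign b (val d ((s^-1)%g i)).
  move=> i; apply: same_ringP => //.
  by have := se ((s^-1)%g i); rewrite permKV.
by exists b; apply: val_inj; apply/funext => i /=; rewrite bE.
Qed.

(** The families whose link is that of a member of A form the union of the preimages
of A under the relabellings. *)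
Lemma link_of_open (A : set frames) : open A -> open (@link_of R M k @` A).
Proof.
move=> oA; change (open (@link_of R M k @^-1` (@link_of R M k @` A))).
rewrite openE => d [e Ae /link_ofP]; rewrite same_link_sym => /same_linkP[s [b eE]].
have nA : nbhs (relabel s b d) A by apply: open_nbhs_nbhs; rewrite -eE.
have nd : nbhs d (relabel s b @^-1` A) by apply: relabel_continuous.
apply: (filterS _ nd) => d' /= Ad'.
exists (relabel s b d') => //; apply/link_ofP; rewrite same_link_sym.
exact: same_link_relabel.
Qed.

End Config.

Lemma chord1_resign b c f g : chord1 (resign b f) (resign c g) = chord1 f g.
Proof.
rewrite /chord1 /cosn /displ /resign /normal /center /radius/=.
by case: b; case: c; rewrite ?dotNl ?(dotC _ (- _)) ?dotNl ?sqrrN ?(dotC g.2 f.2) //.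
Qed.

Lemma chord2_resign b c f g : chord2 (resign b f) (resign c g) = chord2 f g.
Proof.
rewrite /chord2 /cosn /displ /resign /normal /center /radius/=.
by case: b; case: c; rewrite ?dotNl ?(dotC _ (- _)) ?dotNl ?sqrrN ?(dotC g.2 f.2) //.
Qed.

Lemma orient_resign b c f g : orient (resign b f) (resign c g) =
  if b (+) c then - orient f g else orient f g.
Proof.
rewrite /orient /displ /resign /normal /center/=.
by case: b; case: c => //=; rewrite !dotE !pE; ring.
Qed.

Lemma linking_resign b c f g : linking (resign b f) (resign c g) = linking f g.
Proof.
by rewrite /linking chord1_resign chord2_resign orient_resign; case: ifP; rewrite ?sqrrN.
Qed.

Lemma weakly_linked_resign b c f g :
  weakly_linked f g -> weakly_linked (resign b f) (resign c g).
Proof.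
by move=> [k1 k2 k3 d1 d2]; split; rewrite ?chord1_resign ?chord2_resign ?linking_resign.
Qed.

Lemma cosnC f g : cosn g f = cosn f g. Proof. exact: dotC. Qed.

Lemma displC f g : displ g f = - displ f g. Proof. by rewrite /displ opprB. Qed.

Lemma dot_opp (u v : 'rV[R]_3) : dot u (- v) = - dot u v.
Proof. by rewrite dotC dotNl dotC. Qed.

Lemma weakly_linked_sym f g : weakly_linked f g -> weakly_linked g f.
Proof.
move=> [k1 k2 k3 d1 d2].
have e1 : chord1 g f = chord2 f g by rewrite /chord1 cosnC displC dot_opp sqrrN.
have e2 : chord2 g f = chord1 f g by rewrite /chord2 cosnC displC dot_opp sqrrN.
have e3 : orient g f = orient f g.
  by rewrite /orient displC dotNl !dotE !pE; ring.
have e4 : dot (displ g f) (displ g f) = dot (displ f g) (displ f g).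
  by rewrite displC dotNl dot_opp opprK.
split; rewrite ?e1 ?e2 ?e4 //.
- by move: k3; rewrite /linking e1 e2 e3; congr (0 <= _); rewrite /heron3; ring.
- by rewrite -sqrrN opprB.
- by rewrite addrC.
Qed.

End Relabelling.

Section HopfCover.
Variable R : realType.
Local Notation frames := (config (setT : set 'rV[R]_3) (k := 2)).
Local Notation link := (ring_link (setT : set 'rV[R]_3) 2).
Implicit Types d : config (setT : set 'rV[R]_3) (k := 2).

Lemma perm2P (s : {perm 'I_2}) : (s 0 = 0 /\ s 1 = 1) \/ (s 0 = 1 /\ s 1 = 0).
Proof.
have inj : s 0 != s 1 by rewrite (inj_eq perm_inj).
by case: (ord2P (s 0)) (ord2P (s 1)) inj => -> [] ->; auto.
Qed.

Definition hopf_cover (x : hopf_space R) : link := link_of (hopf_pair x).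

Lemma hopf_cover_continuous : continuous hopf_cover.
Proof. exact: (cts_comp (@hopf_pair_continuous R) (@link_of_continuous _ _ _)). Qed.

Lemma hopf_cover_open (A : set (hopf_space R)) : open A -> open (hopf_cover @` A).
Proof.
move=> /hopf_pair_open/link_of_open; congr open.
by rewrite image_comp.
Qed.

(** Reversing one of the normals reverses [orient], so one of the two choices comes
from parameters. *)
Lemma hopf_cover_rangeP d :
  range hopf_cover (link_of d) <-> weakly_linked (val d 0) (val d 1).
Proof.
split.
  move=> [x _ /link_ofP/same_linkP[s [b dE]]]; rewrite dE/=.
  have [_ _ wl] := hopf_linked (set_mem (valP x)).
  apply: weakly_linked_resign.
  by have [[-> ->]|[-> ->]] := perm2P s; [|apply: weakly_linked_sym].
move=> wl; have [fd _ dd] := set_mem (valP d).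
have [|lk o0] := weakly_linkedP (fd 0) (fd 1) _ wl; first exact: dd.
suff [d' [s [b d'E]] [lk' o']] : exists2 d', exists s b, d' = relabel s b d &
    linked (val d' 0) (val d' 1) /\ 0 < orient (val d' 0) (val d' 1).
  have [e De ed] := pair_exists lk' o'.
  exists (exist (fun e => e \in @hopf_params R) e (mem_set De)) => //.
  apply/link_ofP; rewrite same_link_sym (_ : hopf_pair _ = d'); last exact: val_inj.
  by rewrite d'E; exact: same_link_relabel.
pose b (i : 'I_2) := (i == 0) && (orient (val d 0) (val d 1) < 0).
exists (relabel 1%g b d); first by exists 1%g, b.
rewrite /= !perm1; split.
  case: lk => c1 k1 k2 k3; split; rewrite ?chord1_resign ?chord2_resign ?linking_resign//.
  rewrite /cosn /resign/= {1}/normal/=.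
  by case: (b 0); rewrite ?dotNl ?sqrrN.
rewrite orient_resign /b/= addbF.
case: ifP => h; first by rewrite oppr_gt0.
by rewrite lt_neqAle eq_sym o0 leNgt h.
Qed.

Lemma hopf_cover_closed : closed (range hopf_cover).
Proof.
rewrite -openC; change (open (@link_of R setT 2 @^-1` (~` range hopf_cover))).
rewrite -[_ @^-1` _]/(~` (@link_of R setT 2 @^-1` range hopf_cover)) openC.
have -> : @link_of R setT 2 @^-1` range hopf_cover =
    [set d : frames | weakly_linked (val d 0) (val d 1)].
  by apply/seteqP; split=> d /= /hopf_cover_rangeP.
have cf (d : frames) : continuous_at d (fun d : frames => val d 0 : frame R).
  exact: cts_config_coord.
have cg (d : frames) : continuous_at d (fun d : frames => val d 1 : frame R).
  exact: cts_config_coord.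
have cl (h : frames -> R) : continuous h -> closed [set d : frames | 0 <= h d].
  by move=> ch; apply: (@closed_comp _ _ h [set r | 0 <= r]) => [? _|]; [exact: ch|exact: closed_ge].
have -> : [set d : frames | weakly_linked (val d 0) (val d 1)] =
  [set d : frames | 0 <= chord1 (val d 0) (val d 1)] `&`
  [set d : frames | 0 <= chord2 (val d 0) (val d 1)] `&`
  [set d : frames | 0 <= linking (val d 0) (val d 1)] `&`
  [set d : frames | 0 <= dot (displ (val d 0) (val d 1)) (displ (val d 0) (val d 1))
     - (radius (val d 0) - radius (val d 1)) ^+ 2] `&`
  [set d : frames | 0 <= (radius (val d 0) + radius (val d 1)) ^+ 2
     - dot (displ (val d 0) (val d 1)) (displ (val d 0) (val d 1))].
  apply/seteqP; split=> d /=.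
    by move=> [k1 k2 k3 d1 d2]; do !split => //; rewrite subr_ge0.
  by move=> [[[[k1 k2] k3] d1] d2]; split=> //; rewrite -subr_ge0.
have cd (d : frames) : continuous_at d
    (fun d : frames => dot (displ (val d 0) (val d 1)) (displ (val d 0) (val d 1))).
  by apply: ctat_dot; exact: (ctat_displ (cf d) (cg d)).
do ![apply: closedI]; apply: cl => d.
- exact: (ctat_chord1 (cf d) (cg d)).
- exact: (ctat_chord2 (cf d) (cg d)).
- exact: (ctat_linking (cf d) (cg d)).
- apply: ctatB => //; apply: ctatX; apply: ctatB; [exact: (ctat_radius (cf d))|exact: (ctat_radius (cg d))].
- apply: ctatB => //; apply: ctatX; apply: ctatD; [exact: (ctat_radius (cf d))|exact: (ctat_radius (cg d))].
Qed.

Definition swap_deck (x : hopf_space R) : hopf_space R :=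
  exist (fun e => e \in @hopf_params R) (swap (val x))
    (mem_set (swap_params (set_mem (valP x)))).
Definition flip_deck (x : hopf_space R) : hopf_space R :=
  exist (fun e => e \in @hopf_params R) (flip (val x))
    (mem_set (flip_params (set_mem (valP x)))).

Lemma swap_deck_continuous : continuous swap_deck.
Proof. by apply: continuous_comp_initial; exact: (cts_swap (@cts_val_hopf R)). Qed.

Lemma flip_deck_continuous : continuous flip_deck.
Proof. by apply: continuous_comp_initial; exact: (cts_flip (@cts_val_hopf R)). Qed.

Lemma hopf_cover_swap x : hopf_cover (swap_deck x) = hopf_cover x.
Proof.
apply/link_ofP; rewrite same_link_sym.
rewrite (_ : hopf_pair (swap_deck x) = relabel (tperm 0 1) (fun=> false) (hopf_pair x)).
  exact: same_link_relabel.
apply: val_inj; apply/funext => i /=; rewrite /pair_frames.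
have [->|->] := ord2P i; rewrite ?tpermL ?tpermR /=.
  by rewrite -/(frame2 (val x)); case: (frame2 _) => -[].
by rewrite frame2_swap; case: (frame1 _) => -[].
Qed.

Lemma hopf_cover_flip x : hopf_cover (flip_deck x) = hopf_cover x.
Proof.
apply/link_ofP; rewrite same_link_sym.
rewrite (_ : hopf_pair (flip_deck x) = relabel 1%g (fun=> true) (hopf_pair x)).
  exact: same_link_relabel.
apply: val_inj; apply/funext => i /=; rewrite /pair_frames perm1.
by have [->|->] := ord2P i; rewrite /= ?frame1_flip ?frame2_flip.
Qed.

Lemma flip_deck2 x : val (flip_deck (flip_deck x)) =
  (- rotor (val x), mid (val x), (tilt (val x), off1 (val x), off2 (val x), half1 (val x), half2 (val x))).
Proof.
rewrite /= /flip /mid /tilt /off1 /off2 /half1 /half2/= !opprK; congr (_, _, _).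
by rewrite /rotor/=; apply: quatP; rewrite /qmul !qE; ring.
Qed.

Lemma param_eta (e : param R) :
  e = (rotor e, mid e, (tilt e, off1 e, off2 e, half1 e, half2 e)).
Proof. by case: e => -[q p] [[[[? ?] ?] ?] ?]. Qed.

Lemma flip_deck4 x : flip_deck (flip_deck (flip_deck (flip_deck x))) = x.
Proof.
apply: val_inj; rewrite flip_deck2 [in RHS](param_eta (val x)).
rewrite flip_deck2 /rotor/mid/tilt/off1/off2/half1/half2/=; by rewrite opprK.
Qed.

Lemma swap_deck2 x : swap_deck (swap_deck x) = flip_deck (flip_deck x).
Proof.
apply: val_inj; rewrite flip_deck2 /= /swap.
by rewrite /rotor/mid/tilt/off1/off2/half1/half2/= qmul_swap2.
Qed.

Lemma flip_swap_quat :
  qmul (qmul (@flip_quat R) (@swap_quat R)) (@flip_quat R) = @swap_quat R.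
Proof. by apply: quatP; rewrite /qmul !qE; ring. Qed.

Lemma flip_swap x : flip_deck (swap_deck (flip_deck x)) = swap_deck x.
Proof.
apply: val_inj; rewrite /= /swap /flip /mid /tilt /off1 /off2 /half1 /half2/= !opprK.
by rewrite /rotor/= -!qmulA [qmul (flip_quat R) _]qmulA flip_swap_quat.
Qed.

(** The quaternions of x and y are not orthogonal, as the pair determines q q^T; up
to a sign [recover] then gives the same parameters for both. *)
Lemma pair_frames_inj (x y : hopf_space R) : hopf_pair x = hopf_pair y ->
  y = x \/ y = flip_deck (flip_deck x).
Proof.
have Dx : hopf_params (val x) := set_mem (valP x).
have Dy : hopf_params (val y) := set_mem (valP y).
move=> /(congr1 val)/= xy.
have f1 : frame1 (val x) = frame1 (val y) by have := congr1 (fun d : 'I_2 -> frame R => d 0) xy.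
have f2 : frame2 (val x) = frame2 (val y) by have := congr1 (fun d : 'I_2 -> frame R => d 1) xy.
have q0 : qdot (rotor (val y)) (rotor (val x)) != 0.
  apply/eqP => q0; have := rgramE Dx (rotor (val x)).
  rewrite f1 f2 (rgramE Dy) q0 mulr0 scale0r => /esym/eqP.
  rewrite scaler_eq0 mulf_eq0 pnatr_eq0/= (gt_eqF (rotor_gt0 Dx))/=.
  by case: Dx => /negbTE ->.
have K e : hopf_params e -> 0 < qdot (rotor e) (rotor (val x)) ->
    frame1 e = frame1 (val x) -> frame2 e = frame2 (val x) -> e = val x.
  move=> De p e1 e2; rewrite -(recoverK De p) e1 e2 recoverK//; exact: rotor_gt0.
move: q0; rewrite neq_lt => /orP[n|p]; last by left; apply: val_inj; apply: K.
right; apply: val_inj; rewrite flip_deck2.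
rewrite -(K (val (flip_deck (flip_deck y)))) ?flip_deck2.
- by rewrite {1}(param_eta (val y)) /rotor/mid/tilt/off1/off2/half1/half2/= opprK.
- exact: opp_params.
- rewrite [X in 0 < X](_ : _ = - qdot (rotor (val y)) (rotor (val x))) ?oppr_gt0//.
  by rewrite {1}/rotor/= /qdot !qE; ring.
- by have := congr1 (fun d : 'I_2 -> frame R => d 0) (pair_frames_opp (val y)); rewrite /pair_frames/= => ->.
- by have := congr1 (fun d : 'I_2 -> frame R => d 1) (pair_frames_opp (val y)); rewrite /pair_frames/= => ->.
Qed.

(** Every element of the group generated by the two maps, the quaternion group of
order 8, is uniquely of this form with k < 4. *)
Definition deck (k : nat) (b : bool) (x : hopf_space R) : hopf_space R :=
  iter k flip_deck (if b then swap_deck x else x).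

Lemma hopf_cover_deck k b x : hopf_cover (deck k b x) = hopf_cover x.
Proof.
rewrite /deck; elim: k => [|k IH] /=; last by rewrite hopf_cover_flip.
by case: b => //; exact: hopf_cover_swap.
Qed.

(** Two families for the same link differ by the order and by the normals. Since
[orient] is positive on parameters and unchanged by the exchange of the rings,
either both normals are reversed or none is. *)
Lemma hopf_cover_fibre x y : hopf_cover x = hopf_cover y ->
  exists k b, (k < 4)%N /\ y = deck k b x.
Proof.
move=> /link_ofP/same_linkP[s [b yE]].
suff H x' : hopf_cover x' = hopf_cover x -> (exists b', hopf_pair y = relabel 1%g b' (hopf_pair x')) ->
    exists k, (k < 4)%N /\ y = iter k flip_deck x'.
  have [[s0 s1]|[s0 s1]] := perm2P s.
    have [|k [k4 yk]] := H x erefl; last by exists k, false.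
    exists b; rewrite yE; apply: val_inj; apply/funext => i /=; rewrite perm1.
    by have [->|->] := ord2P i; rewrite ?s0 ?s1.
  have [|k [k4 yk]] := H _ (hopf_cover_swap x); last by exists k, true.
  exists b; rewrite yE; apply: val_inj; apply/funext => i /=; rewrite perm1 /pair_frames.
  by have [->|->] := ord2P i; rewrite ?s0 ?s1//= frame2_swap.
move=> _ [c yc].
have Dx : hopf_params (val x') := set_mem (valP x').
have Dy : hopf_params (val y) := set_mem (valP y).
have [_ ox _] := hopf_linked Dx; have [_ oy _] := hopf_linked Dy.
have f1 : frame1 (val y) = resign (c 0) (frame1 (val x')).
  by have := congr1 (fun d => val d 0) yc; rewrite /= perm1.
have f2 : frame2 (val y) = resign (c 1) (frame2 (val x')).
  by have := congr1 (fun d => val d 1) yc; rewrite /= perm1.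
have cc : c 0 = c 1.
  move: oy; rewrite f1 f2 orient_resign; case: ifP => [_|/negbT].
    by rewrite oppr_gt0 => /(lt_trans ox); rewrite ltxx.
  by rewrite negb_add => /eqP.
have [c0|c0] := boolP (c 0).
  have [|->|->] := @pair_frames_inj (flip_deck x') y.
  - apply: val_inj; apply/funext => i /=; rewrite /pair_frames.
    have [->|->] := ord2P i; rewrite /= ?f1 ?f2 -?cc c0 ?frame1_flip ?frame2_flip//.
  - by exists 1%N.
  - by exists 3%N.
have [|->|->] := @pair_frames_inj x' y.
- apply: val_inj; apply/funext => i /=; rewrite /pair_frames.
  have [->|->] := ord2P i; rewrite /= ?f1 ?f2 -?cc (negbTE c0) /resign.
    by case: (frame1 _) => -[].
  by case: (frame2 _) => -[].
- by exists 0%N.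
- by exists 2%N.
Qed.

End HopfCover.

(** * Deck transformations and simple connectedness *)

Section HopfCovering.
Variable R : realType.
Local Notation I := (unit_interval R).
Implicit Types x y : hopf_space R.

(** The angle of the two quaternions is less than pi / 4. Distinct quaternions over
one link are orthogonal or opposite, so at most one of them is that close to a
given one. *)
Definition hopf_close x y : Prop :=
  0 < qdot (rotor (val x)) (rotor (val y)) /\
  qnorm2 (rotor (val x)) * qnorm2 (rotor (val y)) <
    2 * qdot (rotor (val x)) (rotor (val y)) ^+ 2.

Lemma hopf_close_swap x y : hopf_close x y -> hopf_close (swap_deck x) (swap_deck y).
Proof.
move=> [h1 h2]; split; rewrite /rotor/= ?qnorm2M !qdotM !qnorm2_swap !mulr1//.
Qed.

Lemma hopf_close_flip x y : hopf_close x y -> hopf_close (flip_deck x) (flip_deck y).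
Proof.
move=> [h1 h2]; split; rewrite /rotor/= ?qnorm2M !qdotM !qnorm2_flip !mulr1//.
Qed.

Lemma hopf_close_deck k b x y : hopf_close x y -> hopf_close (deck k b x) (deck k b y).
Proof.
move=> xy; rewrite /deck; elim: k => [|k IH] /=; last exact: hopf_close_flip.
by case: b => //; exact: hopf_close_swap.
Qed.

Lemma bessel (a b c : 'rV[R]_4) : 0 < qnorm2 b -> qnorm2 c = qnorm2 b -> qdot b c = 0 ->
  qdot a b ^+ 2 + qdot a c ^+ 2 <= qnorm2 a * qnorm2 b.
Proof.
move=> b0 cb bc; set B := qnorm2 b in b0 cb *.
pose v := quat4 (B * qa a - qdot a b * qa b - qdot a c * qa c)
  (B * qb a - qdot a b * qb b - qdot a c * qb c)
  (B * qc a - qdot a b * qc b - qdot a c * qc c)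
  (B * qd a - qdot a b * qd b - qdot a c * qd c).
have := qnorm2_ge0 v.
have -> : qnorm2 v = B * (B * qnorm2 a - qdot a b ^+ 2 - qdot a c ^+ 2).
  transitivity (B ^+ 2 * qnorm2 a + qdot a b ^+ 2 * qnorm2 b + qdot a c ^+ 2 * qnorm2 c
    - 2 * B * qdot a b ^+ 2 - 2 * B * qdot a c ^+ 2 + 2 * qdot a b * qdot a c * qdot b c).
    by rewrite /v /qnorm2 [qdot (quat4 _ _ _ _) _]/qdot !qE /qdot; ring.
  by rewrite cb bc -/B; ring.
by rewrite pmulr_rge0// => h; lra.
Qed.

Lemma qnorm2_deck k b x : qnorm2 (rotor (val (deck k b x))) = qnorm2 (rotor (val x)).
Proof.
rewrite /deck; elim: k => [|k IH] /=.
  by case: b => //; rewrite {1}/rotor/= qnorm2M qnorm2_swap mulr1.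
by rewrite {1}/rotor/= qnorm2M qnorm2_flip mulr1.
Qed.

Lemma deck_rotor k b x : (k < 4)%N ->
  [\/ deck k b x = x, rotor (val (deck k b x)) = - rotor (val x) |
      qdot (rotor (val x)) (rotor (val (deck k b x))) = 0].
Proof.
case: k => [|[|[|[|//]]]] _; case: b; rewrite /deck/=.
- by apply: Or33; rewrite /rotor/= /qdot /qmul !qE; ring.
- exact: Or31.
- by apply: Or33; rewrite /rotor/= /qdot /qmul !qE; ring.
- by apply: Or33; rewrite /rotor/= /qdot /qmul !qE; ring.
- by apply: Or33; rewrite /rotor/= /qdot /qmul !qE; ring.
- by apply: Or32; rewrite /rotor/=; apply: quatP; rewrite /qmul !qE; ring.
- by apply: Or33; rewrite /rotor/= /qdot /qmul !qE; ring.
- by apply: Or33; rewrite /rotor/= /qdot /qmul !qE; ring.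
Qed.

Lemma hopf_covering : covering (@hopf_cover R) hopf_close.
Proof.
have Dx x : hopf_params (val x) := set_mem (valP x).
split.
- exact: hopf_cover_continuous.
- exact: hopf_cover_open.
- exact: hopf_cover_closed.
- move=> x; have w0 := rotor_gt0 (Dx x); split; first exact: w0.
  rewrite -/(qnorm2 _) -expr2; have := exprn_gt0 2 w0; lra.
- have c1 : continuous (fun p : hopf_space R * hopf_space R => rotor (val p.1)).
    have [] // := cts_param (e := fun p : hopf_space R * hopf_space R => val p.1).
    by apply: (cts_comp (f := fun p : hopf_space R * hopf_space R => p.1) _ (@cts_val_hopf R)); cts.
  have c2 : continuous (fun p : hopf_space R * hopf_space R => rotor (val p.2)).
    have [] // := cts_param (e := fun p : hopf_space R * hopf_space R => val p.2).
    by apply: (cts_comp (f := fun p : hopf_space R * hopf_space R => p.2) _ (@cts_val_hopf R)); cts.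
  pose h1 (p : hopf_space R * hopf_space R) := qdot (rotor (val p.1)) (rotor (val p.2)).
  pose h2 (p : hopf_space R * hopf_space R) := 2 * h1 p ^+ 2 -
    qnorm2 (rotor (val p.1)) * qnorm2 (rotor (val p.2)).
  have ch1 : continuous h1 by move=> p; exact: (ctat_qdot (c1 p) (c2 p)).
  have ch2 : continuous h2.
    move=> p; have a := ch1 p.
    have b := ctat_qdot (c1 p) (c1 p); have c := ctat_qdot (c2 p) (c2 p).
    by apply: ctatB; [apply: ctatM; [exact: ctat_cst|exact: ctatX]|exact: ctatM].
  have -> : [set ab : hopf_space R * hopf_space R | hopf_close ab.1 ab.2] =
      h1 @^-1` [set r | 0 < r] `&` h2 @^-1` [set r | 0 < r].
    by apply/seteqP; split=> p [a b]; split=> //; move: b; rewrite /= subr_gt0.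
  by apply: openI; apply: open_comp (@open_gt _ 0) => p _; [exact: ch1|exact: ch2].
- move=> x y y' [xy1 xy2] [xy1' xy2'] /hopf_cover_fibre[k [b [k4 y'E]]].
  have [e|e|e] := deck_rotor b y k4; rewrite -y'E in e.
  + by [].
  + exfalso; move: xy1'; rewrite e [X in 0 < X](_ : _ = - qdot (rotor (val x)) (rotor (val y))).
      by rewrite oppr_gt0 => /(lt_trans xy1); rewrite ltxx.
    by rewrite /qdot !qE; ring.
  + exfalso; have nE : qnorm2 (rotor (val y')) = qnorm2 (rotor (val y)) by rewrite y'E qnorm2_deck.
    have := bessel (rotor (val x)) (rotor_gt0 (Dx y)) nE e.
    by rewrite nE in xy2'; lra.
- move=> x y x' xy /hopf_cover_fibre[k [b [_ ->]]].
  by exists (deck k b y); [exact: hopf_close_deck|rewrite hopf_cover_deck].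
Qed.

Lemma hopf_space_hausdorff : hausdorff_space (hopf_space R).
Proof.
have := @norm_hausdorff R ('rV[R]_4 * 'rV[R]_3 * (R * R * R * R * R))%type.
rewrite !open_hausdorff => H x y xy.
have /H[[A B] /=] : val x != val y by apply: contra xy => /eqP/val_inj ->.
rewrite !inE => -[Ax By] [oA oB AB].
exists (val @^-1` A, val @^-1` B); rewrite !inE//=; split.
- by apply: open_comp oA => ? _; exact: cts_val_hopf.
- by apply: open_comp oB => ? _; exact: cts_val_hopf.
- by apply/eqP; rewrite -preimage_setI AB preimage_set0.
Qed.

Lemma convex_lt (s a b m : R) : 0 <= s <= 1 -> a < m -> b < m -> (1 - s) * a + s * b < m.
Proof.
move=> /andP[s0 s1] am bm.
have [->|sn0] := eqVneq s 0; first by rewrite subr0 mul1r mul0r addr0.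
have sp : 0 < s by rewrite lt_neqAle eq_sym sn0.
have p1 : (1 - s) * a <= (1 - s) * m by rewrite ler_wpM2l ?subr_ge0// ltW.
have p2 : s * b < s * m by rewrite ltr_pM2l.
by lra.
Qed.

(** Apart from the quaternion, the parameters range over a convex set. *)
Lemma hopf_space_simply_connected x y (F G : {path I from x to y}) : homotopic F G.
Proof.
have cF : continuous (fun t => val (F t)).
  by apply: (cts_comp (f := F) _ (@cts_val_hopf R)); exact: cts_fun.
have cG : continuous (fun t => val (G t)).
  by apply: (cts_comp (f := G) _ (@cts_val_hopf R)); exact: cts_fun.
have D (z : hopf_space R) : hopf_params (val z) := set_mem (valP z).
have Dq (z : hopf_space R) : @punctured R 1 (rotor (val z)) by case: (D z).
have [cFq cFp cFz [cF1 cF2 cF3 cF4]] := cts_param cF.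
have [cGq cGp cGz [cG1 cG2 cG3 cG4]] := cts_param cG.
pose pt (z : hopf_space R) : @punctured R 1 := exist (fun v => v \in @punctured R 1) (rotor (val z)) (mem_set (Dq z)).
have [||Fq FqE] := sub_path (x := pt x) (y := pt y) cFq (fun t => Dq (F t)).
- by rewrite [F _]path_zero.
- by rewrite [F _]path_one.
have [||Gq GqE] := sub_path (x := pt x) (y := pt y) cGq (fun t => Dq (G t)).
- by rewrite [G _]path_zero.
- by rewrite [G _]path_one.
have [h [ch h0 h1 hx hy]] := punctured_simply_connected Fq Gq.
pose lin (c : param R -> R) (s t : I) := (1 - val s) * c (val (F t)) + val s * c (val (G t)).
pose H (s t : I) : param R := (val (h s t),
  (1 - val s) *: mid (val (F t)) + val s *: mid (val (G t)),
  (lin (@tilt R) s t, lin (@off1 R) s t, lin (@off2 R) s t, lin (@half1 R) s t, lin (@half2 R) s t)).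
have s01 (s : I) : 0 <= val s <= 1 by rewrite uival_ge0 uival_le1.
have clin (c : param R -> R) : continuous (fun t => c (val (F t))) ->
    continuous (fun t => c (val (G t))) -> continuous (fun p : I * I => lin c p.1 p.2).
  move=> cf cg.
  have cfp : continuous (fun p : I * I => c (val (F p.2))).
    by apply: (cts_comp (f := fun p : I * I => p.2) _ cf); cts.
  have cgp : continuous (fun p : I * I => c (val (G p.2))).
    by apply: (cts_comp (f := fun p : I * I => p.2) _ cg); cts.
  have cs : continuous (fun p : I * I => val p.1) by cts.
  apply: ctsD; apply: ctsM => //; exact: ctsB (@cts_cst _ _ _) _.
apply: (sub_homotopic (h := H)).
- have cs : continuous (fun p : I * I => val p.1) by cts.
  have cs' : continuous (fun p : I * I => 1 - val p.1) by cts.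
  have cmF : continuous (fun p : I * I => mid (val (F p.2))).
    by apply: (cts_comp (f := fun p : I * I => p.2) _ cFp); cts.
  have cmG : continuous (fun p : I * I => mid (val (G p.2))).
    by apply: (cts_comp (f := fun p : I * I => p.2) _ cGp); cts.
  have chv : continuous (fun p : I * I => val (h p.1 p.2)).
    apply: (cts_comp (f := fun p : I * I => h p.1 p.2) ch (g := fun v : @punctured R 1 => val v)).
    exact: initial_continuous.
  have l1 := clin _ cFz cGz; have l2 := clin _ cF1 cG1; have l3 := clin _ cF2 cG2.
  have l4 := clin _ cF3 cG3; have l5 := clin _ cF4 cG4.
  move=> p; rewrite /H; apply: ctat_pair; first apply: ctat_pair.
  + exact: chv.
  + by apply: ctat_addv; apply: ctat_scale; [exact: cs'|exact: cmF|exact: cs|exact: cmG].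
  + by do ![apply: ctat_pair]; [exact: l1|exact: l2|exact: l3|exact: l4|exact: l5].
- move=> s t; have [_ Fz Fl Fs] := D (F t); have [_ Gz Gl Gs] := D (G t).
  move: Fz Gz Fl Gl; rewrite !ltr_norml => /andP[f1 f2] /andP[g1 g2] /andP[f3 f4] /andP[g3 g4].
  split; rewrite /rotor /tilt /half1 /half2/=.
  + exact: (set_mem (valP (h s t))).
  + rewrite ltr_norml (convex_lt (s01 s) f2 g2) andbT ltrNl.
    rewrite [X in X < _](_ : _ = (1 - val s) * (- tilt (val (F t))) + val s * (- tilt (val (G t)))).
      by apply: convex_lt => //; rewrite ltrNl.
    by rewrite /lin; ring.
  + rewrite ltr_norml; apply/andP; split.
      rewrite ltrNl [X in X < _](_ : _ = (1 - val s) * (- (half1 (val (F t)) - half2 (val (F t))))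
        + val s * (- (half1 (val (G t)) - half2 (val (G t))))); last by rewrite /lin; ring.
      by apply: convex_lt => //; rewrite ltrNl.
    rewrite [X in X < _](_ : _ = (1 - val s) * (half1 (val (F t)) - half2 (val (F t)))
        + val s * (half1 (val (G t)) - half2 (val (G t)))); last by rewrite /lin; ring.
    exact: convex_lt.
  + rewrite -ltrN2 [X in X < _](_ : _ = (1 - val s) * (- (half1 (val (F t)) + half2 (val (F t))))
        + val s * (- (half1 (val (G t)) + half2 (val (G t))))); last by rewrite /lin; ring.
    by apply: convex_lt => //; rewrite ltrN2.
- move=> t; rewrite /H h0 FqE /lin val_zero subr0 !scale1r !scale0r !mul1r !mul0r !addr0.
  by rewrite [RHS]param_eta.
- move=> t; rewrite /H h1 GqE /lin val_one subrr !scale1r !scale0r !mul1r !mul0r !add0r.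
  by rewrite [RHS]param_eta.
- move=> s; rewrite /H hx /lin [F zero]path_zero [G zero]path_zero -scalerDl -!mulrDl.
  by rewrite subrK scale1r !mul1r [RHS]param_eta.
- move=> s; rewrite /H hy /lin [F one]path_one [G one]path_one -scalerDl -!mulrDl.
  by rewrite subrK scale1r !mul1r [RHS]param_eta.
Qed.

End HopfCovering.

(** * Monodromy of loops of links *)

Section Monodromy.
Variable R : realType.
Local Notation I := (unit_interval R).
Local Notation space := (ring_space (@hopf_link R)).
Local Notation base := (ring_base (@hopf_link R)).
Local Notation loop := {path I from base to base}.

(** The parameters of the Hopf link, whose rings cut the chords [-1, 1] and [0, 2] out
of the second axis; p is halfway between their midpoints 0 and 1. *)
Definition base_param : param R := (quat4 1 0 0 0, vec3 0 2^-1 0, (0, 0, 0, 1, 1)).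

Lemma base_paramP : hopf_params base_param.
Proof.
split; rewrite /rotor /tilt /half1 /half2/=.
- apply/eqP => /(congr1 (@qa R)); rewrite !qE => /eqP; by rewrite oner_eq0.
- by rewrite normr0.
- by rewrite subrr normr0.
- by rewrite ltrDl.
Qed.

Definition base_point : hopf_space R :=
  exist (fun e => e \in @hopf_params R) base_param (mem_set base_paramP).

Lemma axis_norm0 : axis_norm 0 = 1 :> R.
Proof. by rewrite /axis_norm expr0n addr0 sqrtr1. Qed.

(** Along a motion by isometries only q and p move. *)
Lemma moved_frames (g : 'rV[R]_3 -> 'rV[R]_3) (q : 'rV[R]_4) : qnorm2 q = 1 ->
  (forall v, g v - g 0 = rot q v) ->
  pair_frames (q, g (vec3 0 2^-1 0), (0, 0, 0, 1, 1)) = fun i => act g (hopf_frames R i).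
Proof.
move=> q1 gq; apply/funext => i; rewrite /pair_frames /act /hopf_frames.
have s1 : Num.sqrt (1 ^+ 2 + 0 ^+ 2 * (1 + 0 ^+ 2)) = 1 :> R.
  by rewrite expr1n expr0n mul0r addr0 sqrtr1.
have gE v : g v = g 0 + rot q v by rewrite -gq addrC subrK.
case: ifP => _; [rewrite /frame1|rewrite frame2E]; rewrite /rotor /mid /tilt /off1 /off2 /half1 /half2/=.
  rewrite q1 s1 axis_norm0 !mul1r invr1 scale1r mul0r oppr0 /center/= -(gq (vec3 0 0 1)).
  congr (_, _, _); rewrite (gE (vec3 0 2^-1 0)) -addrA -rotD.
  rewrite (_ : vec3 _ _ _ + _ = 0); last by apply: vecP; rewrite !pE; field.
  by rewrite -gq subrr addr0.
rewrite q1 s1 axis_norm0 !mul1r invr1 scale1r mul0r oppr0 /center/= -(gq (vec3 1 0 0)).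
congr (_, _, _); rewrite (gE (vec3 0 2^-1 0)) (gE (e2 R)) -addrA -rotD; congr (_ + rot q _).
by apply: vecP; rewrite !pE; field.
Qed.

Lemma qnorm2_1 : qnorm2 (quat4 1 0 0 0) = 1 :> R.
Proof. by rewrite /qnorm2 /qdot !qE; ring. Qed.

Lemma rot_1 (v : 'rV[R]_3) : rot (quat4 1 0 0 0) v = v.
Proof. by apply: vecP; rewrite !pE !qE; ring. Qed.

Lemma hopf_cover_base : hopf_cover base_point = hopf_link R.
Proof.
congr link_of; apply: val_inj; rewrite /= (moved_frames (g := id) qnorm2_1).
  by apply/funext => i; rewrite /act subr0; case: (hopf_frames R i) => -[].
by move=> v; rewrite subr0 rot_1.
Qed.

Definition lifts_to (f : loop) (y : hopf_space R) : Prop :=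
  exists F : I -> hopf_space R, [/\ continuous F, F zero = base_point, F one = y &
    forall t, hopf_cover (F t) = val (f t)].

Let hc := hopf_covering R.
Let hh := @hopf_space_hausdorff R.

Lemma range_clopen : clopen (range (@hopf_cover R)).
Proof.
split; last exact: cov_closed hc.
by apply: (cov_open hc); exact: openT.
Qed.

Lemma cts_loop (f : loop) : continuous (fun t => val (f t)).
Proof.
apply: (cts_comp (f := f) (g := fun x : space => val x)); first exact: cts_fun.
exact: initial_continuous.
Qed.

Lemma range_start (f : I -> ring_link (setT : set 'rV[R]_3) 2) : continuous f ->
  f zero = hopf_link R -> forall t, range (@hopf_cover R) (f t).
Proof.
move=> cf f0; apply: unit_clopen cf range_clopen _.
by rewrite f0 -hopf_cover_base; exists base_point.
Qed.

Lemma lifts_exist (f : loop) : exists y, lifts_to f y.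
Proof.
have cf := @cts_loop f; have f0 : val (f zero) = hopf_link R by rewrite [f zero]path_zero.
have [|||F [cF qF F0]] := lift_square hc (f := fun s t => val (f t)) (e := base_point).
- by apply: (cts_comp (f := fun p : I * I => p.2) _ cf); cts.
- by move=> _; exact: range_start.
- by rewrite f0 hopf_cover_base.
exists (F zero one), (F zero); split=> //.
by apply: (cts_comp (f := fun t : I => (zero, t)) _ cF); cts.
Qed.

(** The lift of a homotopy is constant along the sides on which the homotopy is, by
uniqueness of lifts. *)
Lemma lifts_homotopic (f f' : loop) y y' : homotopic f f' ->
  lifts_to f y -> lifts_to f' y' -> y = y'.
Proof.
move=> [h [ch h0 h1 hx hy]] [F [cF F0 F1 Ff]] [F' [cF' F0' F1' Ff']].
have chv : continuous (fun p : I * I => val (h p.1 p.2)).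
  apply: (cts_comp (f := fun p : I * I => h p.1 p.2) ch (g := fun x : space => val x)).
  exact: initial_continuous.
have cl s : continuous (fun t => val (h s t)).
  by apply: (cts_comp (f := fun t : I => (s, t)) _ chv); cts.
have [|||H [cH qH H0]] := lift_square hc (f := fun s t => val (h s t)) (e := base_point).
- exact: chv.
- by move=> s; apply: range_start => //; rewrite hx.
- by rewrite hx hopf_cover_base.
have cHl s : continuous (fun t => H s t).
  by apply: (cts_comp (f := fun t : I => (s, t)) _ cH); cts.
have cHr t : continuous (fun s => H s t).
  by apply: (cts_comp (f := fun s : I => (s, t)) _ cH); cts.
have Hx s : H s zero = base_point.
  apply: (lift_unique hc hh (cHr zero) (@cts_cst _ _ base_point)) => // r.
  by rewrite qH hx hopf_cover_base.
have Hy s : H s one = H zero one.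
  apply: (lift_unique hc hh (cHr one) (@cts_cst _ _ (H zero one))) => // r.
  by rewrite !qH !hy.
have <- : H zero one = y.
  rewrite -F1; apply: (lift_unique hc hh (cHl zero) cF) => [t|].
    by rewrite qH h0 Ff.
  by rewrite Hx F0.
rewrite -(Hy one) -F1'; apply: (lift_unique hc hh (cHl one) cF') => [t|].
  by rewrite qH h1 Ff'.
by rewrite Hx F0'.
Qed.

(** The two lifts are homotopic in the simply connected space of parameters, and the
homotopy is pushed down. *)
Lemma lifts_same_end (f f' : loop) y : lifts_to f y -> lifts_to f' y -> homotopic f f'.
Proof.
move=> [F [cF F0 F1 Ff]] [F' [cF' F0' F1' Ff']].
have [h [ch h0 h1 hx hy]] :=
  hopf_space_simply_connected (mk_path cF F0 F1) (mk_path cF' F0' F1').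
have cq : continuous (fun p : I * I => hopf_cover (h p.1 p.2)).
  by apply: (cts_comp (f := fun p : I * I => h p.1 p.2) ch); exact: cov_continuous hc.
apply: (sub_homotopic (h := fun s t => hopf_cover (h s t))) => //.
- move=> s t; rewrite /ring_space /isotopic/=.
  split; apply: (@mk_path _ _ _ _ (fun u : I => hopf_cover (h s (clamp (val u * val t))))).
  + apply: (cts_comp (f := fun u : I => (s, clamp (val u * val t))) _ cq); cts.
  + have -> : clamp (val (zero : I) * val t) = zero by rewrite val_zero mul0r.
    by rewrite hx hopf_cover_base.
  + by rewrite val_one mul1r valK_clamp.
- by move=> t; rewrite h0 -Ff.
- by move=> t; rewrite h1 -Ff'.
- by move=> s; rewrite hx hopf_cover_base.
- by move=> s; rewrite hy -F1 Ff [f one]path_one.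
Qed.

(** The lift of f ends on the sheet reached by g, where the lift of f' is continued by
its image under g. So concatenation of loops becomes composition of deck
transformations, in the same order. *)
Lemma lifts_concat (f f' : loop) (g : hopf_space R -> hopf_space R) y :
  continuous g -> (forall x, hopf_cover (g x) = hopf_cover x) ->
  lifts_to f (g base_point) -> lifts_to f' y -> lifts_to (concat f f') (g y).
Proof.
move=> cg gc [F [cF F0 F1 Ff]] [F' [cF' F0' F1' Ff']].
have cgF : continuous (fun t => g (F' t)) by exact: (cts_comp cF' cg).
have gF0 : g (F' zero) = g base_point by rewrite F0'.
have gF1 : g (F' one) = g y by rewrite F1'.
pose P := concat (mk_path cF F0 F1) (mk_path cgF gF0 gF1).
exists P; split=> [||| t].
- exact: cts_fun.
- exact: path_zero.
- exact: path_one.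
rewrite !concatE; case: ifP => _; first exact: Ff.
by rewrite -Ff'; exact: gc.
Qed.

Lemma lifts_reverse (f : loop) (g h : hopf_space R -> hopf_space R) :
  continuous h -> (forall x, hopf_cover (h x) = hopf_cover x) ->
  h (g base_point) = base_point ->
  lifts_to f (g base_point) -> lifts_to (reverse f) (h base_point).
Proof.
move=> ch hq hg [F [cF F0 F1 Ff]].
pose P := reverse (mk_path cF F0 F1).
exists (fun t => h (P t)); split=> [|||t].
- by apply: (cts_comp (f := P)) => //; exact: cts_fun.
- by rewrite [P zero]path_zero.
- by rewrite [P one]path_one.
by rewrite hq !reverseE Ff.
Qed.

Lemma lifts_cst : lifts_to (@cst_loop R _ base) base_point.
Proof.
exists (fun=> base_point); split=> // [|t]; first exact: cts_cst.
by rewrite hopf_cover_base.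
Qed.

Lemma lifts_motion (m : motion R) (m1 : moved (hopf_data R) m 1 = hopf_link R)
    (q : R -> 'rV[R]_4) (y : hopf_space R) :
  continuous q -> (forall t, qnorm2 (q t) = 1) -> q 0 = quat4 1 0 0 0 ->
  (forall t v, m t v - m t 0 = rot (q t) v) ->
  val y = (q 1, m 1 (vec3 0 2^-1 0), (0, 0, 0, 1, 1)) ->
  lifts_to (mk_path (@motion_continuous R 2 (hopf_data R) m) (motion_zero _ _) (motion_one m1)) y.
Proof.
move=> cq q1 q0 mq yE.
pose e (t : R) : param R := (q t, m t (vec3 0 2^-1 0), (0, 0, 0, 1, 1)).
have ce : continuous e.
  apply: cts_pair; last exact: cts_cst.
  by apply: cts_pair => //; exact: move_continuous.
have De t : hopf_params (e t).
  have [_ a b c] := base_paramP; split=> //.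
  by rewrite -qnorm2_eq0 q1 oner_eq0.
have cF := cts_sub_type (Af := De) ce.
exists (fun t : I => exist (fun e => e \in @hopf_params R) (e (val t)) (mem_set (De (val t)))).
split=> [|||t].
- exact: (cts_comp (@val_continuous R) cF).
- apply: val_inj; transitivity (e 0); first by congr e; exact: val_zero.
  by rewrite /e q0 move0.
- apply: val_inj; transitivity (e 1); first by congr e; exact: val_one.
  by rewrite yE.
congr link_of; apply: val_inj; rewrite [LHS]/= /e (moved_frames (g := m (val t)))//.
Qed.

End Monodromy.

(** * The two generators *)

Section Generators.
Variable R : realType.
Local Notation vec := 'rV[R]_3.
Local Notation quat := 'rV[R]_4.

Definition qroty (phi : R) : quat := quat4 (cos (phi / 2)) 0 (sin (phi / 2)) 0.
Definition qrotx (phi : R) : quat := quat4 (cos (phi / 2)) (sin (phi / 2)) 0 0.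

Lemma half_angles (phi : R) : cos phi = cos (phi / 2) ^+ 2 - sin (phi / 2) ^+ 2 /\
  sin phi = 2 * cos (phi / 2) * sin (phi / 2).
Proof.
have e : phi = phi / 2 *+ 2 by rewrite -mulr_natr; field.
by split; rewrite [in LHS]e ?cos_mulr2n ?sin_mulr2n ?sin2cos2 -mulr_natr; ring.
Qed.

Lemma qnorm2_qroty phi : qnorm2 (qroty phi) = 1.
Proof. by rewrite -[RHS](cos2Dsin2 (phi / 2)) /qnorm2 /qdot !qE; ring. Qed.

Lemma qnorm2_qrotx phi : qnorm2 (qrotx phi) = 1.
Proof. by rewrite -[RHS](cos2Dsin2 (phi / 2)) /qnorm2 /qdot !qE; ring. Qed.

Lemma rot_qroty phi v : rot (qroty phi) v = roty phi v.
Proof.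
have [c s] := half_angles phi; have cs := cos2Dsin2 (phi / 2).
rewrite /roty c s; apply: vecP; rewrite !pE !qE; [ring| |ring].
transitivity ((cos (phi / 2) ^+ 2 + sin (phi / 2) ^+ 2) * py v); first by ring.
by rewrite cs mul1r.
Qed.

Lemma rot_qrotx phi v : rot (qrotx phi) v = rotx phi v.
Proof.
have [c s] := half_angles phi; have cs := cos2Dsin2 (phi / 2).
rewrite /rotx c s; apply: vecP; rewrite !pE !qE; [|ring|ring].
transitivity ((cos (phi / 2) ^+ 2 + sin (phi / 2) ^+ 2) * px v); first by ring.
by rewrite cs mul1r.
Qed.

Lemma cts_qroty (c : R -> R) : continuous c -> continuous (fun t => qroty (c t)).
Proof.
move=> cc t; have ch : continuous (fun t => c t / 2) by cts.
have c1 := cts_comp ch (@continuous_cos R); have c2 := cts_comp ch (@continuous_sin R).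
by apply: ctat_quat4; [exact: c1|exact: ctat_cst|exact: c2|exact: ctat_cst].
Qed.

Lemma cts_qrotx (c : R -> R) : continuous c -> continuous (fun t => qrotx (c t)).
Proof.
move=> cc t; have ch : continuous (fun t => c t / 2) by cts.
have c1 := cts_comp ch (@continuous_cos R); have c2 := cts_comp ch (@continuous_sin R).
by apply: ctat_quat4; [exact: c1|exact: c2|exact: ctat_cst|exact: ctat_cst].
Qed.

Lemma qroty0 : qroty 0 = quat4 1 0 0 0.
Proof. by rewrite /qroty mul0r cos0 sin0. Qed.

Lemma qrotx0 : qrotx 0 = quat4 1 0 0 0.
Proof. by rewrite /qrotx mul0r cos0 sin0. Qed.

Lemma qmul1q (q : quat) : qmul (quat4 1 0 0 0) q = q.
Proof. by apply: quatP; rewrite /qmul !qE; ring. Qed.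

Definition tau_loop_path := mk_path (@motion_continuous R 2 (hopf_data R) (tau_motion R))
  (motion_zero _ _) (motion_one (tau_loop R)).
Definition s_loop_path := mk_path (@motion_continuous R 2 (hopf_data R) (s_motion R))
  (motion_zero _ _) (motion_one (s_loop R)).

(** The quaternion goes from 1 to j, along rotations about the second axis. *)
Lemma lifts_tau : lifts_to tau_loop_path (flip_deck (base_point R)).
Proof.
apply: (@lifts_motion R (tau_motion R) (tau_loop R) (fun t => qroty (pi * t))).
- by apply: cts_qroty; cts.
- by move=> t; exact: qnorm2_qroty.
- by rewrite mulr0 qroty0.
- move=> t v; rewrite /= /tau_move -!rot_qroty -rotB subr0; by [].
- rewrite /= /flip /rotor /mid /tilt /off1 /off2 /half1 /half2/= oppr0 mulr1.
  rewrite /qroty cos_pihalf sin_pihalf qmul1q /tau_move mulr1 /roty cospi sinpi.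
  by congr (_, _, _); apply: vecP; rewrite !pE; ring.
Qed.

Definition s_quat (t : R) : quat :=
  qmul (qroty (- (pi / 4) * stage 3 t)) (qmul (qrotx (pi * stage 2 t)) (qroty (pi / 4 * stage 1 t))).

(** With y the unit quaternion of the rotation by 45 degrees about the second axis,
the quaternion goes from 1 to y^-1 i y = (i + k) / sqrt 2, which is [swap_quat]. *)
Lemma lifts_s : lifts_to s_loop_path (swap_deck (base_point R)).
Proof.
have cst (a : R) i : continuous (fun t => a * stage i t).
  by apply: ctsM; [exact: cts_cst|exact: stage_continuous].
apply: (@lifts_motion R (s_motion R) (s_loop R) s_quat).
- move=> t; apply: ctat_qmul; first exact: (cts_qroty (cst _ _)).
  by apply: ctat_qmul; [exact: (cts_qrotx (cst _ _))|exact: (cts_qroty (cst _ _))].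
- by move=> t; rewrite /s_quat !qnorm2M !qnorm2_qroty qnorm2_qrotx !mulr1.
- by rewrite /s_quat !stage0 !mulr0 qroty0 qrotx0 !qmul1q.
- move=> t v; rewrite /s_quat !rotM !rot_qroty rot_qrotx /= /s_move.
  rewrite -!rot_qroty -!rot_qrotx !rotD.
  rewrite (_ : rot _ 0 = 0); last by apply: vecP; rewrite !pE; ring.
  rewrite opprD addrACA subrr addr0 (_ : rot _ 0 = 0); last by apply: vecP; rewrite !pE; ring.
  rewrite (_ : rot _ 0 = 0); last by apply: vecP; rewrite !pE; ring.
  by rewrite add0r addrK.
- rewrite /= s_move1 !pE /swap /rotor /mid /tilt /off1 /off2 /half1 /half2/= qmul1q.
  have c : cos (pi / 4 : R) = cos (pi / 4 / 2) ^+ 2 - sin (pi / 4 / 2) ^+ 2.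
    by have [] := half_angles (pi / 4 : R).
  have s : sin (pi / 4 : R) = 2 * cos (pi / 4 / 2) * sin (pi / 4 / 2).
    by have [] := half_angles (pi / 4 : R).
  congr (_, _, _); last by apply: vecP; rewrite !pE; field.
  rewrite /s_quat !stage1// !mulr1 /qroty /qrotx cos_pihalf sin_pihalf mulNr cosN sinN.
  by apply: quatP; rewrite /qmul !qE ?c ?s; ring.
Qed.

Lemma ring_mulE (f g : {path (unit_interval R) from ring_base (@hopf_link R) to ring_base (@hopf_link R)}) :
  ((homotopy_class f : ring_group (@hopf_link R)) * homotopy_class g)%g = homotopy_class (concat f g).
Proof. exact: pi1_mulE. Qed.

Definition letter_deck (l : hopf_generator * bool) : hopf_space R -> hopf_space R :=
  match l with
  | (gen_tau, true) => @flip_deck R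
  | (gen_tau, false) => fun x => flip_deck (flip_deck (flip_deck x))
  | (gen_s, true) => @swap_deck R
  | (gen_s, false) => fun x => flip_deck (flip_deck (swap_deck x))
  end.

Definition word_deck (w : word hopf_generator) (x : hopf_space R) : hopf_space R :=
  foldr letter_deck x w.

Lemma letter_deck_continuous l : continuous (letter_deck l).
Proof.
have cf := @flip_deck_continuous R; have cs := @swap_deck_continuous R.
have cff := cts_comp cf cf.
case: l => -[] [] //=; [exact: (cts_comp cff cf)|exact: (cts_comp cs cff)].
Qed.

Lemma letter_deck_cover l x : hopf_cover (letter_deck l x) = hopf_cover x.
Proof. by case: l => -[] [] /=; rewrite ?hopf_cover_flip ?hopf_cover_swap ?hopf_cover_flip. Qed.

Lemma letter_deckK i x : letter_deck (i, false) (letter_deck (i, true) x) = x.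
Proof. by case: i => /=; rewrite ?swap_deck2 flip_deck4. Qed.

Local Notation gens := (hopf_generators R).

Lemma letter_lifts l : exists2 f, eval_letter gens l = homotopy_class f &
  lifts_to f (letter_deck l (base_point R)).
Proof.
have H i f : gens i = homotopy_class f -> lifts_to f (letter_deck (i, true) (base_point R)) ->
    forall b, exists2 f, eval_letter gens (i, b) = homotopy_class f &
      lifts_to f (letter_deck (i, b) (base_point R)).
  move=> gi fl [|]; first by exists f.
  exists (reverse f); first by rewrite /eval_letter/= gi; exact: pi1_invE.
  apply: (lifts_reverse (g := letter_deck (i, true))) fl.
  - exact: letter_deck_continuous.
  - by move=> x; exact: letter_deck_cover.
  - exact: letter_deckK.
case: l => -[] b.
  by apply: (H gen_tau tau_loop_path) => //; exact: lifts_tau.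
by apply: (H gen_s s_loop_path) => //; exact: lifts_s.
Qed.

Lemma word_lifts w : exists2 f, eval_word gens w = homotopy_class f &
  lifts_to f (word_deck w (base_point R)).
Proof.
elim: w => [|l w [f' wf' lf']].
  by exists (@cst_loop R _ (ring_base (@hopf_link R))); [|exact: lifts_cst].
have [f lf ff] := letter_lifts l.
exists (concat f f'); first by rewrite /= lf wf'; exact: ring_mulE.
apply: lifts_concat ff lf'; first exact: letter_deck_continuous.
by move=> x; exact: letter_deck_cover.
Qed.

(** Loops are homotopic exactly when their lifts have the same end, so the ring group
can be computed in the group of deck transformations. *)
Lemma eval_wordP u v : eval_word gens u = eval_word gens v <->
  word_deck u (base_point R) = word_deck v (base_point R).
Proof.
have [f -> lf] := word_lifts u; have [g -> lg] := word_lifts v.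
split=> [/homotopy_classP h|e]; first exact: lifts_homotopic h lf lg.
by apply/homotopy_classP; apply: lifts_same_end lf _; rewrite e.
Qed.

Local Notation t := (gen_tau, true).
Local Notation s := (gen_s, true).

Definition normal_word (k : nat) (b : bool) : word hopf_generator :=
  nseq k t ++ (if b then [:: s] else [::]).

Lemma normal_word_deck k b x : word_deck (normal_word k b) x = deck k b x.
Proof.
rewrite /normal_word /deck; elim: k => [|k IH]; first by case: b.
by rewrite /= IH.
Qed.

(** The lift of a loop ends at some [deck k b] of the base point, which is also where
the lift of the word tau^k s^b ends. *)
Lemma eval_surjective (g : ring_group (@hopf_link R)) : exists w, eval_word gens w = g.
Proof.
have [f ->] : exists f, g = homotopy_class f := homotopy_classK g.
have [y ly] := lifts_exist f.
have [k [b [_ yE]]] : exists k b, (k < 4)%N /\ y = deck k b (base_point R).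
  apply: hopf_cover_fibre; have [F [cF F0 F1 Ff]] := ly.
  by rewrite -F0 -F1 !Ff [f zero]path_zero [f one]path_one.
exists (normal_word k b); have [f' -> lf'] := word_lifts (normal_word k b).
apply/homotopy_classP; apply: lifts_same_end lf' _.
by rewrite normal_word_deck -yE.
Qed.

Lemma sin_pi4_cos : sin (pi / 4) = cos (pi / 4) :> R.
Proof.
have c2 := @cos2_pi4 R; have cs := @cos_sin_pi4 R.
have C0 : cos (pi / 4) != 0 :> R.
  by apply/eqP => C0; move: c2; rewrite C0 expr0n/=; lra.
by apply: (mulfI C0); rewrite cs -expr2 c2.
Qed.

(** The eight quaternions 1, j, -1, -j and c (i + k), c (- i + k), c (- i - k),
c (i - k), where c = cos (pi / 4). *)
Lemma rotor_deck_base k b : (k < 4)%N ->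
  let C := cos (pi / 4) in
  rotor (val (deck k b (base_point R))) =
  nth 0 (if b then [:: quat4 0 C 0 C; quat4 0 (- C) 0 C; quat4 0 (- C) 0 (- C); quat4 0 C 0 (- C)]
         else [:: quat4 1 0 0 0; quat4 0 0 1 0; quat4 (-1) 0 0 0; quat4 0 0 (-1) 0]) k.
Proof.
move=> k4 C; have f q : rotor (flip q) = qmul (rotor q) (@flip_quat R) by [].
have d0 : rotor (val (deck 0 b (base_point R))) = if b then quat4 0 C 0 C else quat4 1 0 0 0.
  by case: b; rewrite /deck/= /rotor/= /swap_quat ?sin_pi4_cos ?qmul1q.
have dS j : rotor (val (deck j.+1 b (base_point R))) =
    qmul (rotor (val (deck j b (base_point R)))) (@flip_quat R) by [].
case: k k4 => [|[|[|[|//]]]] _; rewrite !(dS, d0); case: b {d0 dS} => //=;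
  by apply: quatP; rewrite /qmul !qE; ring.
Qed.

Lemma deck_base_inj k b k' b' : (k < 4)%N -> (k' < 4)%N ->
  deck k b (base_point R) = deck k' b' (base_point R) -> k = k' /\ b = b'.
Proof.
have C0 : cos (pi / 4) != 0 :> R.
  by apply/eqP => C0; have := @cos2_pi4 R; rewrite C0 expr0n/=; lra.
move=> k4 k4' /(congr1 (fun x => rotor (val x))); rewrite !rotor_deck_base//=.
move: (cos (pi / 4)) C0 => C C0 e.
have [ea eb ec ed] := And4 (congr1 (@qa R) e) (congr1 (@qb R) e)
  (congr1 (@qc R) e) (congr1 (@qd R) e).
clear e; have C0' : C = 0 -> False by move/eqP: C0.
move: k4 k4' ea eb ec ed; case: k => [|[|[|[|//]]]] _; case: k' => [|[|[|[|//]]]] _;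
  case: b; case: b'; rewrite /= !qE => ea eb ec ed; try by [];
  exfalso; first [lra | apply: C0'; lra].
Qed.

End Generators.

(** * The presented group has at most eight elements *)

Section Presentation.
Local Notation t := (gen_tau, true).
Local Notation tV := (gen_tau, false).
Local Notation s := (gen_s, true).
Local Notation sV := (gen_s, false).

Definition hopf_relations : set (word hopf_generator * word hopf_generator) :=
  [set ([:: t; t; t; t], [::]); ([:: s; s], [:: t; t]); ([:: s; t; sV], [:: tV])].

Local Notation "u ~~> v" := (word_congruence hopf_relations u v) (at level 70).

Let cl u v w : v ~~> w -> u ++ v ~~> u ++ w.
Proof. by apply: wc_cat; exact: wc_refl. Qed.
Let cr u v w : u ~~> v -> u ++ w ~~> v ++ w.
Proof. by move=> uv; apply: wc_cat => //; exact: wc_refl. Qed.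

Lemma congr_tau4 : [:: t; t; t; t] ~~> [::].
Proof. by apply: wc_rel; left; left. Qed.
Lemma congr_ss : [:: s; s] ~~> [:: t; t].
Proof. by apply: wc_rel; left; right. Qed.
Lemma congr_conj : [:: s; t; sV] ~~> [:: tV].
Proof. by apply: wc_rel; right. Qed.

Lemma congr_tauV : [:: tV] ~~> [:: t; t; t].
Proof.
apply: (wc_trans (v := [:: tV; t; t; t; t])).
  exact: (cl [:: tV] (wc_sym congr_tau4)).
exact: (cr [:: t; t; t] (wc_cancel _ gen_tau false)).
Qed.

Lemma congr_sV : [:: sV] ~~> [:: s; t; t].
Proof.
apply: (wc_trans (v := [:: sV; s; s; t; t])).
  apply: (wc_trans (v := [:: sV; t; t; t; t])).
    exact: (cl [:: sV] (wc_sym congr_tau4)).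
  exact: (cl [:: sV] (cr [:: t; t] (wc_sym congr_ss))).
exact: (cr [:: s; t; t] (wc_cancel _ gen_s false)).
Qed.

Lemma congr_st : [:: s; t] ~~> [:: t; t; t; s].
Proof.
apply: (wc_trans (v := [:: s; t; sV; s])).
  exact: (cl [:: s; t] (wc_sym (wc_cancel _ gen_s false))).
apply: (wc_trans (v := [:: tV; s])); first exact: (cr [:: s] congr_conj).
exact: (cr [:: s] congr_tauV).
Qed.

Lemma congr_s_tau k : s :: nseq k t ~~> nseq (3 * k)%N t ++ [:: s].
Proof.
elim: k => [|k IH]; first exact: wc_refl.
apply: (wc_trans (v := [:: t; t; t; s] ++ nseq k t)); first exact: (cr _ congr_st).
rewrite mulnS; exact: (cl [:: t; t; t] IH).
Qed.

Lemma congr_mod k b : normal_word k b ~~> normal_word (k %% 4)%N b.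
Proof.
rewrite {1}(divn_eq k 4); elim: (k %/ 4)%N => [|m IH]; first exact: wc_refl.
apply: wc_trans IH; rewrite mulSn -addnA.
exact: (cr _ congr_tau4).
Qed.

(** As s tau = tau^3 s modulo the relations, all letters s can be moved to the right;
as s s = tau^2, at most one is left. *)
Lemma normal_form w : exists k b, (k < 4)%N /\ w ~~> normal_word k b.
Proof.
suff [k [b wE]] : exists k b, w ~~> normal_word k b.
  by exists (k %% 4)%N, b; rewrite ltn_mod; split=> //; exact: wc_trans wE (congr_mod k b).
have Hs k b : exists k' b', s :: normal_word k b ~~> normal_word k' b'.
  have e : s :: normal_word k b ~~> nseq (3 * k)%N t ++ [:: s] ++ (if b then [:: s] else [::]).
    rewrite catA; exact: (cr _ (congr_s_tau k)).
  case: b e => e; last by exists (3 * k)%N, true.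
  exists (3 * k + 2)%N, false; apply: wc_trans e _.
  by rewrite /normal_word cats0 nseqD; apply: cl; exact: congr_ss.
have Ht n k b : nseq n t ++ normal_word k b = normal_word (n + k)%N b.
  by rewrite /normal_word catA nseqD.
elim: w => [|l w [k [b wE]]]; first by exists 0%N, false; exact: wc_refl.
have lw : l :: w ~~> l :: normal_word k b by exact: (cl [:: l] wE).
case: l lw => -[] [] lw.
- by exists (1 + k)%N, b; rewrite -Ht.
- exists (3 + k)%N, b; apply: wc_trans lw _; rewrite -Ht; exact: (cr _ congr_tauV).
- have [k' [b' e]] := Hs k b; exists k', b'; exact: wc_trans lw e.
- have [k' [b' e]] := Hs (2 + k)%N b; exists k', b'; apply: wc_trans lw _.
  apply: wc_trans e; rewrite -Ht; exact: (cr _ congr_sV).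
Qed.

Lemma deck_conj (T : Type) (f g : T -> T) :
  (forall x, f (f (f (f x))) = x) -> (forall x, g (g x) = f (f x)) ->
  (forall x, f (g (f x)) = g x) -> forall x, g (f (f (f (g x)))) = f (f (f x)).
Proof.
move=> f4 g2 fgf x.
have e y : g (f y) = f (f (f (g y))) by rewrite -[in RHS](fgf y) f4.
by rewrite !e g2 !f4.
Qed.

Section Evaluation.
Variable R : realType.
Local Notation gens := (hopf_generators R).

Lemma eval_cat u v : eval_word gens (u ++ v) = (eval_word gens u * eval_word gens v)%g.
Proof. by elim: u => [|l u IH] /=; rewrite ?mul1g // IH mulgA. Qed.

Lemma eval_congr u v : u ~~> v -> eval_word gens u = eval_word gens v.
Proof.
elim=> {u v} [u|u v _ ->|u v w _ -> _ ->|u u' v v' _ uu' _ vv'|i b|u v uv] //.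
- by rewrite !eval_cat uu' vv'.
- by rewrite /= mulg1 /eval_letter/=; case: b => /=; rewrite ?mulgV ?mulVg.
apply/eval_wordP; case: uv => [[|]|] -[-> ->] /=.
- exact: flip_deck4.
- exact: swap_deck2.
- exact: (deck_conj (@flip_deck4 R) (@swap_deck2 R) (@flip_swap R)).
Qed.

(** Words with equal values have the same normal form, since the eight normal forms
carry the base point to different points. *)
Lemma congr_eval u v : eval_word gens u = eval_word gens v -> u ~~> v.
Proof.
have [k [b [k4 uk]]] := normal_form u; have [k' [b' [k4' vk]]] := normal_form v.
rewrite (eval_congr uk) (eval_congr vk) => /eval_wordP; rewrite !normal_word_deck.
move=> /(deck_base_inj k4 k4')[kk bb]; rewrite -kk -bb in vk.
exact: wc_trans uk (wc_sym vk).
Qed.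

End Evaluation.
End Presentation.

Theorem theorem6p6 (R : realType) :
  let t := (gen_tau, true) in let tV := (gen_tau, false) in
  let s := (gen_s, true) in let sV := (gen_s, false) in
  has_presentation (hopf_generators R)
    [set ([:: t; t; t; t], [::]); ([:: s; s], [:: t; t]);
         ([:: s; t; sV], [:: tV])].
Proof.
split; first exact: eval_surjective.
by move=> u v; split; [exact: congr_eval|exact: eval_congr].
Qed.
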